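(* Let $H:[0,T]\times\mathbb{R}^n\times\mathbb{R}^n\to\mathbb{R}$ satisfy (H1)–(H4) and (HLC), where $H$ (jointly in $(t,x,p)$), $c(\cdot)$ and each $k_R(\cdot)$ are continuous. Let $(\mathbb{R}^{n+1},f,l)$ be the Steiner representation of $H$ and $g:\mathbb{R}^n\to\mathbb{R}$ locally Lipschitz. Then the value function $$V(t_0,x_0)=\inf_{(x,a)(\cdot)\in S_f(t_0,x_0)}\Big\{g(x(T))+\int_{t_0}^T l(t,x(t),a(t))\,dt\Big\}$$ is locally Lipschitz continuous on $[0,T]\times\mathbb{R}^n$.
   Context: Hypotheses: (H1) $H(\cdot,x,p)$ Lebesgue measurable; (H2) $H(t,\cdot,\cdot)$ continuous; (H3) $H(t,x,\cdot)$ convex; (H4) there is measurable $c\ge0$ with $|H(t,x,p)-H(t,x,q)|\le c(t)(1+|x|)|p-q|$; (HLC) for each $R>0$ there is measurable $k_R\ge0$ with $|H(t,x,p)-H(t,y,p)|\le k_R(t)(1+|p|)|x-y|$ for $x,y\in\bar B_R$, all $p$. $H^*(t,x,v)=\sup_p\{\langle v,p\rangle-H(t,x,p)\}$. $S_f(t_0,x_0)$: pairs $x(\cdot)$ absolutely continuous on $[t_0,T]$, $a(\cdot)\in L^1([t_0,T],\mathbb{R}^{n+1})$, with $\dot x=f(t,x,a)$ a.e. and $x(t_0)=x_0$. Steiner representation: $E(t,x)=\mathrm{epi}\,H^*(t,x,\cdot)\subset\mathbb{R}^{n+1}$; $\Phi(t,x,a)=E(t,x)\cap\bar B(a,2d(a,E(t,x)))$;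 Steiner point $s_m(K)=m\int_{S^{m-1}}p\max_{y\in K}\langle p,y\rangle\,\mu(dp)$ ($\mu$ normalized rotation-invariant measure on the unit sphere); $(f,l)(t,x,a)=s_{n+1}(\Phi(t,x,a))$ with $f\in\mathbb{R}^n$, $l\in\mathbb{R}$. *)

(* Defs.v *)
From HB Require Import structures.
From mathcomp Require Import all_boot all_order all_algebra.
From mathcomp Require Import all_classical all_reals all_analysis.
Set Implicit Arguments. Unset Strict Implicit. Unset Printing Implicit Defensive.
Import Order.TTheory GRing.Theory Num.Theory.
Import numFieldNormedType.Exports.
Local Open Scope classical_set_scope.
Local Open Scope ring_scope.

Section Defs.
Variable R : realType.

Definition dotv m (u v : 'rV[R]_m) : R := \sum_(i < m) u 0 i * v 0 i.
Definition enorm m (v : 'rV[R]_m) : R := Num.sqrt (dotv v v).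

Notation Borel m := (g_sigma_algebraType (@open 'rV[R]_m)).

(* mu is the normalized rotation-invariant (probability) measure on the
   unit sphere S^{m-1} of R^m.  Such a measure exists and is unique on the
   Borel sets. *)
Definition sphere_measure m (mu : {measure set (Borel m) -> \bar R}) : Prop :=
  [/\ mu setT = 1%E,
      mu [set p : Borel m | enorm p != 1] = 0%E &
      forall Q : 'M[R]_m, Q *m Q^T = 1%:M ->
        forall A : set (Borel m), measurable A ->
          mu [set p : Borel m | (p *m Q : Borel m) \in A] = mu A].

Definition supfun m (K : set 'rV[R]_m) (p : 'rV[R]_m) : R :=
  sup [set dotv p y | y in K].

Definition steiner m (mu : {measure set (Borel m) -> \bar R})
    (K : set 'rV[R]_m) : 'rV[R]_m :=
  \row_(i < m) (m%:R * fine (\int[mu]_(p in setT)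
                    ((p : 'rV[R]_m) 0 i * supfun K p)%:E)).

Definition Hstar n (H : R -> 'rV[R]_n -> 'rV[R]_n -> R) t x (v : 'rV[R]_n)
  : \bar R := ereal_sup [set (dotv v p - H t x p)%:E | p in [set: 'rV[R]_n]].

Definition fpart n (y : 'rV[R]_n.+1) : 'rV[R]_n :=
  \row_(i < n) y 0 (widen_ord (leqnSn n) i).
Definition lpart n (y : 'rV[R]_n.+1) : R := y 0 ord_max.

Definition epiH n (H : R -> 'rV[R]_n -> 'rV[R]_n -> R) t x : set 'rV[R]_n.+1 :=
  [set y | (Hstar H t x (fpart y) <= (lpart y)%:E)%E].

Definition edist m (a : 'rV[R]_m) (E : set 'rV[R]_m) : R :=
  inf [set enorm (a - y) | y in E].

Definition PhiH n (H : R -> 'rV[R]_n -> 'rV[R]_n -> R) t x (a : 'rV[R]_n.+1)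
  : set 'rV[R]_n.+1 :=
  epiH H t x `&` [set y | enorm (y - a) <= 2 * edist a (epiH H t x)].

Definition steiner_fl n (mu : {measure set (Borel n.+1) -> \bar R})
  (H : R -> 'rV[R]_n -> 'rV[R]_n -> R) t x a : 'rV[R]_n.+1 :=
  steiner mu (PhiH H t x a).
Definition steiner_f n mu H t x a : 'rV[R]_n := fpart (@steiner_fl n mu H t x a).
Definition steiner_l n mu H t x a : R := lpart (@steiner_fl n mu H t x a).

Definition abs_cont_on n (t0 T : R) (x : R -> 'rV[R]_n) : Prop :=
  forall e : R, 0 < e -> exists2 d : R, 0 < d &
    forall (k : nat) (u v : nat -> R),
      (forall i, (i < k)%N -> t0 <= u i /\ u i <= v i /\ v i <= T) ->
      (forall i j, (i < j < k)%N -> v i <= u j) ->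
      \sum_(i < k) (v i - u i) < d ->
      \sum_(i < k) enorm (x (v i) - x (u i)) < e.

Definition admissible n (f : R -> 'rV[R]_n -> 'rV[R]_n.+1 -> 'rV[R]_n)
    (T t0 : R) (x0 : 'rV[R]_n) (x : R -> 'rV[R]_n) (a : R -> 'rV[R]_n.+1) : Prop :=
  [/\ abs_cont_on t0 T x,
      (forall i : 'I_n.+1,
          (@lebesgue_measure R).-integrable `[t0, T] (fun t => (a t 0 i)%:E)),
      {ae @lebesgue_measure R, forall t, t \in `[t0, T] ->
          derivable x t 1 /\ 'D_1 x t = f t (x t) (a t)} &
      x t0 = x0].

Definition cost n (l : R -> 'rV[R]_n -> 'rV[R]_n.+1 -> R) (g : 'rV[R]_n -> R)
    (T t0 : R) (x : R -> 'rV[R]_n) (a : R -> 'rV[R]_n.+1) : \bar R :=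
  ((g (x T))%:E + \int[@lebesgue_measure R]_(t in `[t0, T]) (l t (x t) (a t))%:E)%E.

Definition value n f l g (T t0 : R) (x0 : 'rV[R]_n) : \bar R :=
  ereal_inf [set cost l g T t0 xa.1 xa.2 | xa in
              [set xa | @admissible n f T t0 x0 xa.1 xa.2]].

Definition loc_lipschitz_Rn n (g : 'rV[R]_n -> R) : Prop :=
  forall z, exists r, exists L, 0 < r /\
    forall y y', enorm (y - z) < r -> enorm (y' - z) < r ->
      `|g y - g y'| <= L * enorm (y - y').

Definition loc_lipschitz_on_strip n (T : R) (W : R -> 'rV[R]_n -> R) : Prop :=
  forall s z, 0 <= s <= T -> exists r, exists L, 0 < r /\
    forall s1 y1 s2 y2, 0 <= s1 <= T -> 0 <= s2 <= T ->
      `|s1 - s| < r -> enorm (y1 - z) < r ->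
      `|s2 - s| < r -> enorm (y2 - z) < r ->
      `|W s1 y1 - W s2 y2| <= L * (`|s1 - s2| + enorm (y1 - y2)).

End Defs.
Notation Borel R m := (g_sigma_algebraType (@open 'rV[R]_m)).

(* Main.v *)
Require Import Defs.
From HB Require Import structures.
From mathcomp Require Import all_boot all_order all_algebra.
From mathcomp Require Import all_classical all_reals all_analysis.
From mathcomp Require Import measurable_realfun ring lra.
Import Order.TTheory GRing.Theory Num.Theory.
Import numFieldNormedType.Exports.
Local Open Scope classical_set_scope.
Local Open Scope ring_scope.
Set Implicit Arguments.
Unset Strict Implicit.
Unset Printing Implicit Defensive.

(* The Steiner representation enters only through two facts: the Steiner point
   of a compact set lies below its support function, so [(f, l)(t, x, a)] lies
   in the epigraph [E(t, x)], and the Steiner point of a singleton is that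
   point, so a control [a(t)] in [E(t, x(t))] is reproduced by [(f, l)].  Hence
   the value function is that of the problem of minimising
   [g (y T) + \int eta] over curves [y] and integrable [eta] with
   [(y', eta)(t)] in [E(t, y(t))].

   For that problem the local Lipschitz estimates follow from a
   Filippov-Gronwall argument.  A curve satisfying the inclusion up to a defect
   [d] (measured against [1 + |p|]) is corrected iteratively: convexity of [H]
   yields a velocity within [O(d)] satisfying the inclusion at the old curve,
   and (HLC) bounds the defect this leaves at the new curve.  In exponentially
   weighted norms the corrections decrease geometrically, and the resulting
   exact trajectory costs at most [O(\int d)] more.  Translating a nearly
   optimal curve, or waiting at the initial point, creates a defect that is
   linear in the change of the initial data. *)

(** * Euclidean geometry of row vectors *)

(** Three obstacles shape the argument. Along an admissible pair the velocity is measurable because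
    it is a derivative almost everywhere, but nothing so direct applies to [l(t, x, a)]. It is
    replaced by the smaller cost [Hstar] at the velocity, a countable supremum, and the two
    integrals are compared by monotonicity alone. Corrected velocities must be measurable. They come
    from a penalised minimisation followed by rounding to rational vectors, and the rounding leaves
    a small defect, so that a single correction is never exact. Costs are only integrable, while
    (H4) bounds velocities by a multiple of [1 + |x|]. Uniform estimates therefore concern
    velocities, and costs enter through their integrals. The weight [1 + |p|] of a defect is that of
    (HLC), so displacing the curve by [r] adds [K r] to the defect. Correcting a defect [d] moves
    the velocity by at most [4 d]. Under the weight [exp (8 K t)] integration gains a factor
    [1 / (8 K)], so a correction halves the defect; the rounding error is kept within what this
    halving leaves free. *)

Section euclidean.
Context {R : realType} {m : nat}.
Implicit Types u v w : 'rV[R]_m.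

Lemma dotvC u v : dotv u v = dotv v u.
Proof. by apply: eq_bigr => i _; rewrite mulrC. Qed.

Lemma dotvDl u v w : dotv (u + v) w = dotv u w + dotv v w.
Proof. by rewrite -big_split; apply: eq_bigr => i _; rewrite mxE mulrDl. Qed.

Lemma dotvZl a u w : dotv (a *: u) w = a * dotv u w.
Proof. by rewrite /dotv mulr_sumr; apply: eq_bigr => i _; rewrite mxE mulrA. Qed.

Lemma dotvDr u v w : dotv w (u + v) = dotv w u + dotv w v.
Proof. by rewrite dotvC dotvDl !(dotvC _ w). Qed.

Lemma dotvZr a u w : dotv w (a *: u) = a * dotv w u.
Proof. by rewrite dotvC dotvZl dotvC. Qed.

Lemma dotvNl u w : dotv (- u) w = - dotv u w.
Proof. by rewrite -scaleN1r dotvZl mulN1r. Qed.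

Lemma dotvNr u w : dotv w (- u) = - dotv w u.
Proof. by rewrite dotvC dotvNl dotvC. Qed.

Lemma dotvBl u v w : dotv (u - v) w = dotv u w - dotv v w.
Proof. by rewrite dotvDl dotvNl. Qed.

Lemma dotvBr u v w : dotv w (u - v) = dotv w u - dotv w v.
Proof. by rewrite dotvDr dotvNr. Qed.

Lemma dotv0l w : dotv 0 w = 0.
Proof. by rewrite -(scale0r (0 : 'rV[R]_m)) dotvZl mul0r. Qed.

Lemma dotv0r w : dotv w 0 = 0.
Proof. by rewrite dotvC dotv0l. Qed.

Lemma dotvv_ge0 u : 0 <= dotv u u.
Proof. by apply: sumr_ge0 => i _; rewrite -expr2 sqr_ge0. Qed.

Lemma enorm_ge0 u : 0 <= enorm u.
Proof. exact: sqrtr_ge0. Qed.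

Lemma sqr_enorm u : enorm u ^+ 2 = dotv u u.
Proof. by rewrite sqr_sqrtr// dotvv_ge0. Qed.

Lemma enorm0 : enorm (0 : 'rV[R]_m) = 0.
Proof. by rewrite /enorm dotv0l sqrtr0. Qed.

Lemma enormZ a u : enorm (a *: u) = `|a| * enorm u.
Proof.
by rewrite /enorm dotvZl dotvZr mulrA -expr2 sqrtrM ?sqr_ge0// sqrtr_sqr.
Qed.

Lemma enormN u : enorm (- u) = enorm u.
Proof. by rewrite /enorm dotvNl dotvNr opprK. Qed.

Lemma enormB u v : enorm (u - v) = enorm (v - u).
Proof. by rewrite -enormN opprB. Qed.

Lemma le_sqr_enorm u (a : R) : 0 <= a -> dotv u u <= a ^+ 2 -> enorm u <= a.
Proof.
move=> a0 h; rewrite -(ler_pXn2r (n:=2))// ?nnegrE ?enorm_ge0//.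
by rewrite sqr_enorm.
Qed.

Lemma cauchy_schwarz u v : `|dotv u v| <= enorm u * enorm v.
Proof.
rewrite -(ler_pXn2r (n:=2)) ?nnegrE ?mulr_ge0 ?enorm_ge0//.
rewrite exprMn !sqr_enorm real_normK ?num_real//.
(* The square expands to [b * (a * b - c ^+ 2)] in the notation set below, which settles the case
   [b > 0]. *)
have := dotvv_ge0 (dotv v v *: u - dotv u v *: v).
rewrite !(dotvBl, dotvBr, dotvZl, dotvZr) (dotvC v u).
set a := dotv u u; set b := dotv v v; set c := dotv u v => h.
have b0 : 0 <= b := dotvv_ge0 v.
have [b00|bp] := eqVneq b 0.
  suff -> : c = 0 by rewrite b00 expr0n mulr0.
  rewrite /c /dotv big1// => i _.
  have /eqP := b00; rewrite /b /dotv psumr_eq0; last by move=> j _; rewrite -expr2 sqr_ge0.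
  by move=> /allP /(_ i (mem_index_enum i)); rewrite mulf_eq0 orbb => /eqP ->; rewrite mulr0.
have bgt : 0 < b by rewrite lt_neqAle eq_sym bp.
rewrite -subr_ge0 -(pmulr_rge0 _ bgt).
by apply: le_trans h _; rewrite le_eqVlt; apply/orP; left; apply/eqP; ring.
Qed.

Lemma dotv_le u v : dotv u v <= enorm u * enorm v.
Proof. exact: le_trans (ler_norm _) (cauchy_schwarz u v). Qed.

Lemma enormD u v : enorm (u + v) <= enorm u + enorm v.
Proof.
apply: le_sqr_enorm; first by rewrite addr_ge0 ?enorm_ge0.
rewrite !(dotvDl, dotvDr) (dotvC v u) sqrrD !sqr_enorm.
by have := dotv_le u v; lra.
Qed.

Lemma enorm_trans v u w : enorm (u - w) <= enorm (u - v) + enorm (v - w).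
Proof. by apply: le_trans (enormD _ _); rewrite addrA subrK. Qed.

Lemma enorm_le_add u v : enorm u <= enorm v + enorm (u - v).
Proof. by apply: le_trans (enormD _ _); rewrite addrC subrK. Qed.

Lemma coord_le_enorm u i : `|u 0 i| <= enorm u.
Proof.
rewrite -(ler_pXn2r (n:=2)) ?nnegrE ?enorm_ge0// sqr_enorm real_normK ?num_real//.
rewrite /dotv (bigD1 i)//= expr2 lerDl.
by apply: sumr_ge0 => j _; rewrite -expr2 sqr_ge0.
Qed.

Lemma enorm_eq0 u : enorm u = 0 -> u = 0.
Proof.
move=> h; apply/rowP => i; rewrite mxE; apply/eqP; rewrite -normr_le0 -h.
exact: coord_le_enorm.
Qed.

Lemma enorm_le_sum u : enorm u <= \sum_(i < m) `|u 0 i|.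
Proof.
apply: le_sqr_enorm; first by apply: sumr_ge0.
rewrite expr2 mulr_suml /dotv; apply: ler_sum => i _.
apply: le_trans (ler_norm _) _; rewrite normrM ler_wpM2l//.
by rewrite (bigD1 i)//= lerDl sumr_ge0.
Qed.

Lemma enorm_le_norm u : enorm u <= m%:R * `|u|.
Proof.
apply: le_trans (enorm_le_sum u) _.
rewrite mulr_natl -[X in _ *+ X]card_ord -sumr_const; apply: ler_sum => i _.
by rewrite [leRHS]/Num.Def.normr/= mx_normrE (le_bigmax _ _ (ord0, i)).
Qed.

Lemma norm_le_enorm u : `|u| <= enorm u.
Proof.
rewrite [leLHS]/Num.Def.normr/= mx_normrE bigmax_le ?enorm_ge0// => -[i j] _ /=.
by rewrite (ord1 i) coord_le_enorm.
Qed.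

Lemma norm_dist_enorm u v : `|enorm u - enorm v| <= enorm (u - v).
Proof.
rewrite ler_norml; have := enorm_le_add u v; have := enorm_le_add v u.
by rewrite (enormB v u) => h1 h2; apply/andP; split; lra.
Qed.

End euclidean.

#[global] Instance rV_nbhs_filter (R : realType) m (u : 'rV[R]_m) : Filter (nbhs u).
Proof. exact: nbhs_filter. Qed.

(** The topology of row vectors is that of the maximum norm, and [enorm] is at most [m] times that
    norm. Every continuity proof below goes through this comparison. *)
Lemma enorm_lipschitz_continuous (R : realType) (V : normedModType R) m
    (f : 'rV[R]_m -> V) (L : R) :
  (forall u v, `|f u - f v| <= L * enorm (u - v)) -> continuous f.
Proof.
move=> fL u; apply/cvgrPdist_lt => /= e e0.
have L0 : 0 < `|L| * m%:R + 1 by rewrite ltr_wpDl// mulr_ge0.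
near=> v.
have h : `|u - v| < e / (`|L| * m%:R + 1).
  by near: v; apply: cvgr_dist_lt => //; rewrite divr_gt0.
apply: le_lt_trans (fL _ _) _; move: h; rewrite ltr_pdivlMr// => h.
apply: le_lt_trans _ h; rewrite mulrDr mulr1.
apply: le_trans (_ : `|L| * (m%:R * `|u - v|) <= _); last first.
  by rewrite mulrA mulrC lerDl.
apply: le_trans (ler_wpM2r (enorm_ge0 _) (ler_norm L)) _.
by rewrite ler_wpM2l// enorm_le_norm.
Unshelve. all: by end_near. Qed.

Lemma enorm_continuous (R : realType) m : continuous (@enorm R m).
Proof.
apply: (@enorm_lipschitz_continuous R R^o m _ 1) => u v; rewrite mul1r.
exact: norm_dist_enorm.
Qed.

Lemma dotv_continuousr (R : realType) m (u : 'rV[R]_m) : continuous (dotv u).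
Proof.
apply: (@enorm_lipschitz_continuous R R^o m _ (enorm u)) => v w.
by rewrite -dotvBr cauchy_schwarz.
Qed.

Lemma enorm_ball_compact (R : realType) m (r : R) :
  compact [set p : 'rV[R]_m | enorm p <= r].
Proof.
apply: bounded_closed_compact.
  exists r; split; first exact: num_real.
  move=> x rx p /= pr; apply: le_trans (norm_le_enorm _) _.
  exact: le_trans pr (ltW rx).
have -> : [set p : 'rV[R]_m | enorm p <= r] = (@enorm R m) @^-1` [set x | x <= r] by [].
apply: closed_comp; last exact: closed_le.
by move=> x _; exact: enorm_continuous.
Qed.

(** * Steiner points *)

Section borel.
Context {R : realType} {m : nat}.

Lemma continuous_measurable_Borel (f : 'rV[R]_m -> R) :
  continuous f -> measurable_fun setT (f : Borel R m -> R).
Proof.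
move=> /continuousP cf.
apply: (measurability _ (RGenOpens.measurableE R)).
move=> _ [_ [a [b ->] <-]]; rewrite setTI.
by apply: sub_sigma_algebra; apply: cf; exact: interval_open.
Qed.

Lemma continuous_measurable_Borel_self (f : 'rV[R]_m -> 'rV[R]_m) :
  continuous f -> measurable_fun setT (f : Borel R m -> Borel R m).
Proof.
move=> /continuousP cf; apply: measurability => // _ [A oA <-].
by rewrite setTI; apply: sub_sigma_algebra; exact: cf.
Qed.

End borel.

Section support_function.
Context {R : realType} {m : nat}.
Implicit Types (p q y : 'rV[R]_m) (K : set 'rV[R]_m).

Definition bounded_by K (B : R) := forall y, K y -> enorm y <= B.

Lemma supfun_has_sup K B p : K !=set0 -> bounded_by K B ->
  has_sup [set dotv p y | y in K].
Proof.
move=> [y0 Ky0] KB; split; first by exists (dotv p y0), y0.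
exists (enorm p * B) => _ [y Ky <-]; apply: le_trans (dotv_le _ _) _.
by rewrite ler_wpM2l ?enorm_ge0 ?KB.
Qed.

Lemma le_supfun K B p y : bounded_by K B -> K y -> dotv p y <= supfun K p.
Proof.
move=> KB Ky; apply: sup_upper_bound; last by exists y.
by apply: (supfun_has_sup _ _ KB); exists y.
Qed.

Lemma supfun_le K p (a : R) : K !=set0 ->
  (forall y, K y -> dotv p y <= a) -> supfun K p <= a.
Proof.
move=> [y0 Ky0] h; apply: ge_sup; first by exists (dotv p y0), y0.
by move=> _ [y Ky <-]; exact: h.
Qed.

Lemma supfunD K B p q (t : R) : K !=set0 -> bounded_by K B -> 0 <= t ->
  supfun K (p + t *: q) <= supfun K p + t * supfun K q.
Proof.
move=> K0 KB t0; apply: supfun_le => // y Ky.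
by rewrite dotvDl dotvZl lerD ?ler_wpM2l// (le_supfun _ KB).
Qed.

Lemma supfun_lipschitz K B p q : K !=set0 -> bounded_by K B ->
  `|supfun K p - supfun K q| <= B * enorm (p - q).
Proof.
move=> K0 KB.
have h u v : supfun K u - supfun K v <= B * enorm (u - v).
  rewrite lerBlDr; apply: supfun_le => // y Ky.
  have -> : dotv u y = dotv (u - v) y + dotv v y by rewrite dotvBl subrK.
  apply: lerD; last exact: le_supfun KB Ky.
  apply: le_trans (dotv_le _ _) _.
  by rewrite mulrC ler_wpM2r ?enorm_ge0 ?KB.
by rewrite ler_norml lerNl opprB h enormB h.
Qed.

Lemma supfun_set1 y p : supfun [set y] p = dotv p y.
Proof. by rewrite /supfun image_set1 sup1. Qed.

End support_function.

(** * Reflections and the invariant measure on the sphere *)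

Definition reflection {R : realType} {m : nat} (q : 'rV[R]_m) : 'M[R]_m :=
  1%:M - (2 / dotv q q) *: (q^T *m q).

Section reflections.
Context {R : realType} {m : nat}.
Implicit Types (p q : 'rV[R]_m).

Lemma mul_reflection q p : p *m reflection q = p - (2 / dotv q q * dotv p q) *: q.
Proof.
rewrite /reflection mulmxBr mulmx1 -scalemxAr mulmxA; congr (_ - _).
apply/rowP => j; rewrite !mxE big_ord1 !mxE -mulrA; congr (_ * (_ * _)).
by apply: eq_bigr => i _; rewrite !mxE.
Qed.

Lemma reflection_orthogonal q : dotv q q != 0 ->
  reflection q *m (reflection q)^T = 1%:M.
Proof.
move=> q0.
have sT : (reflection q)^T = reflection q.
  by rewrite /reflection linearB/= trmx1 linearZ/= trmx_mul trmxK.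
rewrite sT; apply/row_matrixP => i; rewrite row_mul row1.
have -> : row i (reflection q) = 'e_i *m reflection q by rewrite rowE.
rewrite !mul_reflection dotvBl dotvZl.
rewrite -addrA -opprD -scalerDl.
have h (a b : R) : b != 0 -> 2 / b * a + 2 / b * (a - 2 / b * a * b) = 0.
  by move=> b0; field.
by rewrite h// scale0r subr0.
Qed.

Lemma dotv_reflection p q : dotv q q != 0 -> dotv (p *m reflection q) q = - dotv p q.
Proof.
by move=> q0; rewrite mul_reflection dotvBl dotvZl; field.
Qed.

Lemma enorm_reflection p q : dotv q q != 0 -> enorm (p *m reflection q) = enorm p.
Proof.
move=> q0; congr (Num.sqrt _).
rewrite mul_reflection !(dotvBl, dotvBr, dotvZl, dotvZr) (dotvC q p).
by field.
Qed.

Lemma reflection_continuous q : dotv q q != 0 ->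
  continuous (fun p => p *m reflection q).
Proof.
move=> q0; apply: (@enorm_lipschitz_continuous _ _ _ _ 1) => u v.
rewrite -mulmxBl mul1r; apply: le_trans (norm_le_enorm _) _.
by rewrite enorm_reflection.
Qed.

End reflections.

Section sphere.
Context {R : realType} {n : nat} (mu : {measure set (Borel R n.+1) -> \bar R}).
Hypothesis smu : sphere_measure mu.
Local Notation m := n.+1.
Implicit Types (p q y a : 'rV[R]_m) (K : set 'rV[R]_m) (f : 'rV[R]_m -> R).

Let N : set (Borel R m) := [set p : Borel R m | enorm p != 1].

Let mN : measurable N.
Proof.
have m1 : measurable (~` [set (1 : R)]) by apply: measurableC; exact: measurable_set1.
have := continuous_measurable_Borel (@enorm_continuous R m) measurableT m1.
rewrite setTI; congr measurable; apply/seteqP; split => p /=; first by move/eqP.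
by move=> /eqP.
Qed.

Let mu_fin : (mu (setT `\` N) < +oo)%E.
Proof.
have [muT _ _] := smu.
apply: (@le_lt_trans _ _ (mu setT)); last by rewrite muT ltry.
by apply: le_measure; rewrite ?inE//; apply: measurableD.
Qed.

(** The integrands of interest grow at infinity, but the complement of the sphere is [mu]-null, so a
    bound on the sphere is enough. *)
Lemma sphere_integrable f (C : R) : continuous f ->
  (forall p, enorm p = 1 -> `|f p| <= C) -> mu.-integrable setT (EFin \o f).
Proof.
move=> cf fC; have mf := continuous_measurable_Borel cf.
have [_ muN _] := smu.
apply/(negligible_integrable mN measurableT _ muN).
  exact/measurable_EFinP.
apply: measurable_bounded_integrable => //.
- exact: measurableD.
- exact: measurable_funTS.
- exists C; split; first exact: num_real.
  move=> x Cx p /= [_ /negP]; rewrite negbK => /eqP p1.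
  exact: le_trans (fC p p1) (ltW Cx).
Qed.

(** A change of variables, since the pushforward of [mu] by an orthogonal map is [mu]. Rotation
    invariance enters the development only here, and only for reflections. *)
Lemma sphere_integral_reflection f (C : R) q : dotv q q != 0 -> continuous f ->
  (forall p, enorm p = 1 -> `|f p| <= C) ->
  \int[mu]_p f (p *m reflection q) = \int[mu]_p f p.
Proof.
move=> q0 cf fC.
have cr := reflection_continuous q0.
have mr := continuous_measurable_Borel_self cr.
have [_ _ inv] := smu.
rewrite /Rintegral; congr fine.
have mf : measurable_fun [set: Borel R m] (fun p : Borel R m => (f p)%:E).
  by apply: (@measurableT_comp _ _ _ _ _ _ (@EFin R)) => //; exact: continuous_measurable_Borel.
have fr_int : mu.-integrable ((fun p : Borel R m => p *m reflection q : Borel R m) @^-1` setT)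
    ((fun p : Borel R m => (f p)%:E) \o (fun p : Borel R m => p *m reflection q : Borel R m)).
  rewrite preimage_setT.
  apply: (@sphere_integrable (f \o (fun p => p *m reflection q)) C).
    by move=> p; apply: continuous_comp; [exact: cr|exact: cf].
  by move=> p p1; apply: fC; rewrite enorm_reflection.
have := integral_pushforward mr mf fr_int measurableT.
rewrite preimage_setT /comp => <-.
apply: eq_measure_integral => A mA _.
rewrite /pushforward -[RHS](inv _ (reflection_orthogonal q0) _ mA).
by congr (mu _); apply/seteqP; split => p /=; rewrite inE.
Qed.

Let dd_cont q q' : continuous (fun p => dotv q p * dotv q' p).
Proof.
move=> p.
exact: (cvgM (@dotv_continuousr R m q p) (@dotv_continuousr R m q' p)).
Qed.

Let dd_bound q q' p : enorm p = 1 -> `|dotv q p * dotv q' p| <= enorm q * enorm q'.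
Proof.
move=> p1; rewrite normrM ler_pM//.
  by apply: le_trans (cauchy_schwarz _ _) _; rewrite p1 mulr1.
by apply: le_trans (cauchy_schwarz _ _) _; rewrite p1 mulr1.
Qed.

Let dd_int q q' := sphere_integrable (@dd_cont q q') (@dd_bound q q').

(** The quadratic form of second moments. By invariance it depends on [enorm q] alone, hence is a
    multiple of [dotv q q]; its trace then fixes the multiple. *)
Let B q := \int[mu]_p (dotv q p * dotv q p).

(* The reflection along [q - q'] exchanges [q] and [q']. *)
Let B_eqnorm q q' : dotv q q = dotv q' q' -> B q = B q'.
Proof.
move=> qq'; have [->//|ne] := eqVneq q q'.
have d0 : dotv (q - q') (q - q') != 0.
  apply: contra ne => /eqP h; rewrite -subr_eq0; apply/eqP/enorm_eq0.
  by rewrite /enorm h sqrtr0.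
rewrite /B -(sphere_integral_reflection d0 (@dd_cont q q) (@dd_bound q q)).
apply: eq_Rintegral => p _.
suff -> : dotv q (p *m reflection (q - q')) = dotv q' p by [].
rewrite mul_reflection [dotv q (p - _)]dotvBr [dotv q (_ *: _)]dotvZr.
move: d0; rewrite !(dotvBl, dotvBr) !(dotvC p) -qq' (dotvC q' q) => d0.
field; move: d0; apply: contra => /eqP h; apply/eqP.
by move: h; lra.
Qed.

Let B_scale (t : R) q : B (t *: q) = t ^+ 2 * B q.
Proof.
rewrite /B -RintegralZl//.
by apply: eq_Rintegral => p _; rewrite dotvZl; ring.
Qed.

Let e0 : 'rV[R]_m := delta_mx 0 ord0.

Let dotv_delta i p : dotv (delta_mx 0 i) p = p 0 i.
Proof.
rewrite /dotv (bigD1 i)//= mxE !eqxx mul1r big1 ?addr0// => j ji.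
by rewrite mxE (negPf ji) mul0r.
Qed.

Let B_eq q : B q = dotv q q * B e0.
Proof.
have -> : B q = B (enorm q *: e0).
  by apply: B_eqnorm; rewrite dotvZl dotvZr dotv_delta mxE !eqxx mulr1 -expr2 sqr_enorm.
by rewrite B_scale sqr_enorm.
Qed.

(** The trace of [B] is the integral of [|p|^2], which equals 1 because [mu] is a probability
    carried by the unit sphere. *)
Let B_e0 : m%:R * B e0 = 1.
Proof.
have h i : B (delta_mx 0 i) = B e0 by apply: B_eqnorm; rewrite !dotv_delta !mxE !eqxx.
rewrite mulr_natl -[X in _ *+ X]card_ord -sumr_const.
under eq_bigr => i _ do rewrite -(h i).
have -> : \sum_(i < m) B (delta_mx 0 i) = fine (\int[mu]_p (\sum_(i < m)
    (dotv (delta_mx 0 i) p * dotv (delta_mx 0 i) p)%:E))%E.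
  rewrite integral_sum//; last by move=> i; exact: dd_int.
  by rewrite -sum_fine// => i _; apply: integrable_fin_num (dd_int _ _).
have [muT muN _] := smu.
transitivity (fine (\int[mu]_(p in setT) (cst 1%E p))%E); last first.
  by rewrite integral_cst// mul1e muT.
congr fine; apply: ae_eq_integral => //.
- have -> : (fun p : Borel R m => \sum_(i < m) (dotv (delta_mx 0 i) p * dotv (delta_mx 0 i) p)%:E)%E
      = EFin \o (fun p : Borel R m => enorm p * enorm p).
    apply/funext => p /=; rewrite -expr2 sqr_enorm sumEFin; congr EFin.
    by apply: eq_bigr => i _; rewrite dotv_delta.
  apply/measurable_EFinP; apply: continuous_measurable_Borel => p.
  exact: (cvgM (@enorm_continuous R m p) (@enorm_continuous R m p)).
- exists N; split => // p /= /not_implyP[_] hp; apply/negP => /eqP p1; apply: hp.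
  rewrite sumEFin; congr EFin.
  have := sqr_enorm p; rewrite p1 expr1n => ->.
  by apply: eq_bigr => i _; rewrite dotv_delta.
Qed.

(** Polarisation of [B]. The identity explains the factor [m] in the Steiner point: it is the
    normalisation that makes points fixed. *)
Lemma sphere_second_moment q a :
  m%:R * \int[mu]_p (dotv q p * dotv a p) = dotv q a.
Proof.
have h : B (q + a) = B q + B a + 2 * \int[mu]_p (dotv q p * dotv a p).
  rewrite -RintegralZl ?dd_int// -RintegralD ?dd_int// -RintegralD//.
  - by apply: eq_Rintegral => p _; rewrite dotvDl; ring.
  - by have := integrableD measurableT (dd_int q q) (dd_int a a).
  - by have := integrableZl measurableT 2 (dd_int q a).
move: h; rewrite (B_eq (q + a)) (B_eq q) (B_eq a) !(dotvDl, dotvDr) (dotvC a q).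
set I := \int[mu]_p _ => h.
have -> : I = dotv q a * B e0 by lra.
by rewrite mulrCA B_e0 mulr1.
Qed.

Let supfun_cont K C : K !=set0 -> bounded_by K C -> continuous (supfun K).
Proof.
move=> K0 KC; apply: (@enorm_lipschitz_continuous R R^o m _ C) => u v.
exact: supfun_lipschitz.
Qed.

Let dh_cont K C q : K !=set0 -> bounded_by K C ->
  continuous (fun p => dotv q p * supfun K p).
Proof.
move=> K0 KC p; have c2 := @supfun_cont K C K0 KC p.
exact: (cvgM (@dotv_continuousr R m q p) c2).
Qed.

Let dh_bound K C q p : K !=set0 -> bounded_by K C -> enorm p = 1 ->
  `|dotv q p * supfun K p| <= enorm q * (C + `|supfun K 0|).
Proof.
move=> K0 KC p1; rewrite normrM ler_pM//.
  by apply: le_trans (cauchy_schwarz _ _) _; rewrite p1 mulr1.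
have := supfun_lipschitz p 0 K0 KC; rewrite subr0 p1 mulr1.
by rewrite -[X in `|X| <= _ + _](subrK (supfun K 0)) => h; rewrite (le_trans (ler_normD _ _))// lerD2r.
Qed.

Let dh_int K C q (K0 : K !=set0) (KC : bounded_by K C) :=
  sphere_integrable (@dh_cont K C q K0 KC) (fun p => @dh_bound K C q p K0 KC).

Lemma steiner_dotv K C q : K !=set0 -> bounded_by K C ->
  dotv q (steiner mu K) = m%:R * \int[mu]_p (dotv q p * supfun K p).
Proof.
move=> K0 KC.
have st i : steiner mu K 0 i = m%:R * \int[mu]_p (p 0 i * supfun K p) by rewrite mxE.
have int_i i : mu.-integrable setT (fun p : Borel R m => (p 0 i * supfun K p)%:E).
  have := dh_int (delta_mx 0 i) K0 KC; congr (_.-integrable _ _).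
  by apply/funext => p /=; rewrite dotv_delta.
have -> : \int[mu]_p (dotv q p * supfun K p) =
    \sum_(i < m) (q 0 i * \int[mu]_p (p 0 i * supfun K p)).
  have -> : \int[mu]_p (dotv q p * supfun K p) = fine (\int[mu]_p (\sum_(i < m)
      ((q 0 i)%:E * (p 0 i * supfun K p)%:E)))%E.
    congr fine; apply: eq_integral => p _.
    rewrite /dotv mulr_suml -sumEFin; apply: eq_bigr => i _.
    by rewrite -EFinM mulrA.
  rewrite integral_sum//; last by move=> i; apply: integrableZl.
  rewrite -sum_fine; last first.
    by move=> i _; apply: integrable_fin_num => //; apply: integrableZl.
  apply: eq_bigr => i _; rewrite -RintegralZl//; last exact: int_i.
rewrite /dotv mulr_sumr; apply: eq_bigr => i _.
by rewrite st mulrCA.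
Qed.

(* Averaging over the reflection along [q] reduces the inequality to the
   pointwise bound [<q, p> (h p - h (s_q p)) <= 2 <q, p>^2 h q / |q|^2], which
   is the subadditivity of the support function [h]. *)
Lemma steiner_le_supfun K C q : K !=set0 -> bounded_by K C -> dotv q q != 0 ->
  dotv q (steiner mu K) <= supfun K q.
Proof.
move=> K0 KC q0; rewrite (steiner_dotv _ K0 KC).
set h := supfun K; set I := \int[mu]_p _.
have qp : 0 < dotv q q by rewrite lt_neqAle eq_sym q0 dotvv_ge0.
have c_cont := @dh_cont K C q K0 KC.
have IE := sphere_integral_reflection q0 c_cont (fun p => @dh_bound K C q p K0 KC).
have c2_cont : continuous (fun p => dotv q (p *m reflection q) * h (p *m reflection q)).
  move=> p; apply: (@continuous_comp _ _ _ (fun p => p *m reflection q)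
    (fun p => dotv q p * h p)); last exact: c_cont.
  exact: reflection_continuous.
have c2_int : mu.-integrable setT (fun p : Borel R m =>
    (dotv q (p *m reflection q) * h (p *m reflection q))%:E).
  apply: (sphere_integrable c2_cont (C := enorm q * (C + `|h 0|))) => p p1.
  by apply: dh_bound => //; rewrite enorm_reflection.
have I2 : I + I <= \int[mu]_p (2 / dotv q q * h q * (dotv q p * dotv q p)).
  rewrite {2}/I -IE -RintegralD//; last exact: dh_int KC.
  apply: le_Rintegral => //.
  - by have := integrableD measurableT (dh_int q K0 KC) c2_int.
  - by have := integrableZl measurableT (2 / dotv q q * h q) (dd_int q q).
  move=> p _; rewrite [dotv q (p *m _)]dotvC dotv_reflection// (dotvC p q).
  set t : R := 2 / dotv q q * dotv q p.
  have dE : 2 / dotv q q * h q * (dotv q p * dotv q p) = dotv q p * (t * h q).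
    by rewrite /t; ring.
  have pE : p = p *m reflection q + t *: q by rewrite mul_reflection (dotvC p q) subrK.
  rewrite dE mulNr -mulrBr; have [d0|d0] := leP 0 (dotv q p).
    have t0 : 0 <= t by rewrite mulr_ge0// divr_ge0// ltW.
    rewrite ler_wpM2l// lerBlDl {1}pE; exact: supfunD KC t0.
  have t0 : 0 <= - t.
    by rewrite oppr_ge0 mulr_ge0_le0 ?(ltW d0)// divr_ge0// ltW.
  rewrite ler_nM2l//.
  have := supfunD p q K0 KC t0; rewrite scaleNr {1}pE addrK -/h => h1.
  by rewrite -subr_ge0; lra.
rewrite RintegralZl ?dd_int// in I2.
have := sphere_second_moment q q; set J := \int[mu]_p _ in I2 * => mJ.
have m0 : 0 < m%:R :> R by [].
have : m%:R * (I + I) <= m%:R * (2 / dotv q q * h q * J) by rewrite ler_pM2l.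
have -> : m%:R * (2 / dotv q q * h q * J) = 2 / dotv q q * h q * (m%:R * J) by ring.
rewrite mJ.
have -> : 2 / dotv q q * h q * dotv q q = 2 * h q by field.
by rewrite mulrDr; move: (m%:R * I) (h q) => X Y hXY; lra.
Qed.

(** The support function of a point is linear, so each coordinate is a second moment of [mu]. *)
Lemma steiner_set1 a : steiner mu [set a] = a.
Proof.
have K0 : [set a] !=set0 by exists a.
have KC : bounded_by [set a] (enorm a) by move=> y ->.
apply/rowP => i; have := steiner_dotv (delta_mx 0 i) K0 KC.
rewrite dotv_delta => ->; rewrite -[RHS]dotv_delta -sphere_second_moment.
by congr (_ * _); apply: eq_Rintegral => p _; rewrite supfun_set1 (dotvC p).
Qed.

End sphere.

(** * The epigraph and its bounded pieces *)

Section epigraph.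
Context {R : realType} {n : nat}.
Implicit Types (p : 'rV[R]_n) (y z : 'rV[R]_n.+1).

Definition row_pair p (c : R) : 'rV[R]_n.+1 :=
  \row_(j < n.+1) (if insub (j : nat) is Some i then p 0 i else c).

Lemma fpart_row_pair p c : fpart (row_pair p c) = p.
Proof.
apply/rowP => i; rewrite !mxE /=; case: insubP => [j _ ji|].
  by congr (p _ _); apply: val_inj.
by rewrite /= ltn_ord.
Qed.

Lemma lpart_row_pair p c : lpart (row_pair p c) = c.
Proof. by rewrite /lpart !mxE; case: insubP => //= j; rewrite ltnn. Qed.

Lemma dotv_parts y z : dotv y z = dotv (fpart y) (fpart z) + lpart y * lpart z.
Proof.
by rewrite /dotv big_ord_recr/=; congr (_ + _); apply: eq_bigr => i _; rewrite !mxE.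
Qed.

Variables (H : R -> 'rV[R]_n -> 'rV[R]_n -> R) (t : R) (x : 'rV[R]_n).

Lemma epiHP y : epiH H t x y <->
  forall p, dotv (fpart y) p - lpart y <= H t x p.
Proof.
rewrite /epiH /= /Hstar; split=> [h p|h].
  have : ((dotv (fpart y) p - H t x p)%:E <= (lpart y)%:E)%E.
    by apply: le_trans h; apply: ereal_sup_ubound; exists p.
  by rewrite lee_fin; lra.
apply: ge_ereal_sup => _ [p _ <-]; rewrite lee_fin.
by have := h p; lra.
Qed.

(** The epigraph is an intersection of closed half-spaces with normals [(p, -1)]. This form gives
    both its closedness and the membership of any point lying below the support function of one of
    its subsets. *)
Lemma epiH_dotv y : epiH H t x y <->
  forall p, dotv (row_pair p (-1)) y <= H t x p.
Proof.
rewrite epiHP; split=> h p; have := h p;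
  by rewrite dotv_parts fpart_row_pair lpart_row_pair mulN1r dotvC.
Qed.

Lemma edist_ge0 y (E : set 'rV[R]_n.+1) : 0 <= Defs.edist y E.
Proof.
have [[z Ez]|E0] := pselect (E !=set0).
  apply: lb_le_inf; first by exists (enorm (y - z)); exists z.
  by move=> _ [u _ <-]; exact: enorm_ge0.
by rewrite /Defs.edist (_ : E = set0) ?image_set0 ?inf0//; apply/seteqP; split=> u // Eu; apply: E0; exists u.
Qed.

Lemma edist_le y z (E : set 'rV[R]_n.+1) : E z -> Defs.edist y E <= enorm (y - z).
Proof.
move=> Ez; apply: ge_inf; last by exists z.
by exists 0 => _ [u _ <-]; exact: enorm_ge0.
Qed.

(** On the epigraph the radius [2 * edist] vanishes and the ball shrinks to its centre. *)
Lemma PhiH_mem y : epiH H t x y -> PhiH H t x y = [set y].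
Proof.
move=> Ey.
have d0 : Defs.edist y (epiH H t x) = 0.
  by apply/eqP; rewrite eq_le edist_ge0 andbT -(enorm0 (R := R) (m := n.+1)) -(subrr y) edist_le.
apply/seteqP; split => z; rewrite /PhiH /= d0 mulr0; last by move=> ->; rewrite subrr enorm0.
by move=> [_ h]; apply/subr0_eq/enorm_eq0/eqP; rewrite eq_le enorm_ge0 h.
Qed.

Hypothesis E0 : epiH H t x !=set0.

(** At positive distance the factor 2 in the radius leaves room for a point that nearly realises the
    distance. At distance zero [y] itself belongs to the epigraph, as each half-space is closed. *)
Lemma PhiH_nonempty y : PhiH H t x y !=set0.
Proof.
have [d0|d0] := leP (Defs.edist y (epiH H t x)) 0; last first.
  have hi : has_inf [set enorm (y - z) | z in epiH H t x].
    split; first by have [z Ez] := E0; exists (enorm (y - z)); exists z.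
    by exists 0 => _ [u _ <-]; exact: enorm_ge0.
  have [_ [z Ez <-] hz] := inf_adherent d0 hi.
  exists z; split => //=; rewrite enormB (le_trans (ltW hz))//.
  by rewrite mulr_natl mulr2n.
suff Ey : epiH H t x y by rewrite PhiH_mem//; exists y.
apply/epiH_dotv => p; apply/ler_addgt0Pr => e e0.
set q := row_pair p (-1).
have e1 : 0 < e / (enorm q + 1) by rewrite divr_gt0// ltr_wpDl// enorm_ge0.
have hi : has_inf [set enorm (y - z) | z in epiH H t x].
  split; first by have [z Ez] := E0; exists (enorm (y - z)); exists z.
  by exists 0 => _ [u _ <-]; exact: enorm_ge0.
have [_ [z Ez <-] hz] := inf_adherent e1 hi.
have {}hz : enorm (y - z) <= e / (enorm q + 1).
  by apply: (le_trans (ltW hz)); rewrite gerDr.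
rewrite -(subrK z y) dotvDr [X in _ <= X]addrC lerD//; last first.
  by move/epiH_dotv: Ez; apply.
apply: le_trans (dotv_le _ _) _.
apply: (@le_trans _ _ ((enorm q + 1) * enorm (y - z))).
  by rewrite ler_wpM2r ?enorm_ge0// lerDl.
by rewrite mulrC -ler_pdivlMr// ltr_wpDl// enorm_ge0.
Qed.

Lemma PhiH_bounded y :
  bounded_by (PhiH H t x y) (enorm y + 2 * Defs.edist y (epiH H t x)).
Proof. by move=> z [_ /= h]; apply: le_trans (enorm_le_add z y) _; rewrite lerD2l. Qed.

(** In each direction [(p, -1)] the Steiner point lies below the support function of [PhiH], itself
    at most [H t x p] because [PhiH] is contained in the epigraph. *)
Lemma steiner_fl_mem (mu : {measure set (Borel R n.+1) -> \bar R}) y :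
  sphere_measure mu -> epiH H t x (steiner_fl mu H t x y).
Proof.
move=> smu; apply/epiH_dotv => p.
apply: le_trans (steiner_le_supfun smu (PhiH_nonempty y) (@PhiH_bounded y) _) _.
  rewrite dotv_parts lpart_row_pair mulN1r opprK gt_eqF//.
  by rewrite ltr_wpDl// dotvv_ge0.
by apply: supfun_le; [exact: PhiH_nonempty|move=> z [/epiH_dotv]].
Qed.

End epigraph.

Lemma steiner_fl_id (R : realType) n (mu : {measure set (Borel R n.+1) -> \bar R})
    (H : R -> 'rV[R]_n -> 'rV[R]_n -> R) t x y :
  sphere_measure mu -> epiH H t x y -> steiner_fl mu H t x y = y.
Proof. by move=> smu Ey; rewrite /steiner_fl PhiH_mem// steiner_set1. Qed.

(** * Selection in a convex epigraph *)

Lemma ge0_of_small_slack (R : realType) (y c : R) : 0 <= c ->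
  (forall th : R, 0 < th <= 1 -> 0 <= y + th * c) -> 0 <= y.
Proof.
move=> c0 h; rewrite leNgt; apply/negP => y0.
have cy : 0 < c - y by lra.
have cy2 : 0 < 2 * (c - y) by lra.
(* For [y < 0] this value lies in []0, 1]] and makes [th * c] at most [- y / 2]. *)
have := h ((- y) / (2 * (c - y))).
rewrite divr_gt0 ?oppr_gt0//= ler_pdivrMr// mul1r => /(_ ltac:(lra)).
rewrite mulrAC -[X in X + _](mulfK (lt0r_neq0 cy2)) -mulrDl pmulr_lge0 ?invr_gt0//.
by nra.
Qed.

(** The scalar core of the subgradient inequality in [convex_selection]. The hypotheses are, in
    order, convexity of [h] on a segment, minimality of [p0], and the tangent bound for the
    penalty. *)
Lemma combine_tangent (R : realType) (th d S u z a1 a2 a3 a4 a5 a6 : R) :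
  a6 <= th * a4 + (1 - th) * a5 ->
  a5 - a2 + 2 * d * a1 <= a6 - (a2 + th * a3) + 2 * d * S ->
  d * S <= d * (a1 + (th * u + th ^+ 2 * z / 2)) ->
  0 <= th * (a4 - a5 - a3 + 2 * d * u + th * (d * z)).
Proof. lra. Qed.

Section selection.
Context {R : realType} {n : nat}.
Implicit Types p q v w : 'rV[R]_n.

Let s p : R := Num.sqrt (1 + dotv p p).

Let sp_gt0 p : 0 < 1 + dotv p p.
Proof. by rewrite ltr_wpDr// dotvv_ge0. Qed.

Let s_gt0 p : 0 < s p.
Proof. by rewrite sqrtr_gt0. Qed.

Let s_sqr p : s p ^+ 2 = 1 + dotv p p.
Proof. by rewrite sqr_sqrtr// ltW. Qed.

Let s_ge1 p : 1 <= s p.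
Proof.
rewrite -(ler_pXn2r (n:=2)) ?nnegrE ?(ltW (s_gt0 _))//.
by rewrite expr1n s_sqr lerDl dotvv_ge0.
Qed.

Let s_ge p : enorm p <= s p.
Proof. by apply: le_sqr_enorm; [exact: ltW|rewrite s_sqr lerDr]. Qed.

(** Concavity of the square root, in the form [2 * a * b <= a ^+ 2 + b ^+ 2] for the values [a], [b]
    of [s] at the two points. The error is quadratic in [th], so it disappears after division by
    [th]. *)
Let s_tangent p q th : s (th *: q + (1 - th) *: p) <=
  s p + (2 * th * dotv p (q - p) + th ^+ 2 * dotv (q - p) (q - p)) / (2 * s p).
Proof.
have -> : th *: q + (1 - th) *: p = p + th *: (q - p).
  by rewrite scalerBr scalerBl scale1r addrCA.
move: (q - p) => e.
have sp2 : 0 < 2 * s p by rewrite mulr_gt0.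
rewrite -(ler_pM2r sp2) [leRHS]mulrDl divfK ?lt0r_neq0//.
have := s_sqr (p + th *: e); rewrite !(dotvDl, dotvDr, dotvZl, dotvZr) (dotvC e p).
have := s_sqr p; set a := s (p + _); set b := s p.
set x := dotv p p; set y := dotv p e; set z := dotv e e => h1 h2.
have : 0 <= (a - b) ^+ 2 by apply: sqr_ge0.
by nra.
Qed.

(* The minimiser of [h - <v, .> + 2 d sqrt (1 + |.|^2)] has a subgradient of
   [h] of the form [v - 2 d w]: the penalty is smooth, so no separation
   theorem is needed. *)
Lemma convex_selection (h : 'rV[R]_n -> R) (L eta d : R) v :
  (forall p q, `|h p - h q| <= L * enorm (p - q)) ->
  (forall p q (lam : R), 0 <= lam <= 1 ->
    h (lam *: p + (1 - lam) *: q) <= lam * h p + (1 - lam) * h q) ->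
  0 < d ->
  (forall p, dotv v p - eta <= h p + d * (1 + enorm p)) ->
  exists2 w, enorm w <= 1 &
    forall p, dotv (v - (2 * d) *: w) p - (eta + 3 * d) <= h p.
Proof.
move=> hL hconv d0 hd.
pose F p := h p - dotv v p + 2 * d * s p.
(* The penalty is twice the defect: one half absorbs the defect, the other makes [F] coercive and so
   yields a minimiser. *)
have F_ge p : d * enorm p - eta - d <= F p.
  have := hd p; have := s_ge p; rewrite /F; nra.
pose rho := Num.max 0 ((F 0 + eta + d) / d).
pose A := [set p : 'rV[R]_n | enorm p <= rho].
have rho0 : 0 <= rho by rewrite le_max lexx.
have A0 : A 0 by rewrite /A /= enorm0.
have cA : compact A by exact: enorm_ball_compact.
have cs : continuous s.
  have -> : s = fun p => Num.sqrt (1 + enorm p * enorm p).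
    by apply/funext => q; rewrite /s -expr2 sqr_enorm.
  move=> p; apply: (@continuous_comp _ _ _ (fun p => 1 + enorm p * enorm p) Num.sqrt).
    have cn := @enorm_continuous R n p.
    exact: (cvgD (cvg_cst (1 : R)) (cvgM cn cn)).
  exact: sqrt_continuous.
have cF : continuous F.
  move=> p; have ch := enorm_lipschitz_continuous hL.
  exact: (cvgD (cvgB (ch p) (@dotv_continuousr R n v p)) (cvgM (cvg_cst (2 * d)) (cs p))).
have [p0 p0A p0min] : exists2 p0, p0 \in A & forall p, p \in A -> F p0 <= F p.
  apply: EVT_min_rV => //; first by exists 0.
  exact: continuous_subspaceT.
have {}p0min p : F p0 <= F p.
  have [pA|pA] := leP (enorm p) rho; first by apply: p0min; rewrite inE.
  apply: le_trans (p0min 0 _) _; first by rewrite inE.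
  have : (F 0 + eta + d) / d < enorm p by apply: le_lt_trans pA; rewrite le_max lexx orbT.
  by rewrite ltr_pdivrMr// => h1; have := F_ge p; nra.
have s0 := s_gt0 p0.
pose w := (s p0)^-1 *: p0.
have w1 : enorm w <= 1.
  by rewrite enormZ gtr0_norm ?invr_gt0// mulrC ler_pdivrMr// mul1r.
have sub q : 0 <= h q - h p0 - dotv v (q - p0) + 2 * d * dotv w (q - p0).
  set e := q - p0.
  apply: (@ge0_of_small_slack _ _ (d * dotv e e / s p0)).
    by rewrite divr_ge0 ?mulr_ge0 ?dotvv_ge0// ltW.
  move=> th /andP[th0 th1].
  have thi : 0 <= th <= 1 by rewrite (ltW th0) th1.
  have := p0min (th *: q + (1 - th) *: p0); rewrite /F.
  have := hconv q p0 th thi.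
  have := s_tangent p0 q th; rewrite -/e.
  have -> : dotv v (th *: q + (1 - th) *: p0) = dotv v p0 + th * dotv v e.
    by rewrite /e !(dotvDr, dotvZr, dotvNr); ring.
  rewrite /w dotvZl.
  set X := dotv p0 e; set Z := dotv e e; set S := s (_ + _) => h1 h2 h3.
  have h4 : (2 * th * X + th ^+ 2 * Z) / (2 * s p0) =
     th * ((s p0)^-1 * X) + th ^+ 2 * (Z / s p0) / 2.
    by field; rewrite lt0r_neq0.
  rewrite h4 in h1; rewrite -(pmulr_rge0 _ th0).
  rewrite -[d * Z / _]mulrA.
  set u : R := (s p0)^-1 * X in h1 *; set z : R := Z / _ in h1 *.
  have := ler_wpM2l (ltW d0) h1; move: h2 h3; rewrite /F; exact: combine_tangent.
exists w => // q.
have h1 := sub q.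
have h2 := hd p0.
(* In fact [dotv w p0] equals [s p0 - 1 / s p0]. Together with the hypothesis at [p0] this bounds
   the constant of the supporting affine function, whence [3 * d]. *)
have h3 : s p0 - 1 <= dotv w p0.
  rewrite /w dotvZl -(ler_pM2l s0) mulrA divff ?lt0r_neq0// mul1r.
  suff : s p0 * (s p0 - 1) <= dotv p0 p0 by [].
  by move: (s_sqr p0) (s_ge1 p0); move: (s p0) (dotv p0 p0) => b y; nra.
have h4 := s_ge p0.
have h5 : d * (s p0 - 1) <= d * dotv w p0 by rewrite ler_pM2l.
have h6 : d * enorm p0 <= d * s p0 by rewrite ler_pM2l.
have h7 : 0 <= d * s p0 by rewrite mulr_ge0 ?ltW.
move: h1 h2 h3 h4 h5 h6 h7; rewrite !(dotvBl, dotvBr, dotvZl).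
by move: (s p0) => b; lra.
Qed.

End selection.

(** The sets [seqDU G j] partition the union of the [G j], so [J] picks the least valid index.
    Measurability is stated for each [a \o J], the form in which coordinates of a selected vector
    appear. *)
Lemma measurable_first_index (R : realType) (D : set R) (G : nat -> set R) :
  measurable D -> (forall j, measurable (G j)) ->
  (forall t, D t -> exists j, G j t) ->
  exists J : R -> nat, (forall t, D t -> G (J t) t) /\
    forall a : nat -> R, measurable_fun D (a \o J).
Proof.
move=> mD mG DG.
have mS j : measurable (seqDU G j).
  by apply: measurableD => //; exact: bigsetU_measurable.
have DS t : D t -> exists j, seqDU G j t.
  move=> Dt; have [j Gj] := DG t Dt.
  have : (\bigcup_k seqDU G k) t by rewrite -seqDU_bigcup_eq; exists j.
  by move=> [i _ ?]; exists i.
pose J t := xget 0%N [set j | seqDU G j t].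
have SJ t : D t -> seqDU G (J t) t.
  by move=> Dt; have [j hj] := DS t Dt; apply: (xgetPex 0%N (P := [set j | seqDU G j t])); exists j.
exists J; split=> [t Dt|a _ Y mY]; first by have [] := SJ t Dt.
have -> : D `&` (a \o J) @^-1` Y =
    \bigcup_j ((D `&` seqDU G j) `&` [set t | Y (a j)]).
  apply/seteqP; split => [t [Dt Yt]|t [j _ [[Dt Sj] Yj]]].
    by exists (J t) => //; split => //; split => //; exact: SJ.
  split => //=; have -> // : J t = j.
  have := @trivIset_seqDU _ G => /trivIsetP /(_ (J t) j I I) h.
  apply/eqP; apply: contrapT => /negP /h /seteqP[+ _] => /(_ t); apply.
  by split => //; exact: SJ.
apply: bigcup_measurable => j _; apply: measurableI; first exact: measurableI.
have [Yj|Yj] := pselect (Y (a j)).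
  by rewrite (_ : [set _ | _] = setT)//; apply/seteqP; split.
by rewrite (_ : [set _ | _] = set0)//; apply/seteqP; split.
Qed.

(** An enumeration of the rational vectors; integers that encode no vector are sent to 0. *)
Definition rat_rows {R : realType} {n : nat} (j : nat) : 'rV[R]_n :=
  if unpickle j is Some q then map_mx (@ratr R) (q : 'rV[rat]_n) else 0.

Lemma rat_rows_dense (R : realType) n (u : 'rV[R]_n) (r : R) : 0 < r ->
  exists j, enorm (rat_rows j - u) < r.
Proof.
move=> r0.
have rn : 0 < r / n.+1%:R by rewrite divr_gt0.
have H i : exists q : rat, `|ratr q - u 0 i| < r / n.+1%:R.
  have [q] := @rat_in_itvoo R (u 0 i) (u 0 i + r / n.+1%:R) ltac:(by rewrite ltrDl).
  rewrite in_itv/= => /andP[h1 h2]; exists q.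
  by rewrite ger0_norm; [rewrite ltrBlDl|rewrite subr_ge0 ltW].
have [q hq] := choice H.
exists (pickle (\row_i q i)); rewrite /rat_rows pickleK.
apply: le_lt_trans (enorm_le_sum _) _.
apply: (@le_lt_trans _ _ (\sum_(i < n) r / n.+1%:R)).
  by apply: ler_sum => i _; rewrite !mxE ltW.
rewrite sumr_const card_ord -[X in X < _]mulr_natr mulrAC ltr_pdivrMr ?ltr0Sn//.
by rewrite ltr_pM2l// ltr_nat.
Qed.

Lemma le_of_dense (R : realType) n (F : 'rV[R]_n -> R) (L c : R) :
  (forall p q, `|F p - F q| <= L * enorm (p - q)) ->
  (forall j, F (rat_rows j) <= c) -> forall p, F p <= c.
Proof.
move=> FL Fc p; apply/ler_addgt0Pr => e e0.
have L0 : 0 < `|L| + 1 by rewrite ltr_wpDl.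
have [j hj] := rat_rows_dense p (divr_gt0 e0 L0).
rewrite -(subrK (F (rat_rows j)) (F p)) addrC lerD//.
apply: le_trans (ler_norm _) _; apply: le_trans (FL _ _) _.
rewrite enormB; apply: (@le_trans _ _ ((`|L| + 1) * enorm (rat_rows j - p))).
  rewrite ler_wpM2r ?enorm_ge0//; have := ler_norm L; lra.
by rewrite mulrC -ler_pdivlMr// ltW.
Qed.

Section measurable_selection.
Context {R : realType} {n : nat}.

Definition measurable_row (D : set R) (v : R -> 'rV[R]_n) :=
  forall i, measurable_fun D (fun t => v t 0 i).

Lemma measurable_dotv D v p : measurable_row D v ->
  measurable_fun D (fun t => dotv (v t) p).
Proof.
move=> mv; apply: measurable_sum => i.
by apply: measurable_funM; [exact: mv|exact: measurable_cst].
Qed.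

(** The vector [w] of [convex_selection] is chosen separately at each [t]. Replacing it by the first
    suitable rational vector restores measurability; the defect [e], which may be prescribed, pays
    for the rounding. *)
Lemma measurable_selection (D : set R) (h : R -> 'rV[R]_n -> R)
    (v : R -> 'rV[R]_n) (eta delta L : R -> R) (e : R) :
  measurable D ->
  (forall p, measurable_fun D (h ^~ p)) ->
  (forall t p q, D t -> `|h t p - h t q| <= L t * enorm (p - q)) ->
  (forall t p q (lam : R), D t -> 0 <= lam <= 1 ->
    h t (lam *: p + (1 - lam) *: q) <= lam * h t p + (1 - lam) * h t q) ->
  measurable_row D v -> measurable_fun D eta -> measurable_fun D delta ->
  (forall t, D t -> 0 < delta t) -> 0 < e ->
  (forall t p, D t -> dotv (v t) p - eta t <= h t p + delta t * (1 + enorm p)) ->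
  exists v', [/\ measurable_row D v',
    forall t, D t -> enorm (v' t - v t) <= 4 * delta t &
    forall t p, D t ->
      dotv (v' t) p - (eta t + 3 * delta t) <= h t p + e * (1 + enorm p)].
Proof.
move=> mD mh hL hconv mv meta mdelta delta0 e0 hv.
(* Truncating the candidates at norm 2 bounds the velocity change by [2 * delta t * 2] for every
   index. *)
pose W j : 'rV[R]_n := if enorm (rat_rows j : 'rV[R]_n) <= 2 then rat_rows j else 0.
have W2 j : enorm (W j) <= 2 by rewrite /W; case: ifPn => //; rewrite enorm0.
pose c j t := v t - (2 * delta t) *: W j.
(* Testing the inclusion on rational [p] only makes [G j] a countable intersection; [le_of_dense]
   recovers all [p] at the end. *)
pose G j := \bigcap_i (D `&` [set t | dotv (c j t) (rat_rows i) -
  (eta t + 3 * delta t) <= h t (rat_rows i) + e * (1 + enorm (rat_rows i : 'rV[R]_n))]).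
have mc j : measurable_row D (c j).
  move=> i; rewrite (_ : (fun t => _) = (fun t => v t 0 i - 2 * delta t * W j 0 i)); last first.
    by apply/funext => t; rewrite !mxE.
  apply: measurable_funB; first exact: mv.
  by apply: measurable_funM => //; apply: measurable_funM.
have mG j : measurable (G j).
  apply: bigcap_measurable; first by exists 0%N.
  move=> i _; rewrite -(@preimage_true R (fun t => dotv (c j t) _ - _ <= _)).
  apply: measurable_fun_ler => //.
    apply: measurable_funB; first exact: measurable_dotv.
    by apply: measurable_funD => //; apply: measurable_funM.
  by apply: measurable_funD.
have DG t : D t -> exists j, G j t.
  move=> Dt; have d0 := delta0 t Dt.
  have [w w1 hw] := convex_selection (fun p q => hL t p q Dt)
    (fun p q lam => hconv t p q lam Dt) d0 (fun p => hv t p Dt).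
  (* The bound 1 keeps the rational vector within norm 2; the other makes the rounding cost at most
     [e * enorm p]. *)
  have r0 : 0 < Num.min 1 (e / (2 * delta t)) by rewrite lt_min ltr01 divr_gt0// mulr_gt0.
  have [j] := rat_rows_dense w r0; rewrite lt_min => /andP[j1 je].
  have Wj : W j = rat_rows j.
    rewrite /W ifT//; apply: le_trans (enorm_le_add _ w) _.
    by apply: le_trans (lerD w1 (ltW j1)) _.
  exists j => i _; split => //=; move: (rat_rows i) => p.
  apply: le_trans (_ : h t p + e * enorm p <= _); last first.
    by rewrite lerD2l ler_wpM2l ?(ltW e0)// lerDr.
  have -> : dotv (c j t) p - (eta t + 3 * delta t) =
      (dotv (v t - (2 * delta t) *: w) p - (eta t + 3 * delta t)) +
      2 * delta t * dotv (w - W j) p.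
    by rewrite /c !(dotvBl, dotvZl); ring.
  apply: lerD; first exact: hw.
  move: je; rewrite ltr_pdivlMr ?mulr_gt0// -Wj enormB => je.
  apply: (@le_trans _ _ (2 * delta t * (enorm (w - W j) * enorm p))).
    by rewrite ler_pM2l ?mulr_gt0// dotv_le.
  by rewrite mulrA ler_wpM2r ?enorm_ge0// mulrC ltW.
have [J [GJ mJ]] := measurable_first_index mD mG DG.
exists (fun t => c (J t) t); split.
- move=> i; rewrite (_ : (fun t => _) =
    (fun t => v t 0 i - 2 * delta t * ((fun j => W j 0 i) \o J) t)); last first.
    by apply/funext => t; rewrite !mxE.
  apply: measurable_funB; first exact: mv.
  by apply: measurable_funM => //; apply: measurable_funM.
- move=> t Dt; rewrite /c addrAC subrr add0r enormN enormZ gtr0_norm ?mulr_gt0 ?delta0//.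
  have -> : 4 * delta t = 2 * delta t * 2 by ring.
  by rewrite ler_wpM2l// mulr_ge0// ltW// delta0.
- move=> t p Dt; have hG j := (GJ t Dt j I).2.
  set v' := c (J t) t in hG *.
  pose F q := dotv v' q - h t q - e * (1 + enorm q).
  suff : F p <= eta t + 3 * delta t by rewrite /F; lra.
  apply: (@le_of_dense _ _ F (enorm v' + L t + e)); last first.
    by move=> j; have /= := hG j; rewrite /F; lra.
  move=> q r.
  have -> : F q - F r = dotv v' (q - r) - (h t q - h t r) - e * (enorm q - enorm r).
    by rewrite /F dotvBr; ring.
  rewrite 2!mulrDl; apply: le_trans (ler_normB _ _) _; apply: lerD.
    apply: le_trans (ler_normB _ _) _; apply: lerD; first exact: cauchy_schwarz.
    exact: hL.
  by rewrite normrM gtr0_norm// ler_wpM2l ?(ltW e0)// norm_dist_enorm.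
Qed.

End measurable_selection.

(** * Absolutely continuous functions *)

Section absolutely_continuous.
Context {R : realType}.
Notation leb := (@lebesgue_measure R).

Definition scalar_abs_cont (a b : R) (z : R -> R) := forall e : R, 0 < e ->
  exists2 d : R, 0 < d & forall (k : nat) (u v : nat -> R),
    (forall i, (i < k)%N -> a <= u i /\ u i <= v i /\ v i <= b) ->
    (forall i j, (i < j < k)%N -> v i <= u j) ->
    \sum_(i < k) (v i - u i) < d ->
    \sum_(i < k) `|z (v i) - z (u i)| < e.

(** * Continuous induction along an interval *)

Section chain.
Variables (z : R -> R) (U : set R) (a e : R).
Hypothesis oU : open U.

(** The progress made from [a] up to [s]: the increment of [z] is controlled by its variation over
    finitely many intervals paid for by the measure of [U], plus a part of slope [e]. In use, [U] is
    a small open set around the exceptional null set. The half-open interval makes the measures add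
    up when a piece is appended. *)
Definition chained (s : R) := exists k (u v : nat -> R),
  [/\ forall i, (i < k)%N -> a <= u i /\ u i <= v i /\ v i <= s,
      forall i j, (i < j < k)%N -> v i <= u j,
      ((\sum_(i < k) (v i - u i))%:E <= leb (U `&` `[a, s[))%E &
      `|z s - z a| <= \sum_(i < k) `|z (v i) - z (u i)| + e * (s - a)].

Let mUa s : measurable (U `&` `[a, s[).
Proof. by apply: measurableI => //; exact: open_measurable. Qed.

Lemma chained_start : 0 <= e -> chained a.
Proof.
move=> e0; exists 0%N, (fun=> 0), (fun=> 0); split => //; last 2 first.
- by rewrite big_ord0; exact: measure_ge0.
- by rewrite !subrr normr0 big_ord0 mulr0 addr0.
Qed.

Lemma chained_cover s s' : 0 <= e -> a <= s -> s <= s' -> `[s, s'] `<=` U ->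
  chained s -> chained s'.
Proof.
move=> e0 as0 ss' sU [k [u [v [h1 h2 h3 h4]]]].
pose u' i := if (i < k)%N then u i else s.
pose v' i := if (i < k)%N then v i else s'.
have su (f : nat -> R -> R -> R) : \sum_(i < k.+1) f i (u' i) (v' i) =
    \sum_(i < k) f i (u i) (v i) + f k s s'.
  rewrite big_ord_recr/= /u' /v' ltnn; congr (_ + _).
  by apply: eq_bigr => i _; rewrite ltn_ord.
exists k.+1, u', v'; split.
- move=> i; rewrite ltnS /u' /v'; case: ifP => [ik _|_ _]; last by split.
  by have [? [? ?]] := h1 i ik; split => //; split => //; apply: le_trans ss'.
- move=> i j /andP[ij]; rewrite ltnS /u' /v' => jk.
  have ik : (i < k)%N by apply: leq_trans jk.
  rewrite ik; case: ifP => jk'; first by apply: h2; rewrite ij.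
  by have [_ []] := h1 i ik.
- rewrite (su (fun _ x y => y - x)) EFinD.
  have -> : U `&` `[a, s'[ = (U `&` `[a, s[) `|` `[s, s'[.
    apply/seteqP; split => x /=; rewrite !in_itv/=.
      move=> [Ux /andP[ax xs']]; have [xs|xs] := ltP x s; [left|right].
        by rewrite ax.
      by rewrite xs'.
    move=> [[Ux /andP[ax xs]]|/andP[sx xs']].
      by rewrite ax (lt_le_trans xs ss').
    split; first by apply: sU; rewrite /= in_itv/= sx ltW.
    by rewrite (le_trans as0 sx) xs'.
  rewrite measureU//; [|exact: mUa|].
  2: {apply/seteqP; split => x //=; rewrite !in_itv/= => -[[_ /andP[_ xs]] /andP[sx _]].
    by move: xs; rewrite ltNge sx. }
  apply: leeD => //; apply: (@le_trans _ _ (leb `[s, s'[)) => //.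
  rewrite lebesgue_measure_itv/= lte_fin.
  case: ltP => // h; have -> : s = s' by apply/eqP; rewrite eq_le ss' h.
  by rewrite subrr.
- rewrite (su (fun _ x y => `|z y - z x|)).
  have := ler_distD (z s) (z s') (z a).
  have : 0 <= e * (s' - s) by rewrite mulr_ge0// subr_ge0.
  by move: h4; lra.
Qed.

Lemma chained_slope s s' : s <= s' -> `|z s' - z s| <= e * (s' - s) ->
  chained s -> chained s'.
Proof.
move=> ss' sl [k [u [v [h1 h2 h3 h4]]]]; exists k, u, v; split => //.
- by move=> i /h1 [? [? ?]]; split => //; split => //; apply: le_trans ss'.
- apply: le_trans h3 _; apply: le_measure; [by rewrite inE; exact: mUa|by rewrite inE; exact: mUa|].
  move=> x /=; rewrite !in_itv/= => -[Ux /andP[-> xs]]; split => //=.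
  exact: lt_le_trans ss'.
- by have := ler_distD (z s) (z s') (z a); move: h4; lra.
Qed.

(** The supremum of the points reached is itself reached, by its local alternative on the left, and
    would be passed by the same alternative on the right if it were less than [b]. *)
Lemma chained_all b : 0 <= e -> a <= b ->
  (forall t, a <= t <= b -> exists2 r : R, 0 < r &
     (forall s, `|s - t| < r -> U s) \/
     (forall s, `|s - t| < r -> `|z s - z t| <= e * `|s - t|)) ->
  chained b.
Proof.
move=> e0 ab loc.
pose S := [set s | a <= s <= b /\ chained s].
have Sa : S a by split; [rewrite lexx|exact: chained_start].
have hS : has_sup S by split; [exists a|exists b => s [/andP[]]].
pose sg := sup S.
have asg : a <= sg by apply: sup_upper_bound.
have sgb : sg <= b by apply: ge_sup; [exists a|move=> s [/andP[]]].
(* The slope bound compares values with [z sg] only, so one end of the step has to be [sg]; both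
   arrival at [sg] and departure from it are covered. *)
have step s s' r : a <= s -> s <= s' -> (`|s - s'| < r) ->
    (forall t, `|t - sg| < r -> U t) \/
    (forall t, `|t - sg| < r -> `|z t - z sg| <= e * `|t - sg|) ->
    s = sg \/ s' = sg -> chained s -> chained s'.
  move=> as0 ss' rs [hU|hz] seq.
    apply: chained_cover => // x /=; rewrite in_itv/= => /andP[sx xs'].
    apply: hU; move: rs; rewrite ler0_norm ?subr_le0// opprB => rs.
    by case: seq => <-; rewrite ltr_norml; apply/andP; split; lra.
  have ns : `|s - s'| = s' - s by rewrite ler0_norm ?subr_le0// opprB.
  apply: chained_slope => //; case: seq => seq.
    by subst s; have := hz s'; rewrite distrC ns => /(_ ltac:(by rewrite -ns)).
  by subst s'; have := hz s rs; rewrite ns distrC.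
have Csg : chained sg.
  have [|r r0 hr] := loc sg; first by rewrite asg.
  have [s [/andP[as0 sb] Cs] hs] := sup_adherent r0 hS.
  have ssg : s <= sg by apply: sup_upper_bound => //; split => //; rewrite as0.
  apply: (step s sg r) => //; last by right.
  by rewrite ler0_norm ?subr_le0// opprB; move: hs; rewrite -/sg; lra.
have [bsg|sgb'] := leP b sg.
  by have -> : b = sg by apply/eqP; rewrite eq_le bsg sgb.
have [|r r0 hr] := loc sg; first by rewrite asg.
pose s' := Num.min b (sg + r / 2).
have ss' : sg < s' by rewrite lt_min sgb'/= ltrDl divr_gt0.
have Cs' : chained s'.
  apply: (step sg s' r) => //; first exact: ltW; last by left.
  rewrite ltr0_norm ?subr_lt0// opprB.
  have : s' <= sg + r / 2 by rewrite ge_min lexx orbT.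
  by lra.
have : s' <= sg.
  apply: sup_upper_bound => //; split => //.
  by rewrite (le_trans asg (ltW ss'))/= ge_min lexx.
by rewrite leNgt ss'.
Qed.

End chain.

Lemma derivable_zero_slope (z : R -> R) t (e : R) : 0 < e ->
  derivable z t 1 -> 'D_1 z t = 0 ->
  exists2 r : R, 0 < r & forall s, `|s - t| < r -> `|z s - z t| <= e * `|s - t|.
Proof.
move=> e0 dz Dz; have := dz; rewrite /derivable.
have <- : t + 0 = t by rewrite addr0.
move=> /cvg_ex[l hl].
have l0 : l = 0.
  by rewrite -Dz /derive; apply/esym/cvg_lim; [exact: Rhausdorff|move: hl; rewrite addr0].
move: hl; rewrite l0 addr0 => /cvgrPdist_le /(_ _ e0) [r /= r0 hr].
exists r => // s; have [->|st sr] := eqVneq s t; first by rewrite !subrr normr0 mulr0.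
have := hr (s - t); rewrite /= sub0r normrN subr_eq0 => /(_ sr st).
rewrite sub0r normrN normrZ normfV /= [_%:A]mulr1 subrK.
by rewrite mulrC ler_pdivrMr// normr_gt0 subr_eq0.
Qed.

(** The exceptional set is covered by an open set so small that absolute continuity leaves variation
    less than [e / 2] on it; elsewhere small slopes contribute at most [e / 2]. The continuous
    induction replaces a covering theorem. The 1 in [b - a + 1] allows [a = b]. *)
Lemma abs_cont_zero_derivative (a b : R) (z : R -> R) : a <= b ->
  scalar_abs_cont a b z ->
  {ae leb, forall t, t \in `[a, b] -> derivable z t 1 /\ 'D_1 z t = 0} ->
  z b = z a.
Proof.
move=> ab ac [A [mA A0 hA]].
apply/eqP; rewrite -subr_eq0 -normr_le0; apply/ler_addgt0Pr => e e0; rewrite add0r.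
pose e1 := e / (b - a + 1).
have ba1 : 0 < b - a + 1 by rewrite ltr_wpDl// subr_ge0.
have e10 : 0 < e1 / 2 by rewrite divr_gt0// divr_gt0.
have e20 : 0 < e / 2 by rewrite divr_gt0.
have [d d0 hd] := ac _ e20.
have [U [oU AU muU]] : exists U : set R, [/\ open U, A `<=` U & (leb U < d%:E)%E].
  have Afin : (leb A < +oo)%E by rewrite A0 ltry.
  have [U [oU AU UA]] := lebesgue_regularity_outer mA Afin d0.
  exists U; split => //.
  have -> : U = A `|` (U `\` A) by rewrite setDE setUIr setUv setIT setUC; apply/esym/setUidl.
  apply: le_lt_trans UA; apply: (@le_trans _ _ (leb A + leb (U `\` A))%E).
    by apply: measureU2 => //; apply: measurableD => //; exact: open_measurable.
  by rewrite [leb A]A0 add0e.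
have : chained z U a (e / 2 / (b - a + 1)) b.
  apply: chained_all => //.
    by rewrite ltW// divr_gt0.
  move=> t tab; have [tA|tA] := pselect (A t).
    have /nbhs_ballP[r /= r0 hr] := open_nbhs_nbhs (conj oU (AU _ tA)).
    by exists r => //; left => s sr; apply: hr; rewrite /ball/= distrC.
  have [dz Dz] : derivable z t 1 /\ 'D_1 z t = 0.
    by apply: contrapT => h; apply: tA; apply: hA => /= /(_ _) hh; apply: h; apply: hh; rewrite in_itv/=.
  have e3 : 0 < e / 2 / (b - a + 1) by rewrite divr_gt0.
  have [r r0 hr] := derivable_zero_slope e3 dz Dz.
  by exists r => //; right.
move=> [k [u [v [h1 h2 h3 h4]]]].
have h5 : \sum_(i < k) (v i - u i) < d.
  rewrite -lte_fin; apply: le_lt_trans h3 _; apply: le_lt_trans muU.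
  apply: le_measure; rewrite ?inE//; last exact: open_measurable.
  by apply: measurableI => //; exact: open_measurable.
have h6 := hd k u v h1 h2 h5.
apply: (le_trans h4).
have : e / 2 / (b - a + 1) * (b - a) <= e / 2.
  rewrite mulrAC ler_pdivrMr// ler_pM2l// lerDl//.
by move: h6; lra.
Qed.

End absolutely_continuous.

(** * Primitives *)

Section primitive.
Context {R : realType}.
Notation leb := (@lebesgue_measure R).
Implicit Types (a b s t : R) (f g : R -> R).

Definition prim a f t : R := \int[leb]_(r in `[a, t]) f r.

Definition itg a b f := leb.-integrable `[a, b] (EFin \o f).

Lemma itv_finite a b : (leb `[a, b] < +oo)%E.
Proof. by rewrite lebesgue_measure_itv/=; case: ifP => _; rewrite -?EFinB ltry. Qed.

Lemma itgS a b s t f : a <= s -> t <= b -> itg a b f -> itg s t f.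
Proof.
move=> as0 tb; apply: integrableS => //; apply: subset_itv; by rewrite bnd_simp.
Qed.

Lemma itg_bounded a b f (B : R) : measurable_fun `[a, b] f ->
  (forall t, a <= t <= b -> `|f t| <= B) -> itg a b f.
Proof.
move=> mf fB; apply: measurable_bounded_integrable => //; first exact: itv_finite.
exists B; split; first exact: num_real.
move=> x Bx t /= tab; apply: le_trans (fB t _) (ltW Bx).
by move: tab; rewrite /= in_itv.
Qed.

Lemma itg_measurable a b f : itg a b f -> measurable_fun `[a, b] f.
Proof. by move=> /integrableP[/measurable_EFinP]. Qed.

Lemma itgD a b f g : itg a b f -> itg a b g -> itg a b (fun t => f t + g t).
Proof. by move=> fi gi; have := integrableD _ fi gi; apply. Qed.

Lemma itgB a b f g : itg a b f -> itg a b g -> itg a b (fun t => f t - g t).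
Proof. by move=> fi gi; have := integrableB _ fi gi; apply. Qed.

Lemma itgZ a b (c : R) f : itg a b f -> itg a b (fun t => c * f t).
Proof. by move=> fi; have := integrableZl _ c fi; apply. Qed.

Lemma itg_cst a b (c : R) : itg a b (fun=> c).
Proof. by apply: (@itg_bounded _ _ _ `|c|) => // t; rewrite lexx. Qed.

Lemma primD a t f g : itg a t f -> itg a t g ->
  prim a (fun t => f t + g t) t = prim a f t + prim a g t.
Proof. by move=> fi gi; rewrite /prim RintegralD. Qed.

Lemma primB a t f g : itg a t f -> itg a t g ->
  prim a (fun t => f t - g t) t = prim a f t - prim a g t.
Proof. by move=> fi gi; rewrite /prim RintegralB. Qed.

Lemma primZ a t (c : R) f : itg a t f ->
  prim a (fun t => c * f t) t = c * prim a f t.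
Proof. by move=> fi; rewrite /prim RintegralZl. Qed.

Lemma prim_start a f : prim a f a = 0.
Proof. by rewrite /prim set_itv1 Rintegral_set1. Qed.

Lemma prim_cst a t (c : R) : a <= t -> prim a (fun=> c) t = c * (t - a).
Proof.
move=> at0; rewrite /prim Rintegral_cst//= lebesgue_measure_itv/= lte_fin.
move: at0; rewrite le_eqVlt => /predU1P[->|->]; last by [].
by rewrite ltxx subrr.
Qed.

Lemma eq_prim a t f g : (forall s, a <= s <= t -> f s = g s) ->
  prim a f t = prim a g t.
Proof. by move=> h; apply: eq_Rintegral => s; rewrite inE/= in_itv/=; exact: h. Qed.

Lemma le_prim a t f g : itg a t f -> itg a t g ->
  (forall s, a <= s <= t -> f s <= g s) -> prim a f t <= prim a g t.
Proof.
by move=> fi gi h; apply: le_Rintegral => // s; rewrite /= in_itv/=; exact: h.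
Qed.

Lemma prim_split a s t f : a <= s -> s <= t -> itg a t f ->
  prim a f t = prim a f s + prim s f t.
Proof.
move=> as0 st fi; rewrite -[LHS](subrK (prim a f s)) addrC; congr (_ + _).
rewrite /prim Rintegral_itvB ?bnd_simp// Rintegral_itv_obnd_cbnd//.
apply: integrableS fi => //; apply: subset_itv; by rewrite bnd_simp.
Qed.

(** Lebesgue differentiation applied to [f] extended by 0, which is integrable on the line. Near a
    point [t < b] the primitives of [f] and of its extension coincide. *)
Lemma prim_derivable a b f : itg a b f ->
  {ae leb, forall t, a < t < b -> derivable (prim a f) t 1 /\ 'D_1 (prim a f) t = f t}.
Proof.
move=> fi; pose fD := f \_ `[a, b].
have lf : locally_integrable setT fD by exact: integrable_locally.
have fDi : leb.-integrable setT (EFin \o fD).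
  have -> : EFin \o fD = (EFin \o f) \_ `[a, b] by rewrite restrict_EFin.
  have mI : measurable (`[a, b]%classic : set (measurableTypeR R)) by [].
  by have := (@integrable_mkcond _ _ R leb _ (EFin \o f) mI).1 fi.
have fDy (y : R) : leb.-integrable `[a, y] (EFin \o fD) by exact: integrableS fDi.
have := @FTC1 R fD (BLeft a) fDy lf.
apply: filterS; first exact: (ae_filter_ringOfSetsType leb).
move=> t ht /andP[at0 tb].
have at1 : (a <= t) by rewrite ltW.
have [d1 d2] : derivable (fun x : R => \int[leb]_(s in `[a, x]) fD s) t 1 /\
    (fun x : R => \int[leb]_(s in `[a, x]) fD s)^`()%classic t = fD t by exact: ht.
have E : {near t, (fun y => \int[leb]_(s in `[a, y]) fD s) =1 prim a f}.
  have : \forall y \near t, y < b by exact: lt_nbhsl.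
  apply: filterS => y yb; rewrite /prim; apply: eq_Rintegral => s.
  rewrite inE/= in_itv/= => /andP[as0 sy]; rewrite /fD patchE ifT//.
  by rewrite inE/= in_itv/= as0 (le_trans sy (ltW yb)).
split.
  exact: (near_eq_derivable E d1).
rewrite -(near_eq_derive (1 : R^o) E) -derive1E d2.
by rewrite /fD patchE ifT// inE/= in_itv/= (ltW at0) (ltW tb).
Qed.

(** The gain of a factor [1 / lam] when an exponential weight is integrated drives both the Gronwall
    bound and the contraction of corrections. *)
Lemma prim_exp a t (lam : R) : 0 < lam -> a <= t ->
  prim a (fun s => lam * expR (lam * (s - a))) t = expR (lam * (t - a)) - 1.
Proof.
move=> l0; rewrite le_eqVlt => /predU1P[<-|at0].
  by rewrite prim_start subrr mulr0 expR0 subrr.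
pose F s := expR (lam * (s - a)).
have dF s : is_derive s 1 F (lam * expR (lam * (s - a))).
  have h1 : is_derive s 1 (fun s => lam * (s - a)) lam.
    apply: is_derive_eq; rewrite /=.
    by rewrite subr0 [_ *: _]mulr1.
  have := @is_derive1_comp _ expR (fun s => lam * (s - a)) s _ _ (is_derive_expR _) h1.
  by rewrite /comp mulrC.
have cF : continuous F.
  by move=> s; apply/differentiable_continuous/derivable1_diffP; exact: ex_derive.
rewrite /prim /Rintegral (@continuous_FTC2 _ _ F)//.
- by rewrite /= /F subrr mulr0 expR0.
- apply: continuous_subspaceT => s.
  exact: (cvgM (cvg_cst lam) (cF s)).
- split.
  + by move=> x _; exact: ex_derive.
  + by apply: cvg_at_right_filter; exact: cF.
  + by apply: cvg_at_left_filter; exact: cF.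
- by move=> x _; rewrite derive1E; exact: derive_val.
Qed.

Lemma itg_exp a b (lam : R) : 0 < lam ->
  itg a b (fun s => lam * expR (lam * (s - a))).
Proof.
move=> l0.
apply: (@itg_bounded _ _ _ (lam * expR (lam * (b - a)))).
  apply: measurable_funM => //; apply: (@measurableT_comp _ _ _ _ _ _ (@expR R)) => //.
  by apply: measurable_funM => //; apply: measurable_funB.
move=> t /andP[at0 tb]; rewrite ger0_norm ?mulr_ge0 ?expR_ge0 ?(ltW l0)//.
by rewrite ler_pM2l// ler_expR ler_pM2l// lerB.
Qed.

End primitive.

Section vector_primitive.
Context {R : realType} {n : nat}.
Notation leb := (@lebesgue_measure R).
Implicit Types (a b s t : R) (v w : R -> 'rV[R]_n).

Definition vprim a v t : 'rV[R]_n := \row_i prim a (fun s => v s 0 i) t.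

Definition vitg a b v := forall i, itg a b (fun s => v s 0 i).

Lemma vitgS a b s t v : a <= s -> t <= b -> vitg a b v -> vitg s t v.
Proof. by move=> as0 tb vi i; exact: itgS (vi i). Qed.

Lemma vitg_bounded a b v (B : R) : measurable_row `[a, b] v ->
  (forall t, a <= t <= b -> enorm (v t) <= B) -> vitg a b v.
Proof.
move=> mv vB i; apply: (itg_bounded (B := B)); first exact: mv.
by move=> t /vB; apply: le_trans; exact: coord_le_enorm.
Qed.

Lemma vprim_start a v : vprim a v a = 0.
Proof. by apply/rowP => i; rewrite !mxE prim_start. Qed.

Lemma vprim_split a s t v : a <= s -> s <= t -> vitg a t v ->
  vprim a v t = vprim a v s + vprim s v t.
Proof.
by move=> as0 st vi; apply/rowP => i; rewrite !mxE (@prim_split _ a s t)//; exact: vi.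
Qed.

Lemma vprimB a t v w : vitg a t v -> vitg a t w ->
  vprim a (fun s => v s - w s) t = vprim a v t - vprim a w t.
Proof.
move=> vi wi; apply/rowP => i; rewrite !mxE -primB ?vi ?wi//.
by apply: eq_prim => s _; rewrite !mxE.
Qed.

Lemma dotv_vprim a t v (u : 'rV[R]_n) : vitg a t v ->
  dotv u (vprim a v t) = prim a (fun s => dotv u (v s)) t /\
  itg a t (fun s => dotv u (v s)).
Proof.
move=> vi.
have h (r : seq 'I_n) : \sum_(i <- r) u 0 i * prim a (fun s => v s 0 i) t =
    prim a (fun s => \sum_(i <- r) u 0 i * v s 0 i) t /\
    itg a t (fun s => \sum_(i <- r) u 0 i * v s 0 i).
  elim: r => [|i r [IH1 IH2]].
    rewrite big_nil; split; last by under eq_fun do rewrite big_nil; exact: itg_cst.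
    under [X in _ = prim _ X _]eq_fun do rewrite big_nil.
    by rewrite /prim Rintegral_cst//= mul0r.
  have vii : itg a t (fun s => u 0 i * v s 0 i) by apply: itgZ; exact: vi.
  rewrite big_cons IH1 -primZ; last exact: vi.
  rewrite -primD//; split.
    by apply: eq_prim => s _; rewrite big_cons.
  by under eq_fun do rewrite big_cons; exact: itgD.
have [h1 h2] := h (index_enum 'I_n).
by split => //; rewrite /dotv -h1; apply: eq_bigr => i _; rewrite !mxE.
Qed.

(** Pairing the integral [u] with itself turns [|u|^2] into a scalar integral, at most [|u|] times
    that of [phi]. *)
Lemma enorm_vprim a t v (phi : R -> R) : a <= t -> vitg a t v -> itg a t phi ->
  (forall s, a <= s <= t -> enorm (v s) <= phi s) ->
  enorm (vprim a v t) <= prim a phi t.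
Proof.
move=> at0 vi pi vphi; set u := vprim a v t.
have [u0|u0] := eqVneq (enorm u) 0.
  rewrite u0 -(mul0r (t - a)) -prim_cst//; apply: le_prim => //; first exact: itg_cst.
  by move=> s /vphi; apply: le_trans; exact: enorm_ge0.
have up : 0 < enorm u by rewrite lt_neqAle eq_sym u0 enorm_ge0.
have [uE ui] := dotv_vprim u vi.
rewrite -(ler_pM2l up) -expr2 sqr_enorm uE -primZ//.
apply: le_prim => //; first exact: itgZ.
move=> s /vphi h; apply: le_trans (dotv_le _ _) _.
by rewrite ler_wpM2l// enorm_ge0.
Qed.

Lemma enorm_vprim_diff a b s t v (phi : R -> R) : a <= s -> s <= t -> t <= b ->
  vitg a b v -> itg a b phi ->
  (forall r, a <= r <= b -> enorm (v r) <= phi r) ->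
  enorm (vprim a v t - vprim a v s) <= prim s phi t.
Proof.
move=> as0 st tb vi pi h.
rewrite (@vprim_split a s t)//; last exact: vitgS vi.
rewrite addrAC subrr add0r; apply: enorm_vprim => //.
- exact: vitgS vi.
- exact: itgS pi.
- by move=> r /andP[sr rt]; apply: h; rewrite (le_trans as0 sr) (le_trans rt tb).
Qed.

Lemma vprim_exp_le a b t v (lam A : R) : 0 < lam -> 0 <= A -> a <= t -> t <= b ->
  vitg a b v ->
  (forall s, a <= s <= b -> enorm (v s) <= A * (lam * expR (lam * (s - a)))) ->
  enorm (vprim a v t) <= A * (expR (lam * (t - a)) - 1).
Proof.
move=> l0 A0 at0 tb vi h.
have ei := @itg_exp _ a t lam l0.
rewrite -prim_exp// -primZ//; apply: enorm_vprim => //.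
- exact: vitgS vi.
- exact: itgZ.
- by move=> s /andP[as0 st]; apply: h; rewrite as0 (le_trans st tb).
Qed.

Lemma vprim_lipschitz a b v (B : R) : measurable_row `[a, b] v ->
  (forall t, a <= t <= b -> enorm (v t) <= B) ->
  forall s t, a <= s -> s <= t -> t <= b ->
    enorm (vprim a v t - vprim a v s) <= B * (t - s).
Proof.
move=> mv vB s t as0 st tb; rewrite -prim_cst//.
apply: (enorm_vprim_diff as0 st tb) => //; first exact: vitg_bounded vB.
exact: itg_cst.
Qed.

End vector_primitive.

(** * Filippov's theorem *)

Section geometric_limits.
Context {R : realType}.

Notation half j := ((2^-1 : R) ^+ j).

Lemma half_ge0 j : 0 <= half j.
Proof. by rewrite exprn_ge0// invr_ge0. Qed.

Lemma halfS j : half j.+1 = half j / 2.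
Proof. by rewrite exprSr. Qed.

Lemma half_cvg0 (c : R) : (fun j => c * half j) @ \oo --> (0 : R).
Proof. by apply: cvg_geometric; rewrite gtr0_norm ?invf_lt1 ?ltr1n// invr_gt0. Qed.

Lemma le_of_half (a b c : R) : (forall j, a <= b + c * half j) -> a <= b.
Proof.
move=> h; apply/ler_addgt0Pr => e e0.
have /cvgrPdist_le /(_ e e0) [N _ hN] := half_cvg0 c.
have := hN N (leqnn N); rewrite sub0r normrN => hc.
apply: le_trans (h N) _; rewrite lerD2l.
exact: le_trans (ler_norm _) hc.
Qed.

(** The sequences [b] and [c], obtained by shifting [a] down and up by the remaining tail, are
    monotone and enclose the limit, which gives the explicit rate at once. *)
Lemma geometric_cauchy_limit (a : nat -> R) (A : R) :
  (forall j, `|a j.+1 - a j| <= A * half j) ->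
  exists2 l : R, a @ \oo --> l & forall j, `|l - a j| <= 2 * A * half j.
Proof.
move=> ha.
have A0 : 0 <= A by have := ha 0%N; rewrite expr0 mulr1; apply: le_trans.
pose b j := a j - 2 * A * half j; pose c j := a j + 2 * A * half j.
have nb : {homo b : i j / (i <= j)%N >-> i <= j}.
  apply: homo_leq => [//|x y z|j]; first exact: le_trans.
  have := ha j; rewrite ler_norml => /andP[h1 h2].
  by rewrite /b halfS; lra.
have nc : {homo c : i j / (i <= j)%N >-> j <= i}.
  apply: homo_leq => [//|x y z xy yz|j]; first exact: le_trans yz xy.
  have := ha j; rewrite ler_norml => /andP[h1 h2].
  by rewrite /c halfS; lra.
have bc i j : b i <= c j.
  apply: (@le_trans _ _ (b (maxn i j))); first by apply: nb; rewrite leq_maxl.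
  apply: (@le_trans _ _ (c (maxn i j))); last by apply: nc; rewrite leq_maxr.
  have : 0 <= 2 * A * half (maxn i j) by rewrite !mulr_ge0 ?half_ge0.
  by rewrite /b /c; lra.
pose l := sup (range b).
have bl j : b j <= l.
  apply: sup_upper_bound; last by exists j.
  by split; [exists (b 0%N), 0%N|exists (c 0%N) => _ [i _ <-]].
have lc j : l <= c j by apply: ge_sup; [exists (b 0%N), 0%N|move=> _ [i _ <-]].
have lE j : `|l - a j| <= 2 * A * half j.
  by rewrite ler_norml; have := bl j; have := lc j; rewrite /b /c => h1 h2; apply/andP; split; lra.
exists l => //; apply/cvgrPdist_le => e e0.
have /cvgrPdist_le /(_ e e0) := half_cvg0 (2 * A).
apply: filterS => j; rewrite sub0r normrN; apply: le_trans.
exact: le_trans (lE j) (ler_norm _).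
Qed.

(** Limits are taken coordinatewise, which preserves measurability; the factor [n] is the price of
    summing the coordinates. *)
Lemma geometric_cauchy_row_limit n (D : set R) (u : nat -> R -> 'rV[R]_n) (A : R) :
  (forall j, measurable_row D (u j)) ->
  (forall j t, D t -> enorm (u j.+1 t - u j t) <= A * half j) ->
  exists V, measurable_row D V /\
    forall j t, D t -> enorm (V t - u j t) <= n%:R * (2 * A) * half j.
Proof.
move=> mu hu.
have lim_ex t i : exists l : R, D t ->
    ((fun j => u j t 0 i) @ \oo --> l) /\ forall j, `|l - u j t 0 i| <= 2 * A * half j.
  have [Dt|nDt] := pselect (D t); last by exists 0.
  have [j|l l1 l2] := @geometric_cauchy_limit (fun j => u j t 0 i) A.
    apply: le_trans (hu j t Dt); apply: le_trans (coord_le_enorm _ i).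
    by rewrite !mxE.
  by exists l.
have [l hl] := choice (fun ti : R * 'I_n => lim_ex ti.1 ti.2).
exists (fun t => \row_i l (t, i)); split.
- move=> i; apply: (@measurable_fun_cvg _ _ R D (fun j t => u j t 0 i)).
    by move=> j; exact: mu.
  by move=> t Dt; rewrite mxE; exact: (hl (t, i) Dt).1.
- move=> j t Dt; apply: le_trans (enorm_le_sum _) _.
  rewrite -mulrA mulr_natl -[X in _ *+ X]card_ord -sumr_const; apply: ler_sum => i _.
  by rewrite !mxE; exact: (hl (t, i) Dt).2.
Qed.

End geometric_limits.

(** * The iterative correction of approximate trajectories *)

Section filippov.
Context {R : realType} {n : nat}.
Variables (T : R) (H : R -> 'rV[R]_n -> 'rV[R]_n -> R) (C : R) (K : R -> R).
Implicit Types (p q x : 'rV[R]_n) (t : R).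

(** The hypotheses on [H] with [c] and [k r] replaced by constants in time. The last clause provides
    the measurability in time that the selection along a Lipschitz curve requires. *)
Definition regular_hamiltonian :=
  [/\ 0 <= C,
      forall t x p q, 0 <= t <= T ->
        `|H t x p - H t x q| <= C * (1 + enorm x) * enorm (p - q),
      forall t x p q (lam : R), 0 <= t <= T -> 0 <= lam <= 1 ->
        H t x (lam *: p + (1 - lam) *: q) <= lam * H t x p + (1 - lam) * H t x q,
      forall r t x y p, 0 < r -> 0 <= t <= T -> enorm x <= r -> enorm y <= r ->
        `|H t x p - H t y p| <= K r * (1 + enorm p) * enorm (x - y) &
      forall s t y (L : R), 0 <= s -> t <= T ->
        (forall a b, s <= a -> a <= b -> b <= t -> enorm (y b - y a) <= L * (b - a)) ->
        forall p, measurable_fun `[s, t] (fun r => H r (y r) p)].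

Hypothesis regH : regular_hamiltonian.

(** For [d >= 0], adding [d * (1 + enorm p)] to the Hamiltonian enlarges its epigraph by a ball of
    radius [d] in velocity and lowers it by [d] in cost. For [d = 0] this is membership of
    [(v, eta)] in the epigraph. *)
Definition included t x (v : 'rV[R]_n) (eta d : R) :=
  forall p, dotv v p - eta <= H t x p + d * (1 + enorm p).

Lemma included_weaken t x v (eta eta' d d' : R) : included t x v eta d ->
  eta <= eta' -> d <= d' -> included t x v eta' d'.
Proof.
move=> h e1 d1 p; have := h p; have : d * (1 + enorm p) <= d' * (1 + enorm p).
  by rewrite ler_wpM2r// addr_ge0// enorm_ge0.
by lra.
Qed.

Lemma included_move r t x y v (eta d : R) : 0 < r -> 0 <= t <= T ->
  enorm x <= r -> enorm y <= r -> included t x v eta d ->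
  included t y v eta (d + K r * enorm (x - y)).
Proof.
move=> r0 tT xr yr h p; have [_ _ _ hK _] := regH.
have := hK r t x y p r0 tT xr yr; have := h p.
rewrite ler_norml => h1 /andP[h2 h3].
have -> : (d + K r * enorm (x - y)) * (1 + enorm p) =
   d * (1 + enorm p) + K r * (1 + enorm p) * enorm (x - y) by ring.
by lra.
Qed.

(** Testing with [p = s *: v] for large [s]: the left side grows like [s * |v|^2], the right side at
    most like [s * |v|] times the asserted bound. *)
Lemma included_velocity t x v (eta d : R) : 0 <= t <= T -> 0 <= d ->
  included t x v eta d -> enorm v <= C * (1 + enorm x) + d.
Proof.
move=> tT d0 h; have [C0 hC _ _ _] := regH.
have CX0 : 0 <= C * (1 + enorm x) by rewrite mulr_ge0// addr_ge0 ?enorm_ge0.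
pose a : R := eta + H t x 0 + d.
have hs (s : R) : 0 <= s ->
    s * (enorm v ^+ 2 - (C * (1 + enorm x) + d) * enorm v) <= a.
  move=> s0; have := h (s *: v); have := hC t x (s *: v) 0 tT.
  rewrite ler_norml subr0 enormZ ger0_norm// dotvZr -sqr_enorm /a => /andP[_].
  move: (enorm v) (H t x (s *: v)) (H t x 0) (C * (1 + enorm x)) => N h1 h2 c.
  by lra.
rewrite leNgt; apply/negP; move: hs.
set b : R := C * (1 + enorm x) + d => hs vb.
have b0 : 0 <= b by rewrite addr_ge0.
have v0 : 0 < enorm v := le_lt_trans b0 vb.
have w0 : 0 < enorm v ^+ 2 - b * enorm v.
  by rewrite expr2 -mulrBl mulr_gt0// subr_gt0.
have a1 : 0 <= (`|a| + 1) / (enorm v ^+ 2 - b * enorm v).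
  by apply: divr_ge0; [rewrite addr_ge0|exact: ltW].
have := hs _ a1.
rewrite divfK ?gt_eqF//.
by have := ler_norm a; lra.
Qed.

(** The inclusion holds at every time, not almost everywhere: an exceptional null set is absorbed in
    the defect [d], of which the estimates retain only the integral. *)
Record qtraj (t0 : R) (x0 : 'rV[R]_n) (y v : R -> 'rV[R]_n) (eta d : R -> R) (B : R) : Prop :=
  QTraj {
    q_meas : measurable_row `[t0, T] v;
    q_bound : forall t, t0 <= t <= T -> enorm (v t) <= B;
    q_eta : itg t0 T eta;
    q_defect : itg t0 T d;
    q_defect_ge0 : forall t, t0 <= t <= T -> 0 <= d t;
    q_curve : forall t, t0 <= t <= T -> y t = x0 + vprim t0 v t;
    q_incl : forall t, t0 <= t <= T -> included t (y t) (v t) (eta t) (d t) }.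

Lemma curve_lipschitz t0 x0 y v (B : R) : measurable_row `[t0, T] v ->
  (forall t, t0 <= t <= T -> enorm (v t) <= B) ->
  (forall t, t0 <= t <= T -> y t = x0 + vprim t0 v t) ->
  forall a b, t0 <= a -> a <= b -> b <= T -> enorm (y b - y a) <= B * (b - a).
Proof.
move=> mv vB yE a b ta ab bT.
rewrite !yE ?ta ?bT ?(le_trans ab bT) ?(le_trans ta ab)//.
rewrite opprD addrACA subrr add0r; exact: vprim_lipschitz.
Qed.

Section step.
Variables (t0 : R) (x0 : 'rV[R]_n) (M : R).
Hypotheses (t00 : 0 <= t0) (t0T : t0 <= T) (Mx0 : 1 + enorm x0 <= M).

Let growth t := M * expR ((C + 1) * (t - t0)).

Let inT t : t0 <= t <= T -> 0 <= t <= T.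
Proof. by move=> /andP[h ->]; rewrite (le_trans t00 h). Qed.

Let C1 : 0 < C + 1.
Proof. by have [C0 _ _ _ _] := regH; rewrite ltr_wpDl. Qed.

Let M1 : 1 <= M.
Proof. by apply: le_trans Mx0; rewrite lerDl enorm_ge0. Qed.

Let M0 : 0 <= M := le_trans ler01 M1.

Let M_le_growth t : t0 <= t -> M <= growth t.
Proof.
move=> tt; rewrite ler_peMr//.
by rewrite -[leLHS]expR0 ler_expR mulr_ge0// ?subr_ge0// ltW.
Qed.

Lemma growth_le t : t <= T -> growth t <= M * expR ((C + 1) * (T - t0)).
Proof.
move=> tT; rewrite ler_wpM2l//.
by rewrite ler_expR ler_wpM2l ?(ltW C1)// lerB.
Qed.

(** The bound by [growth] reproduces itself, which confines all iterates to one ball: as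
    [e <= 1 <= growth t], the new velocity is at most [(C + 1) * growth t], and this integrates to
    [growth t - M]. *)
Lemma filippov_step (y v : R -> 'rV[R]_n) (eta delta : R -> R) (B e : R) :
  (forall a b, t0 <= a -> a <= b -> b <= T -> enorm (y b - y a) <= B * (b - a)) ->
  (forall t, t0 <= t <= T -> 1 + enorm (y t) <= growth t) ->
  measurable_row `[t0, T] v -> measurable_fun `[t0, T] eta ->
  measurable_fun `[t0, T] delta -> (forall t, t0 <= t <= T -> 0 < delta t) ->
  0 < e -> e <= 1 ->
  (forall t, t0 <= t <= T -> included t (y t) (v t) (eta t) (delta t)) ->
  exists u, [/\ measurable_row `[t0, T] u,
    forall t, t0 <= t <= T -> enorm (u t - v t) <= 4 * delta t,
    forall t, t0 <= t <= T -> enorm (u t) <= (C + 1) * growth t,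
    forall t, t0 <= t <= T -> 1 + enorm (x0 + vprim t0 u t) <= growth t &
    forall t, t0 <= t <= T -> included t (y t) (u t) (eta t + 3 * delta t) e].
Proof.
move=> yL yM mv meta mdelta d0 e0 e1 hincl.
have [C0 hC hconv _ hm] := regH.
have [u [mu ud uincl]] := @measurable_selection R n `[t0, T]
  (fun t => H t (y t)) v eta delta (fun t => C * (1 + enorm (y t))) e
  (measurable_itv _) (hm t0 T y B t00 (lexx T) yL)
  (fun t p q tD => hC t (y t) p q (inT (t := t) tD))
  (fun t p q lam tD => hconv t (y t) p q lam (inT (t := t) tD)) mv meta mdelta d0 e0
  (fun t p tD => hincl t tD p).
have uB t : t0 <= t <= T -> enorm (u t) <= (C + 1) * growth t.
  move=> tD; have /andP[tt tT] := tD.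
  have := included_velocity (inT tD) (ltW e0) (fun p => uincl t p tD).
  have h1 : C * (1 + enorm (y t)) <= C * growth t by rewrite ler_wpM2l// yM.
  have := M_le_growth tt; move: M1; rewrite mulrDl mul1r.
  by move: h1 e1; lra.
have vu : vitg t0 T u.
  apply: (vitg_bounded (B := (C + 1) * (M * expR ((C + 1) * (T - t0))))) => // t tD.
  apply: le_trans (uB t tD) _; rewrite ler_pM2l//; apply: growth_le.
  by case/andP: tD.
exists u; split => //; last by move=> t tD p; exact: uincl.
move=> t /andP[tt tT].
have h : enorm (vprim t0 u t) <= M * (expR ((C + 1) * (t - t0)) - 1).
  apply: (vprim_exp_le C1 M0 tt tT vu) => s sD.
  apply: le_trans (uB s sD) _.
  by rewrite /growth mulrCA.
have := enormD x0 (vprim t0 u t).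
by rewrite /growth; move: h Mx0; rewrite mulrBr mulr1; lra.
Qed.


(** The constant 12 covers both bounds. Displacements add up to at most [4 * I + 8 * I * E T]. Extra
    costs, three times each defect, integrate to at most [3 * I + 6 * I * (E T - 1)]. *)
Lemma filippov (r eps : R) y0 v0 eta0 d B :
  M * expR ((C + 1) * (T - t0)) <= r -> 0 < K r -> 0 < eps ->
  qtraj t0 x0 y0 v0 eta0 d B -> (forall t, t0 <= t <= T -> 1 + enorm (y0 t) <= M) ->
  exists y v eta B', [/\ qtraj t0 x0 y v eta (fun=> 0) B',
    enorm (y T - y0 T) <=
      12 * expR (8 * K r * T) * (prim t0 d T + eps * (T + 1)) &
    prim t0 eta T <= prim t0 eta0 T +
      12 * expR (8 * K r * T) * (prim t0 d T + eps * (T + 1))].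
Proof.
move=> Mr; set Kr := K r => Kr0 eps0 q0 y0M.
have T0 : 0 <= T := le_trans t00 t0T.
have r0 : 0 < r.
  by apply: lt_le_trans Mr; rewrite mulr_gt0 ?expR_gt0// (lt_le_trans ltr01).
(* The rate 8 is chosen so that [4 * Kr / lam = 1 / 2]: velocity change, integration and (HLC)
   together halve the defect. *)
pose lam : R := 8 * Kr; pose E t : R := expR (lam * (t - t0)).
(* The selection needs positive defects, hence [d + eps] instead of [d]; with [T + 1] in place of
   [T] the bound [I] is positive even for [T = 0]. *)
pose I : R := prim t0 d T + eps * (T + 1).
have lam0 : 0 < lam by rewrite mulr_gt0.
have E1 t : t0 <= t -> 1 <= E t.
  by move=> tt; rewrite -[leLHS]expR0 ler_expR mulr_ge0 ?subr_ge0// ltW.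
have ET t : t <= T -> E t <= E T.
  by move=> tT; rewrite ler_expR ler_pM2l// lerB.
have ETle : E T <= expR (8 * K r * T).
  by rewrite ler_expR ler_pM2l// gerBl.
have di : itg t0 T d := q_defect q0.
have dei t : t0 <= t -> t <= T -> itg t0 t (fun s => d s + eps).
  by move=> tt tT; apply: itgS (lexx _) tT _; apply: itgD => //; exact: itg_cst.
have pd0 : 0 <= prim t0 d T.
  rewrite -(mul0r (T - t0)) -prim_cst//; apply: le_prim => //; first exact: itg_cst.
  exact: q_defect_ge0 q0.
have I0 : 0 < I by rewrite ltr_wpDl// mulr_gt0// ltr_wpDl.
have dI t : t0 <= t -> t <= T -> prim t0 (fun s => d s + eps) t <= I.
  move=> tt tT; rewrite primD; last exact: itg_cst; last exact: itgS (lexx _) tT di.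
  rewrite prim_cst// lerD//; last first.
    by rewrite ler_pM2l// lerBlDr; move: t00 tT; lra.
  rewrite (@prim_split _ t0 t T)// lerDl -(mul0r (T - t)) -prim_cst//.
  apply: le_prim => //; [exact: itg_cst|exact: itgS tt (lexx _) di|].
  by move=> s /andP[ts sT]; apply: (q_defect_ge0 q0); rewrite (le_trans tt ts).
pose qq : R := lam * I.
have qq0 : 0 < qq by rewrite mulr_gt0.
pose z (u : R -> 'rV[R]_n) t := x0 + vprim t0 u t.
pose gT := M * expR ((C + 1) * (T - t0)).
have growth_r x t : t <= T -> 1 + enorm x <= growth t -> enorm x <= r.
  by move=> tT; have := growth_le tT; move: Mr; rewrite -/gT; lra.
have Mgr t : t0 <= t <= T -> 1 + enorm (y0 t) <= growth t.
  by move=> tD; apply: le_trans (y0M t tD) _; apply: M_le_growth; case/andP: tD.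
have CgT t : t0 <= t <= T -> (C + 1) * growth t <= (C + 1) * gT.
  by move=> /andP[_ tT]; rewrite ler_pM2l//; exact: growth_le.
have y0L := curve_lipschitz (q_meas q0) (q_bound q0) (q_curve q0).
(* Moving the curve by [4 * I] costs a defect [4 * Kr * I]; an equal tolerance brings the total to
   [qq = 8 * Kr * I]. *)
have D0 : 0 < Num.min 1 (4 * Kr * I) by rewrite lt_min ltr01 !mulr_gt0.
have D1 : Num.min 1 (4 * Kr * I) <= 1 :> R by rewrite ge_min lexx.
have D2 : Num.min 1 (4 * Kr * I) <= 4 * Kr * I by rewrite ge_min lexx orbT.
have mdelta : measurable_fun `[t0, T] (fun t => d t + eps).
  by apply: measurable_funD => //; exact: itg_measurable.
(* The initial defect is controlled through its integral only. One correction turns this into a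
   uniform displacement, hence into a defect bounded by [qq * E t], from which the geometric
   iteration can start. *)
have [|t tD|u0 [mu0 u0v u0B u0M u0i]] := filippov_step y0L Mgr (q_meas q0)
  (itg_measurable (q_eta q0)) mdelta _ D0 D1 _.
- by move=> t tD; rewrite ltr_wpDl// (q_defect_ge0 q0).
- by apply: included_weaken (q_incl q0 tD) (lexx _) _; rewrite lerDl ltW.
pose eta1 t : R := eta0 t + 3 * (d t + eps).
(* The term [6 * qq * (1 - 2^-1 ^+ j) * E t] is the sum of three times the first [j] defects. *)
pose Inv (j : nat) (u : R -> 'rV[R]_n) := [/\ measurable_row `[t0, T] u,
  forall t, t0 <= t <= T -> enorm (u t) <= (C + 1) * growth t,
  forall t, t0 <= t <= T -> 1 + enorm (z u t) <= growth t,
  forall t, t0 <= t <= T -> included t (z u t) (u t)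
    (eta1 t + 6 * qq * (1 - 2^-1 ^+ j) * E t) (qq * 2^-1 ^+ j * E t) &
  enorm (z u T - y0 T) <= 4 * I + 8 * I * E T * (1 - 2^-1 ^+ j)].
have vi (u : R -> 'rV[R]_n) : measurable_row `[t0, T] u ->
    (forall t, t0 <= t <= T -> enorm (u t) <= (C + 1) * growth t) -> vitg t0 T u.
  move=> mu uB; apply: (vitg_bounded (B := (C + 1) * gT)) => // t tD.
  exact: le_trans (uB t tD) (CgT t tD).
have v0i : vitg t0 T v0 := vitg_bounded (q_meas q0) (q_bound q0).
have zB (u w : R -> 'rV[R]_n) t : t0 <= t -> t <= T -> vitg t0 T u -> vitg t0 T w ->
    z u t - z w t = vprim t0 (fun s => u s - w s) t.
  move=> tt tT ui wi; rewrite vprimB; [|exact: vitgS ui|exact: vitgS wi].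
  by rewrite /z opprD addrACA subrr add0r.
have viB (u w : R -> 'rV[R]_n) : vitg t0 T u -> vitg t0 T w -> vitg t0 T (fun s => u s - w s).
  move=> ui wi i; have := itgB (ui i) (wi i); congr itg.
  by apply/funext => s; rewrite !mxE.
have z0y0 t : t0 <= t <= T -> enorm (z u0 t - y0 t) <= 4 * I.
  move=> tD; have /andP[tt tT] := tD.
  have -> : y0 t = z v0 t by rewrite (q_curve q0).
  have u0i' := vi u0 mu0 u0B.
  rewrite zB//; apply: (@le_trans _ _ (prim t0 (fun s => 4 * (d s + eps)) t)).
    apply: enorm_vprim => //.
    - exact: vitgS (viB _ _ u0i' v0i).
    - by apply: itgZ; exact: dei.
    - by move=> s /andP[ts st]; apply: u0v; rewrite ts (le_trans st tT).
  by rewrite primZ ?ler_pM2l ?dI// ; exact: dei.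
have Inv0 : Inv 0%N u0.
  split => //.
  - move=> t tD; have /andP[tt tT] := tD.
    have h := included_move r0 (inT tD) (growth_r _ t tT (Mgr t tD))
      (growth_r _ t tT (u0M t tD)) (u0i t tD).
    apply: included_weaken h _ _.
      by rewrite expr0 subrr mulr0 mul0r addr0 /eta1.
    rewrite expr0 mulr1 -/Kr enormB.
    have h1 : Kr * enorm (z u0 t - y0 t) <= Kr * (4 * I) by rewrite ler_pM2l// z0y0.
    have h2 : qq * 1 <= qq * E t by rewrite ler_pM2l// E1.
    have h3 : qq = 8 * Kr * I by [].
    by move: h1 h2 D2 h3; rewrite /z; lra.
  - by rewrite expr0 subrr mulr0 addr0 z0y0// t0T lexx.
have next j u : Inv j u -> exists u', Inv j.+1 u' /\
    forall t, t0 <= t <= T -> enorm (u' t - u t) <= 4 * qq * E T * 2^-1 ^+ j.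
  move=> [mu uB uM ui uT].
  have hj : 0 < 2^-1 ^+ j :> R by rewrite exprn_gt0// invr_gt0.
  set hf : R := 2^-1 ^+ j in hj ui uT *.
  have uB' t : t0 <= t <= T -> enorm (u t) <= (C + 1) * gT.
    by move=> tD; exact: le_trans (uB t tD) (CgT t tD).
  have zL := curve_lipschitz mu uB' (fun t tD => erefl (z u t)).
  (* The displacement produces the defect [qq / 2 * hf * (E t - 1)]. The missing [- 1] is exactly
     the tolerance available for rounding. *)
  have e0 : 0 < Num.min 1 (qq / 2 * hf) by rewrite lt_min ltr01 !mulr_gt0// invr_gt0.
  have e1 : Num.min 1 (qq / 2 * hf) <= 1 :> R by rewrite ge_min lexx.
  have e2 : Num.min 1 (qq / 2 * hf) <= qq / 2 * hf by rewrite ge_min lexx orbT.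
  have mE : measurable_fun `[t0, T] E.
    apply: (@measurableT_comp _ _ _ _ _ _ (@expR R)) => //.
    by apply: measurable_funM => //; apply: measurable_funB.
  have meta : measurable_fun `[t0, T] (fun t => eta1 t + 6 * qq * (1 - hf) * E t).
    apply: measurable_funD; last exact: measurable_funM.
    apply: measurable_funD; last exact: measurable_funM.
    exact: itg_measurable (q_eta q0).
  have mdl : measurable_fun `[t0, T] (fun t => qq * hf * E t) by apply: measurable_funM.
  have dl0 t : t0 <= t <= T -> 0 < qq * hf * E t by rewrite !mulr_gt0// expR_gt0.
  have [u' [mu' u'u u'B u'M u'i]] := filippov_step zL uM mu meta mdl dl0 e0 e1 ui.
  have ui' := vi u mu uB; have u'i' := vi u' mu' u'B.
  have zz t : t0 <= t <= T -> enorm (z u' t - z u t) <= 4 * I * hf * (E t - 1).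
    move=> /andP[tt tT]; rewrite zB//.
    apply: (vprim_exp_le lam0 _ tt tT (viB _ _ u'i' ui')).
      by rewrite !mulr_ge0// ltW.
    move=> s sD; apply: le_trans (u'u s sD) _.
    by rewrite le_eqVlt; apply/orP; left; apply/eqP; rewrite /qq /E; ring.
  exists u'; split; last first.
    move=> t tD; apply: le_trans (u'u t tD) _.
    have h : qq * hf * E t <= qq * hf * E T.
      by rewrite ler_pM2l ?mulr_gt0// ET//; case/andP: tD.
    by move: h; lra.
  split => //.
  - move=> t tD; have /andP[tt tT] := tD.
    have h := included_move r0 (inT tD) (growth_r _ t tT (uM t tD))
      (growth_r _ t tT (u'M t tD)) (u'i t tD).
    apply: included_weaken h _ _.
      rewrite exprSr -/hf le_eqVlt; apply/orP; left; apply/eqP.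
      by field.
    rewrite -/Kr enormB exprSr -/hf.
    have h1 : Kr * enorm (z u' t - z u t) <= Kr * (4 * I * hf * (E t - 1)).
      by rewrite ler_pM2l// zz.
    have h2 : Kr * (4 * I * hf * (E t - 1)) = qq / 2 * hf * (E t - 1).
      by rewrite /qq /lam; field.
    rewrite h2 in h1.
    have h3 : qq * (hf / 2) * E t = qq / 2 * hf * (E t - 1) + qq / 2 * hf by field.
    rewrite h3 addrC; exact: lerD h1 e2.
  - rewrite exprSr -/hf.
    have h1 := enorm_trans (z u T) (z u' T) (y0 T).
    have h2 := zz T; rewrite t0T lexx in h2.
    have {}h2 := h2 isT.
    have h3 : 0 <= 4 * I * hf by rewrite !mulr_ge0// ltW.
    have h4 : 8 * I * E T * (1 - hf / 2) =
       8 * I * E T * (1 - hf) + 4 * I * hf * (E T - 1) + 4 * I * hf by field.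
    rewrite h4.
    by move: h1 h2 h3 uT; lra.
(* Choice needs a total statement, so a pair outside the invariant is left unchanged. *)
have nextc (ju : nat * (R -> 'rV[R]_n)) : exists u', Inv ju.1 ju.2 -> Inv ju.1.+1 u' /\
    forall t, t0 <= t <= T -> enorm (u' t - ju.2 t) <= 4 * qq * E T * 2^-1 ^+ ju.1.
  have [iv|niv] := pselect (Inv ju.1 ju.2); last by exists ju.2.
  by have [u' hu'] := next _ _ iv; exists u'.
have [F hF] := choice nextc.
pose U := fix U (j : nat) := if j is k.+1 then F (k, U k) else u0.
have UI j : Inv j (U j).
  by elim: j => [//|j IH]; exact: (hF (j, U j) IH).1.
have UU j t : `[t0, T]%classic t -> enorm (U j.+1 t - U j t) <= 4 * qq * E T * 2^-1 ^+ j.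
  by move=> tD; exact: (hF (j, U j) (UI j)).2.
have mU j : measurable_row `[t0, T] (U j) by case: (UI j).
have [V [mV VU]] := geometric_cauchy_row_limit mU UU.
set G : R := n%:R * (2 * (4 * qq * E T)) in VU.
have G0 : 0 <= G by rewrite !mulr_ge0 ?expR_ge0// ltW.
have UB j := let: And5 _ h _ _ _ := UI j in h.
have VB t : t0 <= t <= T -> enorm (V t) <= (C + 1) * gT + G.
  move=> tD; apply: le_trans (enorm_le_add _ (U 0%N t)) _; apply: lerD.
    exact: le_trans (UB 0%N t tD) (CgT t tD).
  by have := VU 0%N t tD; rewrite expr0 mulr1.
have Vi : vitg t0 T V := vitg_bounded mV VB.
have Ui j : vitg t0 T (U j) := vi _ (mU j) (UB j).
have zVU j t : t0 <= t <= T -> enorm (z V t - z (U j) t) <= G * T * 2^-1 ^+ j.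
  move=> /andP[tt tT]; rewrite zB//.
  apply: (@le_trans _ _ (prim t0 (fun=> G * 2^-1 ^+ j) t)).
    apply: enorm_vprim => //; [exact: vitgS (viB _ _ Vi (Ui j))|exact: itg_cst|].
    by move=> s /andP[ts st]; apply: VU; rewrite /= in_itv/= ts (le_trans st tT).
  rewrite prim_cst// mulrAC ler_wpM2r ?half_ge0// ler_wpM2l//.
  by rewrite lerBlDr (le_trans tT)// lerDl.
pose eta t : R := eta1 t + 6 * qq * E t.
exists (z V), V, eta, ((C + 1) * gT + G).
have Ei : itg t0 T (fun t => 6 * I * (lam * E t)) by apply: itgZ; exact: itg_exp.
have eta1i : itg t0 T eta1.
  by apply: itgD; [exact: q_eta q0|apply: itgZ; exact: dei].
have etaE : eta = fun t => eta1 t + 6 * I * (lam * E t).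
  by apply/funext => t; rewrite /eta /qq; ring.
split.
- split => //.
  + by rewrite etaE; exact: itgD.
  + exact: itg_cst.
  + move=> t tD p; have /andP[tt tT] := tD; rewrite mul0r addr0.
    have zVr : enorm (z V t) <= r.
      apply: (@le_of_half _ _ _ (G * T)) => j.
      have [_ _ hM _ _] := UI j.
      apply: le_trans (enorm_le_add _ (z (U j) t)) _.
      by apply: lerD; [exact: growth_r tT (hM t tD)|exact: zVU].
    (* For fixed [t] and [p] the change of velocity, the change of position and the remaining defect
       are all of order [2^-1 ^+ j], so the limit satisfies the inclusion without defect. *)
    apply: (@le_of_half _ _ _ (G * enorm p + (qq * E t + Kr * (G * T)) * (1 + enorm p))) => j.
    have [_ _ hM hi _] := UI j.
    have := included_move r0 (inT tD) (growth_r _ t tT (hM t tD)) zVr (hi t tD).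
    move=> /(_ p); rewrite -/Kr enormB => h1.
    have h2 : dotv (V t - U j t) p <= G * 2^-1 ^+ j * enorm p.
      by apply: le_trans (dotv_le _ _) _; rewrite ler_wpM2r ?enorm_ge0// VU.
    have h3 : Kr * enorm (z V t - z (U j) t) <= Kr * (G * T * 2^-1 ^+ j).
      by rewrite ler_pM2l// zVU.
    have h4 : (qq * 2^-1 ^+ j * E t + Kr * enorm (z V t - z (U j) t)) * (1 + enorm p) <=
        (qq * 2^-1 ^+ j * E t + Kr * (G * T * 2^-1 ^+ j)) * (1 + enorm p).
      by rewrite ler_wpM2r ?addr_ge0 ?enorm_ge0// lerD2l.
    have h5 : 6 * qq * (1 - 2^-1 ^+ j) * E t <= 6 * qq * E t.
      have : 0 <= qq * 2^-1 ^+ j * E t by rewrite !mulr_ge0 ?half_ge0 ?expR_ge0// ltW.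
      by lra.
    rewrite dotvBl in h2; rewrite /eta.
    set X1 : R := (qq * 2^-1 ^+ j * E t + Kr * enorm (z V t - z (U j) t)) *
      (1 + enorm p) in h1 h4.
    move: X1 h1 h2 h4 h5 => X1.
    move: (dotv (V t) p) (dotv (U j t) p) (H t (z V t) p) (2^-1 ^+ j : R) (enorm p) (E t) (eta1 t).
    by move=> X2 X3 X4 hf N e X5; lra.
- have h1 : enorm (z V T - y0 T) <= 4 * I + 8 * I * E T.
    apply: (@le_of_half _ _ _ (G * T)) => j.
    have [_ _ _ _ hT] := UI j.
    have := enorm_trans (z (U j) T) (z V T) (y0 T).
    have := zVU j T; rewrite t0T lexx => /(_ isT).
    have : 0 <= 8 * I * E T * 2^-1 ^+ j by rewrite !mulr_ge0 ?half_ge0 ?expR_ge0// ltW.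
    by move: hT; lra.
  apply: (le_trans h1).
  have h2 := E1 T t0T.
  have h3 : I * E T <= I * expR (8 * K r * T) by rewrite ler_pM2l.
  have h4 : I * 1 <= I * E T by rewrite ler_pM2l.
  by rewrite -/I; lra.
- rewrite etaE primD// (primZ _ (itg_exp _ _ lam0)) prim_exp// -/(E T).
  rewrite /eta1 primD; [|exact: q_eta q0|by apply: itgZ; exact: dei].
  rewrite primZ; last exact: dei.
  have h1 := dI T t0T (lexx T).
  have h2 := E1 T t0T.
  have h3 : I * E T <= I * expR (8 * K r * T) by rewrite ler_pM2l.
  have h4 : I * 1 <= I * E T by rewrite ler_pM2l.
  by rewrite -/I; lra.
Qed.

End step.

End filippov.

(** * Trajectories and controls *)

Section monotone_integral.
Context d (X : measurableType d) (R : realType).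
Variable m : {measure set X -> \bar R}.
Local Open Scope ereal_scope.

(* No measurability is assumed: the integral of a nonnegative function is a
   supremum over simple functions. *)
Lemma le_integral_nonmeasurable (D : set X) (f g : X -> \bar R) :
  (forall x, D x -> f x <= g x) -> \int[m]_(x in D) f x <= \int[m]_(x in D) g x.
Proof.
move=> fg.
have fgD x : (f \_ D) x <= (g \_ D) x.
  by rewrite !patchE; case: ifPn => // /[!inE]; exact: fg.
rewrite /integral; apply: leeB; apply: ge_ereal_sup => _ [h /= hf <-];
  apply: ereal_sup_ubound; exists h => //= x; apply: le_trans (hf x) _.
- by rewrite !funeposE ge_max !le_max fgD lexx !orbT.
- by rewrite !funenegE ge_max !le_max leeN2 fgD lexx !orbT.
Qed.

End monotone_integral.

Section admissibility.
Context {R : realType} {n : nat}.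
Notation leb := (@lebesgue_measure R).
Variables (T : R) (H : R -> 'rV[R]_n -> 'rV[R]_n -> R) (C : R) (K : R -> R).
Hypothesis regH : regular_hamiltonian T H C K.
Variable mu : {measure set (Borel R n.+1) -> \bar R}.
Hypothesis smu : sphere_measure mu.
Variable g : 'rV[R]_n -> R.
Implicit Types (p q x : 'rV[R]_n) (t : R).

Lemma epiH_included t x y : epiH H t x y <-> included H t x (fpart y) (lpart y) 0.
Proof. by rewrite epiHP; split => h p; have := h p; rewrite mul0r addr0. Qed.

(** By (H4) the zero velocity with cost [- H t x 0] has a finite defect, and [convex_selection]
    turns it into an affine minorant of [H t x]. The added 1 makes the defect positive. *)
Lemma epiH_nonempty t x : 0 <= t <= T -> epiH H t x !=set0.
Proof.
move=> tT; have [C0 hC hconv _ _] := regH.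
have c0 : 0 <= C * (1 + enorm x) by rewrite mulr_ge0// addr_ge0 ?enorm_ge0.
have d0 : 0 < C * (1 + enorm x) + 1 by rewrite ltr_wpDl.
have [p|w _ hw] := @convex_selection R n (H t x) (C * (1 + enorm x))
  (- H t x 0) _ 0 (fun p q => hC t x p q tT)
  (fun p q lam => hconv t x p q lam tT) d0.
  have := hC t x p 0 tT; rewrite dotv0l subr0 ler_norml => /andP[h _].
  have := enorm_ge0 p; move: h c0.
  by move: (C * (1 + enorm x)) => c h c0 p0; nra.
exists (row_pair (0 - (2 * (C * (1 + enorm x) + 1)) *: w)
  (- H t x 0 + 3 * (C * (1 + enorm x) + 1))).
by apply/epiHP => p; rewrite fpart_row_pair lpart_row_pair; exact: hw.
Qed.

Lemma itv_endpoints_negligible (t0 : R) :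
  {ae leb, forall t, t0 <= t <= T -> t0 < t < T}.
Proof.
exists [set t0; T]; split.
- by apply: measurableU; exact: measurable_set1.
- apply: countable_lebesgue_measure0; exact: finite_set_countable.
- move=> t /= /not_implyP[/andP[h1 h2]]; rewrite !lt_neqAle h1 h2 !andbT => /negP.
  by rewrite negb_and !negbK => /orP[/eqP <-|/eqP ->]; [left|right].
Qed.

Lemma vprim_derivable (t0 : R) (v : R -> 'rV[R]_n) x0 : vitg t0 T v ->
  {ae leb, forall t, t0 < t < T -> derivable (fun s => x0 + vprim t0 v s) t 1 /\
    'D_1 (fun s => x0 + vprim t0 v s) t = v t}.
Proof.
move=> vi.
have FF : Filter (almost_everywhere leb) by exact: (ae_filter_ringOfSetsType leb).
have : {ae leb, forall t, forall i : 'I_n, t0 < t < T ->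
    derivable (prim t0 (fun s => v s 0 i)) t 1 /\
    'D_1 (prim t0 (fun s => v s 0 i)) t = v t 0 i}.
  apply: (@filter_forall _ 'I_n (fun i t => t0 < t < T ->
    derivable (prim t0 (fun s => v s 0 i)) t 1 /\
    'D_1 (prim t0 (fun s => v s 0 i)) t = v t 0 i) _ FF) => i.
  exact: prim_derivable (vi i).
apply: filterS => t h tD.
have cE i : (fun s => (x0 + vprim t0 v s) 0 i) = cst (x0 0 i) + prim t0 (fun s => v s 0 i).
  by apply/funext => s; rewrite !mxE.
have d : derivable (fun s => x0 + vprim t0 v s) t 1.
  apply/derivable_mxP => a i; rewrite (ord1 a) cE.
  by apply: derivableD; [exact: derivable_cst|exact: (h i tD).1].
split => //; rewrite derive_mx//; apply/rowP => i; rewrite mxE cE deriveD//.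
- by rewrite derive_cst add0r (h i tD).2.
- exact: (h i tD).1.
Qed.

Lemma lipschitz_abs_cont (t0 B : R) (y : R -> 'rV[R]_n) :
  (forall a b, t0 <= a -> a <= b -> b <= T -> enorm (y b - y a) <= B * (b - a)) ->
  abs_cont_on t0 T y.
Proof.
move=> yL e e0; have B0 : 0 < `|B| + 1 by rewrite ltr_wpDl.
exists (e / (`|B| + 1)); first exact: divr_gt0.
move=> k u v h1 h2; rewrite ltr_pdivlMr// mulrC => h3; apply: le_lt_trans h3.
rewrite mulr_sumr; apply: ler_sum => i _; have [a1 [a2 a3]] := h1 i (ltn_ord i).
apply: le_trans (yL _ _ a1 a2 a3) _; rewrite ler_wpM2r ?subr_ge0//.
by have := ler_norm B; lra.
Qed.

Lemma value_le_qtraj (t0 : R) x0 y v eta B : 0 <= t0 -> t0 <= T ->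
  qtraj T H t0 x0 y v eta (fun=> 0) B ->
  (value (steiner_f mu H) (steiner_l mu H) g T t0 x0 <=
    (g (y T) + prim t0 eta T)%:E)%E.
Proof.
move=> t00 t0T q.
(* The curve [y] is prescribed on [[t0, T]] only, so its formula serves as the state. The control is
   the velocity-cost pair itself, which the Steiner map fixes. *)
pose z t := x0 + vprim t0 v t; pose a t := row_pair (v t) (eta t).
have zE t : t0 <= t <= T -> z t = y t by move=> tD; rewrite (q_curve q).
have aE t : t0 <= t <= T -> steiner_fl mu H t (z t) (a t) = a t.
  move=> tD; apply: steiner_fl_id => //; apply/epiH_included.
  by rewrite fpart_row_pair lpart_row_pair zE//; exact: (q_incl q tD).
have vi : vitg t0 T v := vitg_bounded (q_meas q) (q_bound q).
apply: ereal_inf_lbound; exists (z, a) => /=.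
  split.
  - apply: (@lipschitz_abs_cont _ B).
    exact: curve_lipschitz (q_meas q) (q_bound q) (fun t _ => erefl).
  - move=> i; suff : itg t0 T (fun t => a t 0 i) by [].
    have -> : (fun t => a t 0 i) = (fun t => if insub (i : nat) is Some j then v t 0 j else eta t).
      by apply/funext => t; rewrite /a /row_pair mxE.
    by case: insubP => [j _ _|_]; [exact: vi|exact: q_eta q].
  - have FF : Filter (almost_everywhere leb) by exact: (ae_filter_ringOfSetsType leb).
    have := vprim_derivable x0 vi; have := itv_endpoints_negligible t0.
    apply: filterS2 => t h1 h2; rewrite in_itv/= => tD.
    have [d1 d2] := h2 (h1 tD); split => //.
    by rewrite d2 /steiner_f aE// fpart_row_pair.
  - by rewrite /z vprim_start addr0.
rewrite /cost zE ?t0T ?lexx// EFinD; congr (_ + _)%E.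
rewrite /prim /Rintegral fineK; last by have := integrable_fin_num _ (q_eta q); apply.
apply: eq_integral => t; rewrite inE/= in_itv/= => tD.
by rewrite /steiner_l aE// lpart_row_pair.
Qed.

(** Let [s0] be the supremum of [1 + |y|] divided by the weight of rate [2 * (C + 1)]. Integration
    with this weight gives [s0 <= 1 + |x0| + s0 / 2], hence the factor 2. *)
Lemma gronwall (t0 : R) x0 (y v : R -> 'rV[R]_n) (B : R) :
  measurable_row `[t0, T] v ->
  (forall t, t0 <= t <= T -> enorm (v t) <= B) ->
  (forall t, t0 <= t <= T -> y t = x0 + vprim t0 v t) ->
  (forall t, t0 <= t <= T -> enorm (v t) <= C * (1 + enorm (y t))) ->
  forall t, t0 <= t <= T ->
    1 + enorm (y t) <= 2 * (1 + enorm x0) * expR (2 * (C + 1) * (t - t0)).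
Proof.
move=> mv vB yE vy t tD; have [C0 _ _ _ _] := regH.
have vi : vitg t0 T v := vitg_bounded mv vB.
pose E s : R := expR (2 * (C + 1) * (s - t0)).
have E0 s : 0 < E s by exact: expR_gt0.
have l0 : 0 < 2 * (C + 1) by rewrite mulr_gt0// ltr_wpDl.
have E1 s : t0 <= s -> 1 <= E s.
  by move=> ts; rewrite -[leLHS]expR0 ler_expR mulr_ge0 ?subr_ge0// ltW.
pose S := [set (1 + enorm (y s)) / E s | s in `[t0, T]].
have t0T : t0 <= T by case/andP: tD => h1 h2; exact: le_trans h2.
have yb s : t0 <= s <= T -> 1 + enorm (y s) <= 1 + enorm x0 + B * (T - t0).
  move=> sD; have /andP[ts sT] := sD; rewrite (yE s sD) -addrA lerD2l.
  apply: le_trans (enormD _ _) _; rewrite lerD2l.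
  have := vprim_lipschitz mv vB (lexx t0) ts sT; rewrite vprim_start subr0 => h.
  apply: (le_trans h); rewrite ler_wpM2l ?lerB//.
  by apply: le_trans (enorm_ge0 (v s)) (vB s sD).
have hS : has_sup S.
  split; first by exists ((1 + enorm (y t)) / E t), t; rewrite //= in_itv.
  exists (1 + enorm x0 + B * (T - t0)) => x [s /=]; rewrite in_itv/= => sD <-.
  have /andP[ts _] := sD.
  rewrite ler_pdivrMr//; apply: le_trans (yb s sD) _.
  by rewrite ler_peMr ?E1//; apply: le_trans (yb s sD); rewrite addr_ge0 ?enorm_ge0.
set s0 : R := sup S.
have Sle s : t0 <= s <= T -> 1 + enorm (y s) <= s0 * E s.
  move=> sD; rewrite -ler_pdivrMr//; apply: sup_upper_bound => //.
  by exists s; rewrite //= in_itv.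
have s00 : 0 <= s0.
  have := Sle t tD; rewrite -(pmulr_lge0 _ (E0 t)); apply: le_trans.
  by rewrite addr_ge0 ?enorm_ge0.
have h1 s : t0 <= s <= T -> 1 + enorm (y s) <= 1 + enorm x0 + s0 / 2 * (E s - 1).
  move=> sD; have /andP[ts sT] := sD; rewrite (yE s sD) -addrA lerD2l.
  apply: le_trans (enormD _ _) _; rewrite lerD2l.
  apply: (vprim_exp_le l0 _ ts sT vi); first by rewrite divr_ge0.
  move=> r rD; apply: le_trans (vy r rD) _.
  apply: (@le_trans _ _ ((C + 1) * (s0 * E r))).
    apply: ler_pM => //; first by rewrite addr_ge0 ?enorm_ge0.
      by rewrite lerDl.
    exact: Sle.
  by rewrite le_eqVlt; apply/orP; left; apply/eqP; rewrite -/(E r); field.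
have s0le : s0 <= 1 + enorm x0 + s0 / 2.
  apply: ge_sup; first by case: hS.
  move=> x [s /=]; rewrite in_itv/= => sD <-; rewrite ler_pdivrMr//.
  apply: le_trans (h1 s sD) _.
  have /andP[ts _] := sD; have := E1 s ts; have := enorm_ge0 x0.
  have : 0 <= (1 + enorm x0) * (E s - 1).
    by rewrite mulr_ge0 ?subr_ge0 ?E1// addr_ge0 ?enorm_ge0.
  by move: s00; lra.
apply: le_trans (Sle t tD) _; rewrite ler_wpM2r ?(ltW (E0 t))//.
by move: s0le; lra.
Qed.

End admissibility.

Lemma measurable_fun_patch_off (R : realType) (D N : set R) (f : R -> R) (c : R) :
  measurable D -> measurable N -> measurable_fun (D `\` N) f ->
  measurable_fun D (fun t => if t \in N then c else f t).
Proof.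
move=> mD mN mf.
rewrite -(setUIDK D N); apply/measurable_funU => //.
- exact: measurableI.
- exact: measurableD.
split.
  apply: (eq_measurable_fun (cst c)) => // t; rewrite inE => -[_ Nt].
  by rewrite mem_set.
apply: (eq_measurable_fun f) => // t; rewrite inE => -[_ Nt].
by rewrite memNset.
Qed.

Lemma uniform_within_continuous (R : realType) (f : R -> R) (a b : R) :
  (forall e : R, 0 < e -> exists2 d : R, 0 < d &
    forall s t, a <= s <= b -> a <= t <= b -> `|s - t| < d -> `|f s - f t| <= e) ->
  {within `[a, b], continuous f}.
Proof.
move=> h; apply/subspace_continuousP => t tD; apply/cvgrPdist_le => e e0.
have [d d0 hd] := h e e0.
apply/nbhs_ballP; exists d => //= s st sD.
by move: tD sD; rewrite /= !in_itv/= => tD sD; exact: hd.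
Qed.

(** * Absolutely continuous curves and their derivatives *)

Section absolutely_continuous_curves.
Context {R : realType} {n : nat}.
Variables (t0 T : R) (x : R -> 'rV[R]_n).
Hypotheses (t0T : t0 <= T) (ac : abs_cont_on t0 T x).

Lemma abs_cont_modulus (e : R) : 0 < e -> exists2 d : R, 0 < d &
  forall s t, t0 <= s <= T -> t0 <= t <= T -> `|s - t| < d -> enorm (x s - x t) <= e.
Proof.
move=> e0; have [d d0 hd] := ac e0; exists d => //.
have h s t : t0 <= s -> s <= t -> t <= T -> `|s - t| < d -> enorm (x t - x s) <= e.
  move=> h1 h2 h3 h4.
  have c1 (i : nat) : (i < 1)%N -> t0 <= s /\ s <= t /\ t <= T by [].
  have c2 (i j : nat) : (i < j < 1)%N -> t <= s.
    by move=> /andP[ij]; rewrite ltnS leqn0 => /eqP j0; rewrite j0 in ij.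
  have := hd 1%N (fun=> s) (fun=> t) c1 c2; rewrite !big_ord1.
  move=> hst; apply/ltW/hst.
  by move: h4; rewrite distrC ger0_norm ?subr_ge0.
move=> s t /andP[h1 h2] /andP[h3 h4] st; have [st'|ts'] := leP s t.
  by rewrite enormB h.
by apply: h => //; [exact: ltW|rewrite distrC].
Qed.

Lemma abs_cont_bounded : exists X : R, forall t, t0 <= t <= T -> enorm (x t) <= X.
Proof.
have [c _ hc] : exists2 c, c \in `[t0, T] & forall t, t \in `[t0, T] ->
    enorm (x t) <= enorm (x c).
  apply: (@EVT_max _ (fun t => enorm (x t))) => //; apply: uniform_within_continuous => e e0.
  have [d d0 hd] := abs_cont_modulus e0; exists d => // s t sD tD st.
  by apply: le_trans (norm_dist_enorm _ _) _; exact: hd.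
by exists (enorm (x c)) => t tD; apply: hc; rewrite in_itv.
Qed.

Let clamp (t : R) := Num.max t0 (Num.min t T).

Let clampD t : t0 <= clamp t <= T.
Proof. by rewrite /clamp le_max lexx/= ge_max t0T ge_min lexx orbT. Qed.

Let clamp_id t : t0 <= t <= T -> clamp t = t.
Proof. by move=> /andP[h1 h2]; rewrite /clamp (min_idPl h2) (max_idPr h1). Qed.

Let clamp_lip s t : `|clamp s - clamp t| <= `|s - t|.
Proof.
have h a b : a <= b -> `|clamp a - clamp b| <= `|a - b|.
  move=> ab; rewrite distrC [leRHS]distrC [leRHS]ger0_norm ?subr_ge0// /clamp.
  move: t0T; rewrite !minEle !maxEle => tT.
  by case: (leP a T) => h1; case: (leP b T) => h2; case: (leP t0 a) => h3;
    case: (leP t0 b) => h4; case: (leP t0 T) => h5;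
    rewrite ler_norml; apply/andP; split; lra.
by have [st|ts] := leP s t; [exact: h|rewrite distrC [leRHS]distrC; exact/h/ltW].
Qed.

(* The derivative is a limit of difference quotients, extended beyond the
   endpoints by clamping so that they are continuous. *)
Lemma measurable_derivative (D : set R) (f : R -> 'rV[R]_n) :
  measurable D -> (forall t, D t -> [/\ t0 < t, t < T, derivable x t 1 & 'D_1 x t = f t]) ->
  measurable_row D f.
Proof.
move=> mD hD i.
pose xe t : R := x (clamp t) 0 i.
have cxe : continuous xe.
  move=> t; apply/cvgrPdist_le => e e0.
  have [d d0 hd] := abs_cont_modulus e0.
  apply/nbhs_ballP; exists d => //= s st.
  have h := hd _ _ (clampD t) (clampD s) (le_lt_trans (clamp_lip t s) st).
  by apply: le_trans h; apply: le_trans (coord_le_enorm _ i); rewrite !mxE.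
pose q (j : nat) t := j.+1%:R * (xe (t + j.+1%:R^-1) - xe t).
apply: (@measurable_fun_cvg _ _ R D q).
  move=> j; apply: measurable_funTS; apply: continuous_measurable_fun => t.
  have h1 : xe (s + j.+1%:R^-1) @[s --> t] --> xe (t + j.+1%:R^-1).
    have c0 : s + j.+1%:R^-1 @[s --> t] --> t + j.+1%:R^-1.
      exact: (cvgD (@cvg_id _ (nbhs t)) (cvg_cst _)).
    exact: (@cvg_comp _ _ _ (fun s => s + j.+1%:R^-1) xe _ _ _ c0 (cxe _)).
  exact: (cvgM (cvg_cst _) (cvgB h1 (cxe t))).
move=> t Dt; have [tt tT dx Dx] := hD t Dt.
have dxi := (derivable_mxP x t 1).1 dx 0 i.
have Dxi : 'D_1 (fun s => x s 0 i) t = f t 0 i by rewrite -Dx derive_mx// mxE.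
apply/cvgrPdist_le => e e0.
have : h^-1 *: (x (h *: 1 + t) 0 i - x t 0 i) @[h --> 0^'] --> f t 0 i.
  by move: dxi; rewrite -Dxi; exact.
move=> /cvgrPdist_le /(_ e e0) [r /= r0 hr].
(* A step below [T - t] stays in the interval, where [clamp] is the identity and [q j t] is a
   genuine difference quotient of [x]. *)
have rT : 0 < Num.min r (T - t) by rewrite lt_min r0 subr_gt0.
have := near_infty_natSinv_lt (PosNum rT).
apply: filterS => j /=; rewrite lt_min => /andP[jr jT].
have j0 : 0 < j.+1%:R^-1 :> R by rewrite invr_gt0.
have := hr j.+1%:R^-1; rewrite /= sub0r normrN gtr0_norm// => /(_ jr (lt0r_neq0 j0)).
rewrite invrK [_ *: 1]mulr1 /q /xe !clamp_id ?(ltW tt) ?(ltW tT)//.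
  by rewrite [t + _]addrC.
by rewrite (le_trans (ltW tt)) ?lerDl ?(ltW j0)//= -lerBrDl ltW.
Qed.

End absolutely_continuous_curves.

Lemma scalar_abs_contB (R : realType) (a b : R) (f g : R -> R) :
  scalar_abs_cont a b f -> scalar_abs_cont a b g ->
  scalar_abs_cont a b (fun t => f t - g t).
Proof.
move=> fa ga e e0; have e2 : 0 < e / 2 by rewrite divr_gt0.
have [d1 d10 h1] := fa _ e2; have [d2 d20 h2] := ga _ e2.
exists (Num.min d1 d2); first by rewrite lt_min d10.
move=> k u v uv1 uv2; rewrite lt_min => /andP[l1 l2].
have := h1 k u v uv1 uv2 l1; have := h2 k u v uv1 uv2 l2.
have : \sum_(i < k) `|f (v i) - g (v i) - (f (u i) - g (u i))| <=
   \sum_(i < k) `|f (v i) - f (u i)| + \sum_(i < k) `|g (v i) - g (u i)|.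
  rewrite -big_split/=; apply: ler_sum => i _.
  have -> : f (v i) - g (v i) - (f (u i) - g (u i)) =
    (f (v i) - f (u i)) - (g (v i) - g (u i)) by ring.
  exact: ler_normB.
by lra.
Qed.

Lemma abs_cont_coord (R : realType) n (a b T : R) (x : R -> 'rV[R]_n) i : b <= T ->
  abs_cont_on a T x -> scalar_abs_cont a b (fun t => x t 0 i).
Proof.
move=> bT ac e e0; have [d d0 hd] := ac e e0; exists d => // k u v h1 h2 h3.
apply: le_lt_trans (hd k u v _ h2 h3).
  by apply: ler_sum => j _; apply: le_trans (coord_le_enorm _ i); rewrite !mxE.
by move=> j /h1[? [? ?]]; split => //; split => //; apply: le_trans bT.
Qed.

Section admissible_trajectories.
Context {R : realType} {n : nat}.
Notation leb := (@lebesgue_measure R).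
Variables (T : R) (H : R -> 'rV[R]_n -> 'rV[R]_n -> R) (C : R) (K : R -> R) (C0 : R).
Hypothesis regH : regular_hamiltonian T H C K.
Hypothesis H00 : forall t, 0 <= t <= T -> `|H t 0 0| <= C0.
Variable mu : {measure set (Borel R n.+1) -> \bar R}.
Hypothesis smu : sphere_measure mu.
Implicit Types (p q x : 'rV[R]_n) (t : R).

(** The value at [p = 0] matters because the exact inclusion tested there reads [eta >= - H t x 0]:
    this is the lower bound for running costs. *)
Lemma hamiltonian0_le r t x : 0 < r -> 0 <= K r -> 0 <= t <= T -> enorm x <= r ->
  `|H t x 0| <= C0 + K r * r.
Proof.
move=> r0 K0 tT xr; have [_ _ _ hK _] := regH.
have z0 : enorm (0 : 'rV[R]_n) <= r by rewrite enorm0 ltW.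
have := hK r t x 0 0 r0 tT xr z0; rewrite enorm0 addr0 mulr1 subr0 => h1.
rewrite -(subrK (H t 0 0) (H t x 0)) addrC; apply: le_trans (ler_normD _ _) _.
apply: lerD; first exact: H00.
by apply: le_trans h1 _; rewrite ler_wpM2l.
Qed.

(** Each coordinate differs from the primitive by an absolutely continuous function whose derivative
    vanishes almost everywhere. *)
Lemma admissible_curve (t0 : R) x0 (x v : R -> 'rV[R]_n) (B : R) :
  t0 <= T -> abs_cont_on t0 T x -> x t0 = x0 ->
  measurable_row `[t0, T] v -> (forall t, t0 <= t <= T -> enorm (v t) <= B) ->
  {ae leb, forall t, t0 <= t <= T -> derivable x t 1 /\ 'D_1 x t = v t} ->
  forall t, t0 <= t <= T -> x t = x0 + vprim t0 v t.
Proof.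
move=> t0T ac xt0 mv vB dx t /andP[tt tT].
have vi : vitg t0 T v := vitg_bounded mv vB.
apply/rowP => i; rewrite !mxE.
pose z s := x s 0 i - prim t0 (fun s => v s 0 i) s.
suff : z t = z t0 by rewrite /z prim_start xt0 subr0 => <-; rewrite subrK.
apply: (abs_cont_zero_derivative tt).
  apply: scalar_abs_contB; first exact: abs_cont_coord ac.
  have pL : forall a b, t0 <= a -> a <= b -> b <= T ->
     enorm (vprim t0 v b - vprim t0 v a) <= B * (b - a) by exact: vprim_lipschitz.
  have := abs_cont_coord i tT (lipschitz_abs_cont pL).
  by congr scalar_abs_cont; apply/funext => s; rewrite mxE.
have FF : Filter (almost_everywhere leb) by exact: (ae_filter_ringOfSetsType leb).
have h1 := prim_derivable (vi i); have h2 := itv_endpoints_negligible T t0.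
have h12 := @filterI _ _ FF _ _ h1 h2.
apply: (@filterS2 _ _ FF _ _ _ _ dx h12) => s h3 [h1s h2s]; rewrite in_itv/= => /andP[ts st].
have sD : t0 <= s <= T by rewrite ts (le_trans st tT).
have [d1 d2] := h3 sD; have [d3 d4] := h1s (h2s sD).
have dxi := (derivable_mxP x s 1).1 d1 0 i.
split; first exact: derivableB.
have -> : z = (fun s => x s 0 i) - prim t0 (fun s => v s 0 i) by [].
by rewrite deriveB// d4 -d2 derive_mx// mxE subrr.
Qed.

(** The cost [l] is replaced by the measurable minorant [S], the value of [Hstar] at the velocity.
    It is integrable because it lies between [- LB] and [l], whose positive part has a finite
    integral. On the null set [N] the data are redefined, and a defect of zero integral keeps the
    inclusion valid there. *)
Lemma admissible_qtraj (t0 : R) x0 (x : R -> 'rV[R]_n) (a : R -> 'rV[R]_n.+1) :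
  (forall r, 0 < r -> 0 < K r) -> 0 <= t0 -> t0 <= T ->
  admissible (steiner_f mu H) T t0 x0 x a ->
  (\int[leb]_(t in `[t0, T]) (steiner_l mu H t (x t) (a t))%:E < +oo)%E ->
  exists v eta d B, [/\ qtraj T H t0 x0 x v eta d B,
    prim t0 d T = 0,
    forall t, t0 <= t <= T -> enorm (v t) <= C * (1 + enorm (x t)) &
    ((prim t0 eta T)%:E <=
      \int[leb]_(t in `[t0, T]) (steiner_l mu H t (x t) (a t))%:E)%E].
Proof.
move=> K0 t00 t0T [ac _ dx xt0] lfin.
have [Cge0 hC _ _ hm] := regH.
pose f t := steiner_f mu H t (x t) (a t).
pose l t := steiner_l mu H t (x t) (a t).
have inT t : t0 <= t <= T -> 0 <= t <= T.
  by move=> /andP[h ->]; rewrite (le_trans t00 h).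
have flE t : t0 <= t <= T -> included H t (x t) (f t) (l t) 0.
  move=> tD; apply/epiH_included/steiner_fl_mem => //.
  exact: epiH_nonempty regH t (x t) (inT t tD).
have fB t : t0 <= t <= T -> enorm (f t) <= C * (1 + enorm (x t)).
  move=> tD; have := included_velocity regH (inT t tD) (lexx 0) (flE t tD).
  by rewrite addr0.
have [X hX] := abs_cont_bounded t0T ac.
have X0 : 0 <= X by apply: le_trans (hX t0 _); rewrite ?enorm_ge0// lexx.
pose B := C * (1 + X).
have B0 : 0 <= B by rewrite mulr_ge0// addr_ge0.
have CXB t : t0 <= t <= T -> C * (1 + enorm (x t)) <= B.
  by move=> tD; rewrite ler_wpM2l// lerD2l hX.
have X1 : 0 < X + 1 by rewrite ltr_wpDl.
pose LB := C0 + K (X + 1) * (X + 1).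
have HLB t : t0 <= t <= T -> `|H t (x t) 0| <= LB.
  move=> tD; apply: (hamiltonian0_le X1 (ltW (K0 _ X1)) (inT t tD)).
  by rewrite (le_trans (hX t tD))// lerDl.
have LB0 : 0 <= LB.
  by apply: le_trans (HLB t0 _) => //; rewrite lexx.
have lLB t : t0 <= t <= T -> - LB <= l t.
  move=> tD; have := flE t tD 0; rewrite dotv0r mul0r addr0.
  by have := HLB t tD; rewrite ler_norml => /andP[_]; lra.
have FF : Filter (almost_everywhere leb) by exact: (ae_filter_ringOfSetsType leb).
have [N [mN N0 hN]] : {ae leb, forall t, t0 <= t <= T ->
    [/\ t0 < t, t < T, derivable x t 1 & 'D_1 x t = f t]}.
  apply: (@filterS2 _ _ FF _ _ _ _ dx (itv_endpoints_negligible T t0)) => t h1 h2 tD.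
  have [d1 d2] := h1 tD; have /andP[] := h2 tD; by split.
have mD : measurable (`[t0, T]%classic : set (measurableTypeR R)) by [].
have mDN : measurable (`[t0, T] `\` N) by exact: measurableD.
have good t : (`[t0, T] `\` N) t -> t0 <= t <= T /\
    [/\ t0 < t, t < T, derivable x t 1 & 'D_1 x t = f t].
  move=> [/=]; rewrite in_itv/= => tD tN; split => //.
  by apply: contrapT => h; apply: tN; apply: hN => /= /(_ tD).
have mf : measurable_row (`[t0, T] `\` N) f.
  by apply: (measurable_derivative t0T ac mDN) => t /good[].
pose v t : 'rV[R]_n := if t \in N then 0 else f t.
have vN t : t \in N -> v t = 0 by rewrite /v => ->.
have vnN t : t \notin N -> v t = f t by rewrite /v => /negPf ->.
have mv : measurable_row `[t0, T] v.
  move=> i; have := measurable_fun_patch_off 0 mD mN (mf i).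
  congr measurable_fun; apply/funext => t; rewrite /v.
  by case: ifP => //; rewrite mxE.
have vC t : t0 <= t <= T -> enorm (v t) <= C * (1 + enorm (x t)).
  move=> tD; rewrite /v; case: ifP => _; last exact: fB.
  by rewrite enorm0 mulr_ge0// addr_ge0 ?enorm_ge0.
have vB t : t0 <= t <= T -> enorm (v t) <= B.
  by move=> tD; exact: le_trans (vC t tD) (CXB t tD).
have dxv : {ae leb, forall t, t0 <= t <= T -> derivable x t 1 /\ 'D_1 x t = v t}.
  exists N; split => // t /= h; apply: contrapT => tN; apply: h => tD.
  have [|_ [_ _ d1 d2]] := @good t; first by split => //=; rewrite in_itv.
  by rewrite vnN// notin_setE.
have xE := admissible_curve t0T ac xt0 mv vB dxv.
have xL := curve_lipschitz mv vB xE.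
have mH p : measurable_fun `[t0, T] (fun t => H t (x t) p).
  exact: (hm t0 T x B t00 (lexx T) xL).
pose h (j : nat) t : R := dotv (f t) (rat_rows j) - H t (x t) (rat_rows j).
have mh j : measurable_fun (`[t0, T] `\` N) (h j).
  apply: measurable_funB; first exact: measurable_dotv.
  by apply: measurable_funS (mH _) => // t [].
have hl j t : t0 <= t <= T -> h j t <= l t.
  by move=> tD; have := flE t tD (rat_rows j); rewrite mul0r addr0 /h; lra.
(* A supremum over rational [p] is measurable off [N], and by density it still dominates every
   [p]. *)
pose S t : R := sup (range (h ^~ t)).
have Sl t : t0 <= t <= T -> S t <= l t.
  move=> tD; apply: ge_sup; first by exists (h 0%N t), 0%N.
  by move=> _ [j _ <-]; exact: hl.
have hS j t : t0 <= t <= T -> h j t <= S t.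
  move=> tD; apply: sup_upper_bound; last by exists j.
  by split; [exists (h 0%N t), 0%N|exists (l t) => _ [i _ <-]; exact: hl].
have mS : measurable_fun (`[t0, T] `\` N) S.
  have := @measurable_fun_sups _ _ R (`[t0, T] `\` N) h 0%N.
  have -> : (fun t => sups (h ^~ t) 0%N) = S.
    by apply/funext => t; rewrite /sups /S; congr sup; apply/seteqP; split => _ [j _ <-]; exists j.
  apply => // t /good[tD _]; exists (l t) => _ [j _ <-]; exact: hl.
have Sincl t : t0 <= t <= T -> included H t (x t) (f t) (S t) 0.
  move=> tD p; rewrite mul0r addr0 lerBlDr -lerBlDl.
  apply: (@le_of_dense _ _ (fun p => dotv (f t) p - H t (x t) p)
    (enorm (f t) + C * (1 + enorm (x t)))); last by move=> j; exact: hS.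
  move=> q r; have -> : dotv (f t) q - H t (x t) q - (dotv (f t) r - H t (x t) r) =
     dotv (f t) (q - r) - (H t (x t) q - H t (x t) r) by rewrite dotvBr; ring.
  apply: le_trans (ler_normB _ _) _; rewrite mulrDl lerD ?cauchy_schwarz//.
  exact: hC (inT t tD).
have SLB t : t0 <= t <= T -> - LB <= S t.
  move=> tD; have := Sincl t tD 0; rewrite dotv0r mul0r addr0.
  by have := HLB t tD; rewrite ler_norml => /andP[_]; lra.
pose eta t : R := if t \in N then - LB else S t.
(* On [N] the pair is [(0, - LB)]. Since [H t (x t) p] is at least [- LB - B * enorm p], this
   constant is a sufficient defect. *)
pose d t : R := if t \in N then 2 * LB + B else 0.
have meta : measurable_fun `[t0, T] eta by exact: measurable_fun_patch_off.
have etal t : t0 <= t <= T -> eta t <= l t.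
  by move=> tD; rewrite /eta; case: ifP => _; [exact: lLB|exact: Sl].
have etaLB t : t0 <= t <= T -> - LB <= eta t.
  by move=> tD; rewrite /eta; case: ifP => // _; exact: SLB.
have dD0 : 0 <= 2 * LB + B by rewrite addr_ge0// mulr_ge0.
have md : measurable_fun `[t0, T] d.
  by apply: (@measurable_fun_patch_off _ `[t0, T] N (cst 0) (2 * LB + B)).
have di : itg t0 T d.
  apply: (itg_bounded (B := 2 * LB + B)) => // t _; rewrite /d.
  by case: ifP => _; rewrite ?normr0// ger0_norm.
have etai : itg t0 T eta.
  apply/integrableP; split; first exact/measurable_EFinP.
  (* The integral of [l] is the difference of those of its positive and negative parts; the latter
     is finite as [l >= - LB], so a difference below [+oo] forces the former to be finite. *)
  have l_pos : (\int[leb]_(t in `[t0, T]) ((fun t => (l t)%:E)^\+ t) < +oo)%E.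
    move: lfin; rewrite integralE -/l => lfin.
    have neg_fin : (\int[leb]_(t in `[t0, T]) ((fun t => (l t)%:E)^\- t) < +oo)%E.
      apply: (@le_lt_trans _ _ (\int[leb]_(t in `[t0, T]) (cst LB%:E t))%E).
        apply: le_integral_nonmeasurable => t /=; rewrite in_itv/= => tD.
        rewrite funenegE ge_max !lee_fin LB0 andbT.
        by have := lLB t tD; lra.
      rewrite integral_cst// lte_mul_pinfty ?lee_fin//; exact: itv_finite.
    have neg_ge0 : (0 <= \int[leb]_(t in `[t0, T]) ((fun t => (l t)%:E)^\- t))%E.
      by apply: integral_ge0 => t _.
    move: lfin neg_fin neg_ge0; case: (\int[leb]_(t in _) (_^\+ _))%E => // [r _ _ _|].
      exact: ltry.
    by case: (\int[leb]_(t in _) (_^\- _))%E.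
  apply: (@le_lt_trans _ _ (\int[leb]_(t in `[t0, T])
      (((fun t => (eta t)%:E)^\+ t) + LB%:E))%E).
    apply: le_integral_nonmeasurable => t /=; rewrite in_itv/= => tD.
    rewrite funeposE; have [e0|e0] := leP 0 (eta t).
      by rewrite (max_idPl _) ?lee_fin// ger0_norm// lerDl.
    rewrite (max_idPr _) ?lee_fin ?(ltW e0)// ltr0_norm// add0r.
    by have := etaLB t tD; lra.
  rewrite ge0_integralD//; last first.
    by apply: measurable_funepos; exact/measurable_EFinP.
  apply: lte_add_pinfty.
    apply: le_lt_trans l_pos; apply: le_integral_nonmeasurable => t /=.
    rewrite in_itv/= => tD; rewrite !funeposE ge_max !le_max lexx !orbT andbT.
    by rewrite lee_fin etal.
  rewrite integral_cst// lte_mul_pinfty ?lee_fin//; exact: itv_finite.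
exists v, eta, d, B; split => //.
- split => //.
  + by move=> t _; rewrite /d; case: ifP.
  + move=> t tD; rewrite /v /eta /d; case: ifP => _; last exact: Sincl.
    move=> p; rewrite dotv0l.
    have := HLB t tD; have := hC t (x t) p 0 (inT t tD).
    have := CXB t tD; have := enorm_ge0 p.
    rewrite subr0 !ler_norml; move: (C * _) (H t (x t) p) (H t (x t) 0) (enorm p) LB0 B0.
    move=> c h1 h2 N1 l0 b0 n0 cb /andP[k1 k2] /andP[k3 k4].
    have : c * N1 <= B * N1 by rewrite ler_wpM2r.
    have : 0 <= LB * N1 by rewrite mulr_ge0.
    by move: k1 k3 b0 l0; lra.
- rewrite /prim /Rintegral (@ae_eq_integral _ _ _ leb `[t0, T] (cst 0%E)) ?integral0//.
    exact/measurable_EFinP.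
  exists N; split => // t /= /not_implyP[_ ht]; apply: contrapT => tN; apply: ht.
  by rewrite /d memNset.
- rewrite /prim /Rintegral fineK; last by have := integrable_fin_num _ etai; apply.
  apply: le_integral_nonmeasurable => t /=; rewrite in_itv/= => tD.
  by rewrite lee_fin etal.
Qed.

End admissible_trajectories.

(** * Auxiliary estimates *)

Section piecewise.
Context {R : realType}.
Notation leb := (@lebesgue_measure R).
Implicit Types (a b s t : R) (f g : R -> R).

(** The left endpoint is negligible. This matters for [glue], which still takes the constant value
    at the junction. *)
Lemma eq_prim_oc a t f g : a <= t -> itg a t f -> itg a t g ->
  (forall s, a < s <= t -> f s = g s) -> prim a f t = prim a g t.
Proof.
move=> at0 fi gi h.
have sub (k : R -> R) : itg a t k -> leb.-integrable `]a, t] (EFin \o k).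
  by apply: integrableS => //; apply: subset_itv; rewrite bnd_simp.
rewrite /prim -(Rintegral_itv_obnd_cbnd (sub _ fi)) -(Rintegral_itv_obnd_cbnd (sub _ gi)).
by apply: eq_Rintegral => s; rewrite inE/= in_itv/=; exact: h.
Qed.

Definition glue s (c : R) f t : R := if t <= s then c else f t.

Lemma measurable_glue a b s c f : a <= s -> s <= b -> measurable_fun `[s, b] f ->
  measurable_fun `[a, b] (glue s c f).
Proof.
move=> as0 sb mf.
have -> : `[a, b]%classic = `[a, s] `|` `]s, b] :> set R.
  by rewrite -itv_bndbnd_setU// bnd_simp.
apply/measurable_funU => //; split.
  apply: (eq_measurable_fun (cst c)) => // t.
  by rewrite inE/= in_itv/= /glue => /andP[_ ->].
apply: (eq_measurable_fun f).
  by move=> t; rewrite inE/= in_itv/= /glue => /andP[st _]; rewrite leNgt st.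
by apply: measurable_funS mf => //; apply: subset_itv; rewrite bnd_simp.
Qed.

Lemma itg_glue a b s c f : a <= s -> s <= b -> itg s b f -> itg a b (glue s c f).
Proof.
move=> as0 sb fi; apply/integrableP; split.
  by apply/measurable_EFinP; apply: measurable_glue => //; exact: itg_measurable.
have -> : `[a, b]%classic = `[a, s] `|` `]s, b] :> set R.
  by rewrite -itv_bndbnd_setU// bnd_simp.
have mab : measurable_fun (`[a, s] `|` `]s, b]) (fun t => `|(glue s c f t)%:E|%E).
  apply: measurableT_comp => //; apply/measurable_EFinP.
  by rewrite -itv_bndbnd_setU ?bnd_simp//; apply: measurable_glue => //; exact: itg_measurable.
rewrite ge0_integral_setU//=; last first.
  by apply/disj_setPS => t [/=]; rewrite 2!in_itv/= => /andP[_ ts] /andP[]; rewrite ltNge ts.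
apply: lte_add_pinfty.
  rewrite (eq_integral (cst (`|c|%:E))); last first.
    by move=> t; rewrite inE/= in_itv/= /glue => /andP[_ ->].
  by rewrite integral_cst// lte_mul_pinfty ?lee_fin//; exact: itv_finite.
rewrite (eq_integral (fun t : measurableTypeR R => `|(f t)%:E|%E)); last first.
  by move=> t; rewrite inE/= in_itv/= /glue => /andP[st _]; rewrite leNgt st.
have : leb.-integrable `]s, b] (EFin \o f).
  by apply: integrableS fi => //; apply: subset_itv; rewrite bnd_simp.
by move=> /integrableP[].
Qed.

Lemma prim_glue_before a s t c f : a <= t -> t <= s -> prim a (glue s c f) t = c * (t - a).
Proof.
move=> at0 ts; rewrite -prim_cst//; apply: eq_prim => r /andP[_ rt].
by rewrite /glue (le_trans rt ts).
Qed.

Lemma prim_glue_after a b s t c f : a <= s -> s <= t -> t <= b -> itg s b f ->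
  prim a (glue s c f) t = c * (s - a) + prim s f t.
Proof.
move=> as0 st tb fi; have gi := itg_glue c as0 (le_trans st tb) fi.
rewrite (@prim_split _ a s t)//; last exact: itgS (lexx _) tb gi.
rewrite prim_glue_before//; congr (_ + _); apply: eq_prim_oc => //.
- exact: itgS as0 tb gi.
- exact: itgS (lexx _) tb fi.
- by move=> r /andP[sr _]; rewrite /glue leNgt sr.
Qed.

End piecewise.

Lemma near_enorm (R : realType) n (x : 'rV[R]_n) (e : R) : 0 < e ->
  nbhs x [set y | enorm (y - x) < e].
Proof.
move=> e0.
have c : continuous (fun y : 'rV[R]_n => enorm (y - x)).
  apply: (@enorm_lipschitz_continuous R R^o n _ 1) => u v; rewrite mul1r.
  by apply: le_trans (norm_dist_enorm _ _) _; rewrite opprB addrA subrK.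
have := c x; rewrite /continuous_at subrr enorm0 => /cvgrPdist_lt /(_ e e0).
by apply: filterS => y; rewrite sub0r normrN ger0_norm ?enorm_ge0.
Qed.

(** * Locally Lipschitz functions on balls *)

Section locally_lipschitz.
Context {R : realType} {n : nat}.
Variable g : 'rV[R]_n -> R.
Hypothesis gL : loc_lipschitz_Rn g.

Lemma loc_lipschitz_continuous : continuous g.
Proof.
move=> z; have [r [L [r0 h]]] := gL z; apply/cvgrPdist_lt => e e0.
have L0 : 0 < `|L| + 1 by rewrite ltr_wpDl.
have m0 : 0 < Num.min r (e / (`|L| + 1)) by rewrite lt_min r0 divr_gt0.
move: (near_enorm z m0); apply: filterS => y /=.
rewrite lt_min => /andP[yr ye].
have zr : enorm (z - z) < r by rewrite subrr enorm0.
apply: le_lt_trans (h z y zr yr) _; rewrite enormB.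
move: ye; rewrite ltr_pdivlMr// mulrC; apply: le_lt_trans.
by rewrite ler_wpM2r ?enorm_ge0//; have := ler_norm L; lra.
Qed.

(** Compactness makes the local radii and constants uniform. Pairs of points farther apart than the
    common radius are handled by the bound [G] on [|g|]. *)
Lemma loc_lipschitz_ball (rho : R) : exists2 L : R, 0 <= L &
  forall y y', enorm y <= rho -> enorm y' <= rho -> `|g y - g y'| <= L * enorm (y - y').
Proof.
have cB := @enorm_ball_compact R n rho.
have [G hG] : exists G : R, forall y, enorm y <= rho -> `|g y| <= G.
  have [r0|r0] := leP 0 rho; last first.
    by exists 0 => y yr; have := le_lt_trans yr r0; rewrite ltNge enorm_ge0.
  have [|||c _ hc] := @EVT_max_rV R n (fun y => `|g y|) [set p | enorm p <= rho].
  - by exists 0; rewrite /= enorm0.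
  - exact: cB.
  - apply: continuous_subspaceT => y.
    exact: (cvg_norm (@loc_lipschitz_continuous y)).
  by exists `|g c| => y yr; apply: hc; rewrite inE.
have [N hN] : exists N : nat, forall y, enorm y <= rho ->
    forall y', enorm (y' - y) < N.+1%:R^-1 -> `|g y - g y'| <= N%:R * enorm (y - y').
  (* A single index serves as inverse radius and as Lipschitz constant, so that [P] holds for all
     large [j] near each point, as the compactness argument requires. *)
  pose P (j : nat) (y : 'rV[R]_n) := forall y', enorm (y' - y) < j.+1%:R^-1 ->
    `|g y - g y'| <= j%:R * enorm (y - y').
  have : \forall j \near \oo, [set p : 'rV[R]_n | enorm p <= rho] `<=` P j.
    apply: (compact_near_coveringP _).1 => // x _.
    have [r [L [r0 h]]] := gL x.
    have r20 : 0 < r / 2 by rewrite divr_gt0.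
    have n1 := near_enorm x r20.
    have n2 := near_infty_natSinv_lt (PosNum r20).
    have n3 := @nbhs_infty_ger R L.
    exists ([set y | enorm (y - x) < r / 2],
      [set j : nat | j.+1%:R^-1 < r / 2 /\ L <= j%:R]) => /=.
      by split => //; exact: filterI n2 n3.
    move=> [y j] /= [yx [jr Lj]] y' y'y.
    apply: le_trans (h y y' _ _) _.
    - by apply: lt_trans yx _; lra.
    - apply: le_lt_trans (enorm_trans y _ _) _.
      by move: (lt_trans y'y jr) yx; lra.
    - by rewrite ler_wpM2r ?enorm_ge0.
  move=> [N _ hN]; exists N => y yr; exact: hN N (leqnn N) y yr.
have G0 : 0 <= `|G| by [].
exists (N%:R + 2 * `|G| * N.+1%:R); first by rewrite addr_ge0// !mulr_ge0.
move=> y y' yr y'r; rewrite mulrDl.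
have [near|far] := ltP (enorm (y' - y)) N.+1%:R^-1.
  apply: le_trans (hN y yr y' near) _; rewrite lerDl.
  by rewrite !mulr_ge0 ?enorm_ge0.
apply: (@le_trans _ _ (2 * `|G|)).
  apply: le_trans (ler_normB _ _) _.
  by have := hG y yr; have := hG y' y'r; have := ler_norm G; lra.
have h1 : 1 <= N.+1%:R * enorm (y - y').
  by rewrite enormB -ler_pdivrMl// mulr1.
have h2 : 2 * `|G| * 1 <= 2 * `|G| * (N.+1%:R * enorm (y - y')).
  by rewrite ler_wpM2l// mulr_ge0.
have h3 : 0 <= N%:R * enorm (y - y') by rewrite mulr_ge0 ?enorm_ge0.
by move: h2; rewrite mulr1 mulrA => h2; apply: le_trans h2 _; rewrite lerDr.
Qed.

End locally_lipschitz.

(** * Consequences of continuity in time *)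

Section regularity.
Context {R : realType} {n : nat}.
Variables (T : R) (H : R -> 'rV[R]_n -> 'rV[R]_n -> R).
Hypothesis T0 : 0 < T.
Hypothesis Hcont : {within [set z : R * 'rV[R]_n * 'rV[R]_n | 0 <= z.1.1 <= T],
     continuous (fun z : R * 'rV[R]_n * 'rV[R]_n => H z.1.1 z.1.2 z.2)}.

Lemma hamiltonian_along_curve (s t : R) (y : R -> 'rV[R]_n) (L : R) p :
  0 <= s -> t <= T ->
  (forall a b, s <= a -> a <= b -> b <= t -> enorm (y b - y a) <= L * (b - a)) ->
  {within `[s, t], continuous (fun r => H r (y r) p)}.
Proof.
move=> s0 tT yL; apply/subspace_continuousP => r rD.
have rD' : s <= r <= t by move: rD; rewrite /= in_itv.
have /subspace_continuousP Hc := Hcont.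
have FW : Filter (within `[s, t] (nbhs r)) by exact: within_filter.
have cy : y r' @[r' --> within `[s, t] (nbhs r)] --> y r.
  apply/cvgrPdist_lt => e e0.
  have L0 : 0 < `|L| + 1 by rewrite ltr_wpDl.
  apply/nbhs_ballP; exists (e / (`|L| + 1)); first exact: divr_gt0.
  move=> r' rr' r'D; have {}r'D : s <= r' <= t by move: r'D; rewrite /= in_itv.
  apply: le_lt_trans (norm_le_enorm _) _.
  have : enorm (y r - y r') <= `|L| * `|r - r'|.
    have h a b : s <= a -> a <= b -> b <= t -> enorm (y b - y a) <= `|L| * `|b - a|.
      move=> sa ab bt; apply: le_trans (yL a b sa ab bt) _.
      by rewrite [`|b - a|]ger0_norm ?subr_ge0// ler_wpM2r ?subr_ge0// ler_norm.
    have /andP[sr rt] := rD'; have /andP[sr' r't] := r'D.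
    have [rr|rr] := leP r' r; first exact: h.
    by rewrite enormB distrC; apply: h => //; exact: ltW.
  move: rr'; rewrite /ball/= ltr_pdivlMr// mulrC => rr' h.
  apply: le_lt_trans h (le_lt_trans _ rr').
  by rewrite ler_wpM2r// lerDl.
have cid : r' @[r' --> within `[s, t] (nbhs r)] --> r by exact: cvg_within.
have c3 : (r', y r', p) @[r' --> within `[s, t] (nbhs r)] --> (r, y r, p).
  exact: (cvg_pair (cvg_pair cid cy) (cvg_cst p)).
have rS : [set z : R * 'rV[R]_n * 'rV[R]_n | 0 <= z.1.1 <= T] (r, y r, p).
  by move: rD' => /andP[h1 h2] /=; rewrite (le_trans s0 h1) (le_trans h2 tT).
move=> U /(Hc (r, y r, p) rS) hU.
have := c3 _ hU; rewrite /within /= nbhs_filterE => hW.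
apply: (@filterS _ _ (nbhs_filter r) _ _ _ hW) => r' + r'D => /(_ r'D); apply.
by move: r'D; rewrite /= in_itv/= => /andP[h1 h2]; rewrite (le_trans s0 h1) (le_trans h2 tT).
Qed.

Lemma continuous_bounded (f : R -> R) : {within `[0, T], continuous f} ->
  exists2 M : R, 0 < M & forall t, 0 <= t <= T -> `|f t| <= M.
Proof.
move=> cf.
have [c1 _ h1] := EVT_max (ltW T0) cf; have [c2 _ h2] := EVT_min (ltW T0) cf.
exists (`|f c1| + `|f c2| + 1); first by rewrite ltr_wpDl// addr_ge0.
move=> t tD; have tI : t \in `[0, T] by rewrite in_itv.
have := h1 t tI; have := h2 t tI; have := ler_norm (f c1).
have := lerNnormlW (lexx `|f c2|); have := normr_ge0 (f c1); have := normr_ge0 (f c2).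
by rewrite ler_norml => *; apply/andP; split; lra.
Qed.

End regularity.

(** * The value function *)

Lemma norm_dist_two_sided (R : realType) (a b u w : R) : 0 <= u -> 0 <= w ->
  b <= a + u -> a <= b + w -> `|a - b| <= u + w.
Proof. by move=> u0 w0 ba ab; rewrite ler_norml; apply/andP; split; lra. Qed.

Section value_function.
Context {R : realType} {n : nat}.
Variables (T : R) (H : R -> 'rV[R]_n -> 'rV[R]_n -> R) (C : R) (K : R -> R) (C0 : R).
Hypothesis T0 : 0 <= T.
Hypothesis regH : regular_hamiltonian T H C K.
Hypothesis H00 : forall t, 0 <= t <= T -> `|H t 0 0| <= C0.
Hypothesis K0 : forall r, 0 < r -> 0 < K r.
Variable mu : {measure set (Borel R n.+1) -> \bar R}.
Hypothesis smu : sphere_measure mu.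
Variable g : 'rV[R]_n -> R.
Hypothesis gL : loc_lipschitz_Rn g.
Implicit Types (x : 'rV[R]_n) (t s : R).

Let val t x := value (steiner_f mu H) (steiner_l mu H) g T t x.

Let Cge0 : 0 <= C. Proof. by case: regH. Qed.

Lemma trajectory_bound t0 x0 y v eta d B : 0 <= t0 ->
  qtraj T H t0 x0 y v eta d B ->
  (forall t, t0 <= t <= T -> enorm (v t) <= C * (1 + enorm (y t))) ->
  forall t, t0 <= t <= T ->
    1 + enorm (y t) <= 2 * (1 + enorm x0) * expR (2 * (C + 1) * T).
Proof.
move=> t00 q vy t tD.
apply: le_trans (gronwall regH (q_meas q) (q_bound q) (q_curve q) vy tD) _.
rewrite ler_wpM2l ?mulr_ge0 ?addr_ge0 ?enorm_ge0// ler_expR.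
rewrite ler_wpM2l ?mulr_ge0 ?addr_ge0// lerBlDr.
by case/andP: tD => _ tT; rewrite (le_trans tT)// lerDl.
Qed.

(** Correcting the curve costs a multiple of the integrated defect in [eta] and in the end point;
    the Lipschitz constant of [g] on a large ball converts the latter. The constant [A] depends on
    [M] only, which is what makes it usable for a whole neighbourhood of initial data. *)
Lemma value_le_defect (M : R) : exists2 A : R, 0 <= A &
  forall t0 x0 y v eta d B, 0 <= t0 -> t0 <= T -> 1 + enorm x0 <= M ->
    qtraj T H t0 x0 y v eta d B -> (forall t, t0 <= t <= T -> 1 + enorm (y t) <= M) ->
    (val t0 x0 <= (g (y T) + prim t0 eta T + A * prim t0 d T)%:E)%E.
Proof.
pose r : R := Num.max 1 (M * expR ((C + 1) * T)).
have r0 : 0 < r by rewrite lt_max ltr01.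
pose Rg : R := 2 * M * expR (2 * (C + 1) * T).
have [L L0 hL] := loc_lipschitz_ball gL Rg.
pose A1 : R := 12 * expR (8 * K r * T).
have A10 : 0 < A1 by rewrite mulr_gt0// expR_gt0.
have A0 : 0 < (L + 1) * A1 by rewrite mulr_gt0// ltr_wpDl.
exists ((L + 1) * A1); first exact: ltW.
move=> t0 x0 y0 v0 eta0 d B t00 t0T Mx0 q y0M; apply/lee_addgt0Pr => e e0.
have M0 : 0 <= M by apply: le_trans Mx0; rewrite addr_ge0// enorm_ge0.
have T1 : 0 < T + 1 by rewrite ltr_wpDl.
(* Chosen so that the term [eps * (T + 1)] of the correction contributes exactly [e]. *)
pose eps : R := e / ((L + 1) * A1 * (T + 1)).
have eps0 : 0 < eps by rewrite divr_gt0// mulr_gt0.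
have Mr : M * expR ((C + 1) * (T - t0)) <= r.
  rewrite le_max; apply/orP; right; rewrite ler_wpM2l// ler_expR.
  by rewrite ler_wpM2l ?addr_ge0// gerBl.
have [y [v [eta [B' [q' yT etaT]]]]] :=
  filippov regH t00 t0T Mx0 Mr (K0 r0) eps0 q y0M.
apply: le_trans (value_le_qtraj smu g t00 t0T q') _.
rewrite -EFinD lee_fin.
set I : R := prim t0 d T + eps * (T + 1) in yT etaT.
have TD : t0 <= T <= T by rewrite t0T lexx.
have vy t : t0 <= t <= T -> enorm (v t) <= C * (1 + enorm (y t)).
  move=> tD; have tT : 0 <= t <= T by case/andP: tD => h1 h2; rewrite (le_trans t00 h1).
  have := included_velocity regH tT (lexx 0) (q_incl q' tD).
  by rewrite addr0.
have E1 : 1 <= expR (2 * (C + 1) * T) :> R.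
  by rewrite -[leLHS]expR0 ler_expR mulr_ge0// mulr_ge0// addr_ge0.
have yR : enorm (y T) <= Rg.
  have h1 := trajectory_bound t00 q' vy TD.
  have h2 : 2 * (1 + enorm x0) * expR (2 * (C + 1) * T) <= Rg.
    by rewrite ler_wpM2r ?expR_ge0// ler_wpM2l.
  by lra.
have y0R : enorm (y0 T) <= Rg.
  have h1 := y0M T TD.
  have h2 : M * 1 <= M * expR (2 * (C + 1) * T) by rewrite ler_wpM2l.
  by rewrite /Rg; lra.
have h1 := hL (y T) (y0 T) yR y0R.
have h2 : L * enorm (y T - y0 T) <= L * (A1 * I) by rewrite ler_wpM2l.
have h3 : (L + 1) * A1 * I = (L + 1) * A1 * prim t0 d T + e.
  by rewrite /I /eps; field; rewrite !lt0r_neq0// ltr_wpDl.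
have h4 := ler_norm (g (y T) - g (y0 T)).
have h5 : (L + 1) * A1 * I = L * (A1 * I) + A1 * I by ring.
move: etaT; rewrite -/A1 => etaT.
by lra.
Qed.

Lemma near_optimal t0 x0 (m : R) : 0 <= t0 -> t0 <= T -> (val t0 x0 < m%:E)%E ->
  exists y v eta d B, [/\ qtraj T H t0 x0 y v eta d B, prim t0 d T = 0,
    forall t, t0 <= t <= T -> enorm (v t) <= C * (1 + enorm (y t)) &
    g (y T) + prim t0 eta T < m].
Proof.
move=> t00 t0T /ereal_inf_lt[_ [[y a] /= adm <-]]; rewrite /cost => hm.
have lfin : (\int[@lebesgue_measure R]_(t in `[t0, T])
    (steiner_l mu H t (y t) (a t))%:E < +oo)%E.
  by move: hm; case: (integral _ _ _) => // r _; rewrite ltry.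
have [v [eta [d [B [q d0 vy etal]]]]] := admissible_qtraj regH H00 smu K0 t00 t0T adm lfin.
exists y, v, eta, d, B; split => //.
rewrite -lte_fin EFinD; apply: le_lt_trans hm.
by rewrite leeD2l.
Qed.

Lemma prim_sub_ge0 a b s t (f : R -> R) : a <= s -> s <= t -> t <= b -> itg a b f ->
  (forall r, a <= r <= b -> 0 <= f r) -> 0 <= prim s f t <= prim a f b.
Proof.
move=> as0 st tb fi f0.
have ge0 u w : a <= u -> u <= w -> w <= b -> 0 <= prim u f w.
  move=> au uw wb; rewrite -(mul0r (w - u)) -prim_cst//; apply: le_prim => //.
  - exact: itg_cst.
  - exact: itgS fi.
  - by move=> r /andP[ur rw]; apply: f0; rewrite (le_trans au ur) (le_trans rw wb).
rewrite ge0//= (@prim_split _ a s b)//; last exact: le_trans tb.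
rewrite (@prim_split _ s t b)//; last exact: itgS fi.
have := ge0 a s (lexx a) as0 (le_trans st tb).
have := ge0 t b (le_trans as0 st) tb (lexx b).
by lra.
Qed.

Let LB r : R := C0 + K r * r.

Lemma LB_ge0 r : 0 < r -> 0 <= LB r.
Proof.
move=> r0; rewrite addr_ge0 ?mulr_ge0 ?(ltW r0) ?(ltW (K0 r0))//.
by apply: le_trans (H00 (t := 0) _); rewrite ?lexx.
Qed.

Lemma running_cost_ge t0 x0 y v eta d B r a b : 0 < r -> 0 <= t0 ->
  qtraj T H t0 x0 y v eta d B -> prim t0 d T = 0 ->
  (forall t, t0 <= t <= T -> enorm (y t) <= r) ->
  t0 <= a -> a <= b -> b <= T -> - (LB r * (b - a)) <= prim a eta b.
Proof.
move=> r0 t00 q d0 yr t0a ab bT.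
have /andP[h1 h2] := prim_sub_ge0 t0a ab bT (q_defect q) (q_defect_ge0 q).
have da : prim a d b = 0 by apply/eqP; rewrite eq_le h1 -d0 h2.
have di := itgS t0a bT (q_defect q).
have ei := itgS t0a bT (q_eta q).
have ci := itg_cst a b (- LB r).
rewrite -[leLHS](subr0 _) -{1}da -mulNr -prim_cst// -primB//.
apply: le_prim => //; first exact: itgB.
move=> t /andP[at0 tb].
have tD : t0 <= t <= T by rewrite (le_trans t0a at0) (le_trans tb bT).
have tT : 0 <= t <= T by case/andP: tD => h3 ->; rewrite (le_trans t00 h3).
have := hamiltonian0_le regH H00 r0 (ltW (K0 r0)) tT (yr t tD).
have := q_incl q tD 0; rewrite dotv0r enorm0 addr0 mulr1 ler_norml -/(LB r).
by move=> h4 /andP[_ h5]; lra.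
Qed.

(** Standing still at no cost has a bounded defect. This provides a competitor from every initial
    point and bounds the price of waiting. *)
Lemma included_rest r t x : 0 < r -> 0 <= t <= T -> 1 + enorm x <= r ->
  included H t x 0 0 (LB r + C * r).
Proof.
move=> r0 tT xr p; rewrite dotv0l subr0.
have xr' : enorm x <= r by move: xr; lra.
have [_ hC _ _ _] := regH.
have := hamiltonian0_le regH H00 r0 (ltW (K0 r0)) tT xr'; rewrite -/(LB r).
have := hC t x p 0 tT; rewrite subr0 !ler_norml => /andP[h1 _] /andP[h2 _].
have h3 : C * (1 + enorm x) * enorm p <= C * r * enorm p.
  by rewrite ler_wpM2r ?enorm_ge0// ler_wpM2l.
have h4 : 0 <= LB r * enorm p by rewrite mulr_ge0 ?enorm_ge0 ?LB_ge0.
have h5 : 0 <= C * r by rewrite mulr_ge0// ltW.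
by rewrite mulrDr mulr1 mulrDl; move: h1 h2 h3 h4 h5; lra.
Qed.

(** Correcting the constant curve excludes [+oo]; the lower bounds on the running cost and on [g]
    along trajectories exclude [-oo]. *)
Lemma value_finite t0 x0 : 0 <= t0 -> t0 <= T -> exists w : R, val t0 x0 = w%:E.
Proof.
move=> t00 t0T.
have [A A0 hA] := value_le_defect (1 + enorm x0).
have r1 : 0 < 1 + enorm x0 by rewrite ltr_pwDl// enorm_ge0.
have D0 : 0 <= LB (1 + enorm x0) + C * (1 + enorm x0).
  by rewrite addr_ge0 ?LB_ge0// mulr_ge0// ltW.
have q : qtraj T H t0 x0 (fun=> x0) (fun=> 0) (fun=> 0)
    (fun=> LB (1 + enorm x0) + C * (1 + enorm x0)) 0.
  split.
  - move=> i; rewrite (_ : (fun t => _) = cst 0) //.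
    by apply/funext => t; rewrite mxE.
  - by move=> t _; rewrite enorm0.
  - exact: itg_cst.
  - exact: itg_cst.
  - by [].
  - move=> t /andP[tt _]; rewrite (_ : vprim _ _ _ = 0) ?addr0//.
    by apply/rowP => i; rewrite !mxE prim_cst// mul0r.
  - move=> t /andP[tt tT]; apply: included_rest => //.
    by rewrite (le_trans t00 tt).
have := hA t0 x0 _ _ _ _ _ t00 t0T (lexx _) q (fun t _ => lexx _).
case vE : (val t0 x0) => [w| |] // _; first by exists w.
pose X : R := 2 * (1 + enorm x0) * expR (2 * (C + 1) * T).
have X0 : 0 < X by rewrite !mulr_gt0// expR_gt0.
have [L L0 hL] := loc_lipschitz_ball gL X.
(* The threshold is a lower bound for the cost of every trajectory from [x0]; a value [-oo] would
   produce one strictly below it. *)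
have [|y [v [eta [d [B [q' d0 vy hm]]]]]] :=
  @near_optimal t0 x0 (g 0 - L * X - LB X * (T - t0)) t00 t0T.
  by rewrite vE ltNyr.
have yX t : t0 <= t <= T -> enorm (y t) <= X.
  by move=> tD; have := trajectory_bound t00 q' vy tD; rewrite -/X; lra.
have h1 := running_cost_ge X0 t00 q' d0 yX (lexx t0) t0T (lexx T).
have TD : t0 <= T <= T by rewrite t0T lexx.
have z0 : enorm (0 : 'rV[R]_n) <= X by rewrite enorm0 ltW.
have := hL (y T) 0 (yX T TD) z0; rewrite subr0 ler_norml => /andP[h2 _].
have h3 : L * enorm (y T) <= L * X by rewrite ler_wpM2l// yX.
by move: h1 h2 h3 hm; lra.
Qed.

Section local_estimates.
Variable rho : R.
Hypothesis rho0 : 0 <= rho.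

(** [X] bounds trajectories started in the ball of radius [rho]; [M] leaves room for their
    translates, by at most [rho + X] or [2 * rho] in the two estimates. *)
Let X : R := 2 * (1 + rho) * expR (2 * (C + 1) * T).
Let M : R := 1 + 2 * rho + 2 * X.

Let XE : 1 + rho <= X.
Proof.
have E1 : 1 <= expR (2 * (C + 1) * T) :> R.
  by rewrite -[leLHS]expR0 ler_expR mulr_ge0// mulr_ge0// addr_ge0.
have : (1 + rho) * 1 <= (1 + rho) * expR (2 * (C + 1) * T) by rewrite ler_wpM2l// addr_ge0.
by rewrite /X; move: rho0; lra.
Qed.

Let X0 : 0 < X. Proof. by move: XE rho0; lra. Qed.
Let M0 : 0 < M. Proof. by rewrite /M; move: X0 rho0; lra. Qed.

Let traj_X t0 x0 y v eta d B : 0 <= t0 -> enorm x0 <= rho ->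
  qtraj T H t0 x0 y v eta d B ->
  (forall t, t0 <= t <= T -> enorm (v t) <= C * (1 + enorm (y t))) ->
  forall t, t0 <= t <= T -> 1 + enorm (y t) <= X.
Proof.
move=> t00 xr q vy t tD; apply: le_trans (trajectory_bound t00 q vy tD) _.
by rewrite ler_wpM2r ?expR_ge0// ler_wpM2l// lerD2l.
Qed.

(** A nearly optimal curve from [(s1, y1)] is cut at [s2] and translated to start at [y2]. By (HLC)
    the translation by [del] creates a defect [K M * del], and the discarded piece had cost at least
    [- LB X * (s2 - s1)]. *)
Lemma value_later_le : exists2 L : R, 0 <= L & forall s1 s2 y1 y2 (w1 w2 : R),
  0 <= s1 -> s1 <= s2 -> s2 <= T -> enorm y1 <= rho -> enorm y2 <= rho ->
  val s1 y1 = w1%:E -> val s2 y2 = w2%:E ->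
  w2 <= w1 + L * ((s2 - s1) + enorm (y1 - y2)).
Proof.
have [A A0 hA] := value_le_defect M.
have [Lg Lg0 hLg] := loc_lipschitz_ball gL M.
have KM0 := K0 M0.
pose Q : R := Lg + A * (K M * T).
have Q0 : 0 <= Q by rewrite addr_ge0// mulr_ge0// mulr_ge0// ltW.
have LBX := LB_ge0 X0.
have CX0 : 0 <= C * X by rewrite mulr_ge0// ltW.
(* [LB X] pays for the discarded piece. [Q] is the cost per unit of translation, whose length is at
   most [C * X * (s2 - s1) + enorm (y1 - y2)]. *)
exists (LB X + Q * (C * X + 1)); first by rewrite addr_ge0// mulr_ge0// addr_ge0.
move=> s1 s2 y1 y2 w1 w2 s10 s12 s2T y1r y2r v1 v2; apply/ler_addgt0Pr => e e0.
have s20 := le_trans s10 s12; have s1T := le_trans s12 s2T.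
have [|x [v [eta [d [B [q d0 vx J]]]]]] := @near_optimal s1 y1 (w1 + e) s10 s1T.
  by rewrite v1 lte_fin ltrDl.
have xX := traj_X s10 y1r q vx.
have sD t : s2 <= t <= T -> s1 <= t <= T by move=> /andP[h ->]; rewrite (le_trans s12 h).
have s2D : s1 <= s2 <= T by rewrite s12.
pose del : R := enorm (x s2 - y2).
have del0 : 0 <= del by exact: enorm_ge0.
have vi : vitg s1 T v := vitg_bounded (q_meas q) (q_bound q).
pose y t := y2 + vprim s2 v t.
have yE t : s2 <= t <= T -> y t = x t + (y2 - x s2).
  move=> tD; have /andP[h1 h2] := tD.
  rewrite (q_curve q (sD t tD)) (q_curve q s2D) /y.
  rewrite (@vprim_split _ _ s1 s2 t)//; last exact: vitgS (lexx _) h2 vi.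
  by apply/rowP => i; rewrite !mxE; ring.
have yM t : s2 <= t <= T -> 1 + enorm (y t) <= M.
  move=> tD; rewrite (yE t tD); have := xX t (sD t tD); have := xX s2 s2D.
  have := enormD (x t) (y2 - x s2); have := enormD y2 (- x s2); rewrite enormN.
  by rewrite /M; move: rho0 y2r; lra.
have xM t : s1 <= t <= T -> enorm (x t) <= M.
  by move=> tD; have := xX t tD; rewrite /M; move: rho0 X0; lra.
have yM' t : s2 <= t <= T -> enorm (y t) <= M by move=> /yM; lra.
have q2 : qtraj T H s2 y2 y v eta (fun t => d t + K M * del) B.
  split => //.
  - move=> i; apply: (@measurable_funS _ _ _ _ `[s1, T]) (q_meas q i) => //.
  - by move=> t /sD; exact: q_bound q t.
  - exact: itgS s12 (lexx _) (q_eta q).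
  - by apply: itgD; [exact: itgS s12 (lexx _) (q_defect q)|exact: itg_cst].
  - move=> t /sD tD; rewrite addr_ge0 ?(q_defect_ge0 q)// mulr_ge0//; exact: ltW.
  - move=> t tD; have tT : 0 <= t <= T by case/andP: tD => h1 ->; rewrite (le_trans s20 h1).
    have := included_move regH M0 tT (xM t (sD t tD)) (yM' t tD) (q_incl q (sD t tD)).
    suff -> : x t - y t = x s2 - y2 by [].
    by rewrite yE//; apply/rowP => i; rewrite !mxE; ring.
have y2M : 1 + enorm y2 <= M by rewrite /M; move: rho0 X0 y2r; lra.
have := hA s2 y2 y v eta _ B s20 s2T y2M q2 yM; rewrite v2 lee_fin => h1.
have dE : prim s2 (fun t => d t + K M * del) T = K M * del * (T - s2).
  rewrite primD; [|exact: itgS s12 (lexx _) (q_defect q)|exact: itg_cst].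
  have /andP[h2 h3] := prim_sub_ge0 s12 s2T (lexx T) (q_defect q) (q_defect_ge0 q).
  rewrite prim_cst// (_ : prim s2 d T = 0) ?add0r//.
  by apply/eqP; rewrite eq_le h2 -d0 h3.
have h2 : A * prim s2 (fun t => d t + K M * del) T <= A * (K M * T) * del.
  have -> : A * (K M * T) * del = A * (K M * del * T) by ring.
  by rewrite dE ler_wpM2l// ler_wpM2l ?gerBl// mulr_ge0// ltW.
have TD2 : s2 <= T <= T by rewrite s2T lexx.
have h3 := hLg (y T) (x T) (yM' T TD2) (xM T (sD T TD2)).
have yx : enorm (y T - x T) = del.
  by rewrite yE// addrAC subrr add0r enormB.
rewrite yx in h3.
have h4 := ler_norm (g (y T) - g (x T)).
have xX' t : s1 <= t <= T -> enorm (x t) <= X by move=> /xX; lra.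
have h5 := running_cost_ge X0 s10 q d0 xX' (lexx s1) s12 s2T.
have h6 : prim s1 eta T = prim s1 eta s2 + prim s2 eta T.
  by apply: prim_split => //; exact: q_eta q.
have h7 : del <= C * X * (s2 - s1) + enorm (y1 - y2).
  apply: le_trans (enorm_trans y1 _ _) _; rewrite lerD2r.
  have vX t : s1 <= t <= T -> enorm (v t) <= C * X.
    by move=> tD; apply: le_trans (vx t tD) _; rewrite ler_wpM2l// xX.
  have := vprim_lipschitz (q_meas q) vX (lexx s1) s12 s2T.
  by rewrite vprim_start subr0 (q_curve q s2D) addrAC subrr add0r.
have h8 : Q * del <= Q * (C * X * (s2 - s1) + enorm (y1 - y2)) by rewrite ler_wpM2l.
have h9 : 0 <= LB X * enorm (y1 - y2) by rewrite mulr_ge0// enorm_ge0.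
have h10 : 0 <= Q * (C * X) * enorm (y1 - y2) by rewrite mulr_ge0 ?enorm_ge0// mulr_ge0.
have h11 : 0 <= Q * (s2 - s1) by rewrite mulr_ge0// subr_ge0.
have QE : Q * del = Lg * del + A * (K M * T) * del by rewrite /Q; ring.
have LE : (LB X + Q * (C * X + 1)) * ((s2 - s1) + enorm (y1 - y2)) =
  LB X * (s2 - s1) + LB X * enorm (y1 - y2) + Q * (C * X * (s2 - s1) + enorm (y1 - y2))
  + Q * (C * X) * enorm (y1 - y2) + Q * (s2 - s1) by ring.
rewrite LE; move: J h1 h2 h3 h4 h5 h6 h8 h9 h10 h11 QE.
move: (A * prim _ _ _) (A * (K M * T) * del) (Q * del) (Lg * del) => a1 a2 a3 a4.
move: (Q * (C * X * (s2 - s1) + enorm (y1 - y2))) (Q * (C * X) * enorm (y1 - y2)) => a5 a6.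
move: (Q * (s2 - s1)) (LB X * (s2 - s1)) (LB X * enorm (y1 - y2)) => a7 a8 a9.
move: (prim s1 eta T) (prim s2 eta T) (prim s1 eta s2) (g (x T)) (g (y T)) => b1 b2 b3 b4 b5.
by lra.
Qed.

(** The competitor waits at [y1] until [s2] and then follows the translate of a nearly optimal curve
    from [(s2, y2)]. Waiting has a defect at most [Dc] per unit of time, and the translation is by
    [y1 - y2]. *)
Lemma value_earlier_le : exists2 L : R, 0 <= L & forall s1 s2 y1 y2 (w1 w2 : R),
  0 <= s1 -> s1 <= s2 -> s2 <= T -> enorm y1 <= rho -> enorm y2 <= rho ->
  val s1 y1 = w1%:E -> val s2 y2 = w2%:E ->
  w1 <= w2 + L * ((s2 - s1) + enorm (y1 - y2)).
Proof.
have [A A0 hA] := value_le_defect M.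
have [Lg Lg0 hLg] := loc_lipschitz_ball gL M.
have KM0 := K0 M0.
pose Dc : R := LB X + C * X.
have Dc0 : 0 <= Dc by rewrite addr_ge0 ?LB_ge0// mulr_ge0// ltW.
pose Q : R := Lg + A * (K M * T).
have Q0 : 0 <= Q by rewrite addr_ge0// mulr_ge0// mulr_ge0// ltW.
exists (A * Dc + Q); first by rewrite addr_ge0// mulr_ge0.
move=> s1 s2 y1 y2 w1 w2 s10 s12 s2T y1r y2r v1 v2; apply/ler_addgt0Pr => e e0.
have s20 := le_trans s10 s12; have s1T := le_trans s12 s2T.
have [|x [v [eta [d [B [q d0 vx J]]]]]] := @near_optimal s2 y2 (w2 + e) s20 s2T.
  by rewrite v2 lte_fin ltrDl.
have xX := traj_X s20 y2r q vx.
pose del : R := enorm (y2 - y1).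
have del0 : 0 <= del by exact: enorm_ge0.
have vi : vitg s2 T v := vitg_bounded (q_meas q) (q_bound q).
pose v' t : 'rV[R]_n := if t <= s2 then 0 else v t.
have v'E i : (fun t => v' t 0 i) = glue s2 0 (fun t => v t 0 i).
  by apply/funext => t; rewrite /v' /glue; case: ifP; rewrite ?mxE.
pose y t := y1 + vprim s1 v' t.
have yE1 t : s1 <= t -> t <= s2 -> y t = y1.
  move=> h1 h2; rewrite /y (_ : vprim _ _ _ = 0) ?addr0//; apply/rowP => i.
  by rewrite !mxE v'E prim_glue_before// mul0r.
have yE2 t : s2 <= t <= T -> y t = x t + (y1 - y2).
  move=> tD; have /andP[h1 h2] := tD; rewrite (q_curve q tD) /y.
  have -> : vprim s1 v' t = vprim s2 v t.
    by apply/rowP => i; rewrite !mxE v'E (prim_glue_after _ s12 h1 h2)// mul0r add0r.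
  by apply/rowP => i; rewrite !mxE; ring.
have dich t : s1 <= t <= T -> (s1 <= t /\ t <= s2) \/ ((t <= s2) = false /\ s2 <= t <= T).
  move=> /andP[h1 h2]; have [h|h] := leP t s2; first by left.
  by right; rewrite h2 (ltW h).
have yM t : s1 <= t <= T -> 1 + enorm (y t) <= M.
  move=> /dich[[h1 h2]|[h1 h2]].
    by rewrite yE1// /M; move: y1r rho0 X0; lra.
  rewrite yE2//; have := xX t h2; have := enormD (x t) (y1 - y2).
  by have := enormD y1 (- y2); rewrite enormN /M; move: y1r y2r rho0 X0; lra.
have yM' t : s1 <= t <= T -> enorm (y t) <= M by move=> /yM; lra.
have xM t : s2 <= t <= T -> enorm (x t) <= M.
  by move=> tD; have := xX t tD; rewrite /M; move: rho0 X0; lra.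
have di : itg s2 T (fun t => d t + K M * del).
  by apply: itgD; [exact: q_defect q|exact: itg_cst].
have B0 : 0 <= B by apply: le_trans (enorm_ge0 (v s2)) (q_bound q _); rewrite lexx.
have q2 : qtraj T H s1 y1 y v' (glue s2 0 eta) (glue s2 Dc (fun t => d t + K M * del)) B.
  split => //.
  - by move=> i; rewrite v'E; apply: measurable_glue => //; exact: q_meas q i.
  - move=> t /dich[[h1 h2]|[h1 h2]]; rewrite /v'; first by rewrite h2 enorm0.
    by rewrite h1; exact: q_bound q t h2.
  - by apply: itg_glue => //; exact: q_eta q.
  - exact: itg_glue.
  - move=> t /dich[[h1 h2]|[h1 h2]]; rewrite /glue; first by rewrite h2.
    by rewrite h1 addr_ge0 ?(q_defect_ge0 q)// mulr_ge0// ltW.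
  - move=> t tD.
    have tT : 0 <= t <= T by case/andP: tD => h1 ->; rewrite (le_trans s10 h1).
    have [[h1 h2]|[h1 h2]] := dich t tD; rewrite /v' /glue.
      rewrite h2 yE1//; apply: included_rest => //.
      by move: XE y1r; lra.
    rewrite h1.
    have := included_move regH M0 tT (xM t h2) (yM' t tD) (q_incl q h2).
    suff -> : x t - y t = y2 - y1 by [].
    by rewrite yE2//; apply/rowP => i; rewrite !mxE; ring.
have y1M : 1 + enorm y1 <= M by rewrite /M; move: rho0 X0 y1r; lra.
have := hA s1 y1 y v' _ _ B s10 s1T y1M q2 yM; rewrite v1 lee_fin => h1.
have TD2 : s2 <= T <= T by rewrite s2T lexx.
have TD1 : s1 <= T <= T by rewrite s1T lexx.
have eE : prim s1 (glue s2 0 eta) T = prim s2 eta T.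
  by rewrite (prim_glue_after _ s12 s2T (lexx T) (q_eta q)) mul0r add0r.
have dE : prim s1 (glue s2 Dc (fun t => d t + K M * del)) T =
    Dc * (s2 - s1) + K M * del * (T - s2).
  rewrite (prim_glue_after _ s12 s2T (lexx T) di) primD; [|exact: q_defect q|exact: itg_cst].
  by rewrite d0 add0r prim_cst.
have h2 : A * prim s1 (glue s2 Dc (fun t => d t + K M * del)) T <=
    A * Dc * (s2 - s1) + A * (K M * T) * del.
  have -> : A * (K M * T) * del = A * (K M * del * T) by ring.
  rewrite dE mulrDr mulrA lerD2l ler_wpM2l// ler_wpM2l ?gerBl// mulr_ge0//.
  exact: ltW.
have h3 := hLg (y T) (x T) (yM' T TD1) (xM T TD2).
have yx : enorm (y T - x T) = del by rewrite yE2// addrAC subrr add0r enormB.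
rewrite yx in h3.
have h4 := ler_norm (g (y T) - g (x T)).
have QE : Q * del = Lg * del + A * (K M * T) * del by rewrite /Q; ring.
have dE' : enorm (y1 - y2) = del by rewrite enormB.
have h5 : 0 <= A * Dc * del by rewrite !mulr_ge0.
have h6 : 0 <= Q * (s2 - s1) by rewrite mulr_ge0// subr_ge0.
have LE : (A * Dc + Q) * ((s2 - s1) + enorm (y1 - y2)) =
  A * Dc * (s2 - s1) + A * Dc * del + Q * (s2 - s1) + Q * del by rewrite dE'; ring.
rewrite LE; move: J h1 h2 h3 h4 h5 h6 QE; rewrite eE.
move: (A * prim _ _ _) (A * Dc * (s2 - s1)) (A * Dc * del) (Q * (s2 - s1)) (Q * del).
by move: (A * _ * del) (Lg * del) (prim s2 eta T) => a1 a2 a3 a4 a5 a6 a7 a8; lra.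
Qed.

End local_estimates.

Lemma value_loc_lipschitz : exists W : R -> 'rV[R]_n -> R,
  (forall t0 x0, 0 <= t0 <= T -> val t0 x0 = (W t0 x0)%:E) /\
  loc_lipschitz_on_strip T W.
Proof.
have hW t x : 0 <= t <= T -> val t x = (fine (val t x))%:E.
  by move=> /andP[h1 h2]; have [w ->] := value_finite x h1 h2.
exists (fun t x => fine (val t x)); split => // s z sT.
have rho0 : 0 <= enorm z + 1 by rewrite addr_ge0// enorm_ge0.
have [L1 L10 h1] := value_later_le rho0.
have [L2 L20 h2] := value_earlier_le rho0.
have key s1 y1 s2 y2 : 0 <= s1 <= T -> 0 <= s2 <= T -> s1 <= s2 ->
    enorm (y1 - z) < 1 -> enorm (y2 - z) < 1 ->
    `|fine (val s1 y1) - fine (val s2 y2)| <=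
      (L1 + L2) * (`|s1 - s2| + enorm (y1 - y2)).
  move=> s1T s2T s12 y1z y2z.
  have r1 : enorm y1 <= enorm z + 1.
    by apply: le_trans (enorm_le_add _ z) _; rewrite lerD2l ltW.
  have r2 : enorm y2 <= enorm z + 1.
    by apply: le_trans (enorm_le_add _ z) _; rewrite lerD2l ltW.
  have /andP[s10 _] := s1T; have /andP[_ s2T'] := s2T.
  have a1 := h1 s1 s2 y1 y2 _ _ s10 s12 s2T' r1 r2 (hW s1 y1 s1T) (hW s2 y2 s2T).
  have a2 := h2 s1 s2 y1 y2 _ _ s10 s12 s2T' r1 r2 (hW s1 y1 s1T) (hW s2 y2 s2T).
  have -> : `|s1 - s2| = s2 - s1 by rewrite distrC ger0_norm// subr_ge0.
  have D0 : 0 <= (s2 - s1) + enorm (y1 - y2) by rewrite addr_ge0 ?enorm_ge0// subr_ge0.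
  have b1 : 0 <= L1 * ((s2 - s1) + enorm (y1 - y2)) by rewrite mulr_ge0.
  have b2 : 0 <= L2 * ((s2 - s1) + enorm (y1 - y2)) by rewrite mulr_ge0.
  by rewrite mulrDl; exact: norm_dist_two_sided.
exists 1, (L1 + L2); split => // s1 y1 s2 y2 s1T s2T _ y1z _ y2z.
have [s12|s21] := leP s1 s2; first exact: key.
by rewrite distrC (distrC s1) enormB; apply: key => //; exact: ltW.
Qed.

End value_function.

Unset Implicit Arguments.
Theorem theorem4p8 (R : realType) (n : nat) (T : R)
  (H : R -> 'rV[R]_n -> 'rV[R]_n -> R) (c : R -> R) (k : R -> R -> R)
  (g : 'rV[R]_n -> R) (mu : {measure set (Borel R n.+1) -> \bar R}) :
  0 < T ->
  (* (H1) *)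
  (forall x p, measurable_fun `[0, T] (fun t => H t x p)) ->
  (* (H2) *)
  (forall t, 0 <= t <= T ->
     continuous (fun xp : 'rV[R]_n * 'rV[R]_n => H t xp.1 xp.2)) ->
  (* (H3) *)
  (forall t x, 0 <= t <= T -> forall p q (lam : R), 0 <= lam <= 1 ->
     H t x (lam *: p + (1 - lam) *: q) <= lam * H t x p + (1 - lam) * H t x q) ->
  (* (H4) *)
  measurable_fun `[0, T] c ->
  (forall t, 0 <= t <= T -> 0 <= c t) ->
  (forall t x p q, 0 <= t <= T ->
     `|H t x p - H t x q| <= c t * (1 + enorm x) * enorm (p - q)) ->
  (* (HLC) *)
  (forall r : R, 0 < r -> measurable_fun `[0, T] (k r)) ->
  (forall r : R, 0 < r -> forall t, 0 <= t <= T -> 0 <= k r t) ->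
  (forall r : R, 0 < r -> forall t x y p, 0 <= t <= T ->
     enorm x <= r -> enorm y <= r ->
     `|H t x p - H t y p| <= k r t * (1 + enorm p) * enorm (x - y)) ->
  (* continuity of H (jointly), of c and of each k_R *)
  {within [set z : R * 'rV[R]_n * 'rV[R]_n | 0 <= z.1.1 <= T],
     continuous (fun z : R * 'rV[R]_n * 'rV[R]_n => H z.1.1 z.1.2 z.2)} ->
  {within `[0, T], continuous c} ->
  (forall r : R, 0 < r -> {within `[0, T], continuous (k r)}) ->
  (* mu: the normalized rotation-invariant measure on the unit sphere of R^{n+1} *)
  sphere_measure mu ->
  (* g locally Lipschitz *)
  loc_lipschitz_Rn g ->
  (* conclusion: V is finite and locally Lipschitz on [0,T] x R^n *)
  exists W : R -> 'rV[R]_n -> R,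
    (forall t0 x0, 0 <= t0 <= T ->
       value (steiner_f mu H) (steiner_l mu H) g T t0 x0 = (W t0 x0)%:E) /\
    loc_lipschitz_on_strip T W.
Proof.
move=> T0 _ _ Hconv _ c0 Hp _ k0 HLC Hcont ccont kcont smu gL.
(* Compactness of [[0, T]] turns [c] and each [k r] into the constants of [regular_hamiltonian]. *)
have [C Cgt0 cC] := continuous_bounded T0 ccont.
have Kex r : exists kr : R, 0 < r -> 0 < kr /\ forall t, 0 <= t <= T -> k r t <= kr.
  have [r0|] := ltP 0 r; last by exists 0.
  have [kr kr0 hk] := continuous_bounded T0 (kcont r r0); exists kr => _; split => // t tT.
  exact: le_trans (ler_norm _) (hk t tT).
have [K hK] := choice Kex.
have regH : regular_hamiltonian T H C K.
  split.
  - exact: ltW.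
  - move=> t x p q tT; apply: le_trans (Hp t x p q tT) _.
    rewrite ler_wpM2r ?enorm_ge0// ler_wpM2r ?addr_ge0 ?enorm_ge0//.
    exact: le_trans (ler_norm _) (cC t tT).
  - by move=> t x p q lam tT; exact: Hconv.
  - move=> r t x y p r0 tT xr yr; apply: le_trans (HLC r r0 t x y p tT xr yr) _.
    rewrite ler_wpM2r ?enorm_ge0// ler_wpM2r ?addr_ge0 ?enorm_ge0//.
    exact: (hK r r0).2.
  - move=> s t y L s0 tT yL p; have cH := @hamiltonian_along_curve R n T H Hcont s t y L p s0 tT yL.
    exact: (subspace_continuous_measurable_fun (measurable_itv `[s, t]) cH).
have [C0 _ H00] : exists2 C0 : R, 0 < C0 & forall t, 0 <= t <= T -> `|H t 0 0| <= C0.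
  apply: continuous_bounded => //.
  apply: (@hamiltonian_along_curve R n T H Hcont 0 T (fun=> 0) 0 0 (lexx 0) (lexx T)).
  by move=> a b _ _ _; rewrite subrr enorm0 mul0r.
exact: (value_loc_lipschitz (ltW T0) regH H00 (fun r r0 => (hK r r0).1) smu gL).
Qed.
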